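(* Let $n\ge 1$ be an integer, $x_0=(a_1,\dots,a_{2n},s)\in\mathbb{R}^{2n+1}$, $c\in\mathbb{R}$ with $c\neq 0$, $k\in\mathbb{R}$ with $k>0$, $1<p<\infty$, and $0<r<R$. Put $Q=2n+2k$, $\alpha=\frac{Q-p}{1-p}$, $$\psi(x_1,\dots,x_{2n},t)=\Big[c^2\Big(\sum_{l=1}^{2n}(x_l-a_l)^2\Big)^{2k}+(t-s)^2\Big]^{\frac{1}{4k}},$$ $B(x_0,\rho)=\{x\in\mathbb{R}^{2n+1}:\psi(x)<\rho\}$ for $\rho>0$, and $$\sigma_p=\int_{B(x_0,1)}\|\nabla_0\psi\|^p\,d\mathcal{L}_{2n+1},$$ which is a fixed positive constant. Then $$\operatorname{cap}_p\big(\overline{B(x_0,r)},B(x_0,R)\big)=\begin{cases}|\alpha|^{p-1}\,Q\,\sigma_p\,\big(r^\alpha-R^\alpha\big)^{1-p} & \text{when } 1<p<Q,\\[4pt] Q\,\sigma_Q\,\big[\log R-\log r\big]^{1-Q} & \text{when } p=Q,\\[4pt] \alpha^{p-1}\,Q\,\sigma_p\,\big(R^\alpha-r^\alpha\big)^{1-p} & \text{when } p>Q.\end{cases}$$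
   Context: The vector fields on $\mathbb{R}^{2n+1}$, with coordinates $(x_1,\dots,x_{2n},t)$, are $$X_i=\frac{\partial}{\partial x_i}+2kc\,(x_{i+n}-a_{i+n})\,\Sigma^{k-1}\frac{\partial}{\partial t}\quad(1\le i\le n),$$ $$X_i=\frac{\partial}{\partial x_i}-2kc\,(x_{i-n}-a_{i-n})\,\Sigma^{k-1}\frac{\partial}{\partial t}\quad(n+1\le i\le 2n),$$ where $\Sigma=\sum_{l=1}^{2n}(x_l-a_l)^2$. The horizontal gradient is $\nabla_0u=(X_1u,\dots,X_{2n}u)$, with $\|\nabla_0u\|^2=\sum_{i=1}^{2n}(X_iu)^2$. $\mathcal{L}_{2n+1}$ denotes Lebesgue measure on $\mathbb{R}^{2n+1}$. For a bounded open set $\Omega\subset\mathbb{R}^{2n+1}$ and a compact subset $K\subset\Omega$, the $p$-capacity is $$\operatorname{cap}_p(K,\Omega)=\inf\Big\{\int_\Omega\|\nabla_0u\|^p\,d\mathcal{L}_{2n+1}:\ u\in C_0^\infty(\Omega),\ u|_K=1\Big\}.$$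
   Formalization: σ_p is always positive, but it is finite only when (1−2k)p < 2n (e.g. n=1, k=1/4, p=4 gives σ_p=+∞); finiteness is asserted exactly in that range, and the three capacity formulas hold for all parameters as equalities in [0,+∞]. *)

(* Defs.v *)
From HB Require Import structures.
From mathcomp Require Import all_boot all_order all_algebra.
From mathcomp Require Import all_classical all_reals all_analysis.

Set Implicit Arguments.
Unset Strict Implicit.
Unset Printing Implicit Defensive.

Import Order.TTheory GRing.Theory Num.Theory.
Import numFieldNormedType.Exports.

Local Open Scope classical_set_scope.
Local Open Scope ring_scope.

(* The Borel sigma-algebra of R^m, generated by the coordinate functions; this
   is the construction that the library uses for m.-tuple, transported to row
   vectors because these carry the topology and the norm. *)
Definition measure_rV_display : measure_display -> measure_display.
Proof. exact. Qed.

Section rV_measurable.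
Context (R : realType) (m : nat).

Definition rV_coord (i : 'I_m) (x : 'rV[R]_m) : measurableTypeR R := x ord0 i.

Let rV_set0 : g_sigma_preimage rV_coord set0.
Proof. exact: sigma_algebra0. Qed.

Let rV_setC A : g_sigma_preimage rV_coord A -> g_sigma_preimage rV_coord (~` A).
Proof. exact: sigma_algebraC. Qed.

Let rV_bigcup (F : (set 'rV[R]_m)^nat) :
  (forall i, g_sigma_preimage rV_coord (F i)) ->
  g_sigma_preimage rV_coord (\bigcup_i (F i)).
Proof. exact: sigma_algebra_bigcup. Qed.

HB.instance Definition _ :=
  @isMeasurable.Build (measure_rV_display R.-ocitv.-measurable.-sigma)
  'rV[R]_m (g_sigma_preimage rV_coord) rV_set0 rV_setC rV_bigcup.

Lemma measurable_rV_coord (i : 'I_m) : measurable_fun [set: 'rV[R]_m] (rV_coord i).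
Proof.
move=> _ Y mY; rewrite setTI; apply: sub_sigma_algebra => /=.
rewrite -bigcup_seq/=; exists i => /=; first by rewrite mem_index_enum.
by exists Y => //; rewrite setTI.
Qed.

Lemma measurable_fun_rVP d (T : measurableType d) (f : T -> 'rV[R]_m) :
  (forall i, measurable_fun [set: T] (rV_coord i \o f)) ->
  measurable_fun [set: T] f.
Proof.
move=> mf _ A mA; rewrite setTI.
have : [set B | measurable (f @^-1` B)] A; last by [].
apply: mA; split; last first.
  move=> B /=; rewrite -bigcup_seq/= => -[i _ [C mC <-]].
  by rewrite setTI -[X in measurable X]setTI; exact: mf.
split => /=.
- by rewrite preimage_set0; exact: measurable0.
- move=> B mB /=; rewrite setTD preimage_setC; exact: measurableC.
- by move=> F mF /=; rewrite preimage_bigcup; exact: bigcupT_measurable.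
Qed.

End rV_measurable.

Definition rV_cons (R : realType) (m : nat)
    (z : 'rV[R]_m * measurableTypeR R) : 'rV[R]_m.+1 :=
  row_mx (z.2 : R)%:M z.1.

Lemma measurable_rV_cons (R : realType) (m : nat) :
  measurable_fun [set: 'rV[R]_m * measurableTypeR R] (@rV_cons R m).
Proof.
apply: measurable_fun_rVP => i.
rewrite -(@splitK 1 m i); case: (fintype.split _) => j /=.
  rewrite (_ : _ \o _ = snd); first exact: measurable_snd.
  apply/funext => z /=; apply: (etrans (row_mxEl _ _ _ _)).
  by rewrite mxE (ord1 j) eqxx mulr1n.
rewrite (_ : _ \o _ = rV_coord j \o fst).
  by apply: measurableT_comp; [exact: measurable_rV_coord|exact: measurable_fst].
by apply/funext => z /=; exact: row_mxEr.
Qed.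

Section rV_cons_measure.
Context (R : realType) (m : nat) (mu : {measure set 'rV[R]_m -> \bar R}).

Definition rV_cons_measure : set 'rV[R]_m.+1 -> \bar R :=
  pushforward (mu \x lebesgue_measure)%E (@rV_cons R m).

Let rV_cons_measure0 : rV_cons_measure set0 = 0%E.
Proof. by rewrite /rV_cons_measure /pushforward preimage_set0 measure0. Qed.

Let rV_cons_measure_ge0 A : (0 <= rV_cons_measure A)%E.
Proof. by rewrite /rV_cons_measure /pushforward measure_ge0. Qed.

Let rV_cons_measure_sigma_additive : semi_sigma_additive rV_cons_measure.
Proof.
exact: (@measure_semi_sigma_additive _ _ _
  (measure_function_pushforward__canonical__measure_function_Measure
    (mu \x lebesgue_measure)%E (@measurable_rV_cons R m))).
Qed.

HB.instance Definition _ := isMeasure.Build _ _ _ rV_cons_measure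
  rV_cons_measure0 rV_cons_measure_ge0 rV_cons_measure_sigma_additive.

End rV_cons_measure.

(* Lebesgue measure on R^m, as the m-fold product of Lebesgue measure on R. *)
Fixpoint lebesgue_rV (R : realType) (m : nat) :
    {measure set 'rV[R]_m -> \bar R} :=
  match m with
  | 0 => \d_ (0 : 'rV[R]_0)
  | m'.+1 => rV_cons_measure (lebesgue_rV R m')
  end.

(* R^(2n+1), a point being the pair ((x_1, ..., x_2n), t). *)
Notation "''H[' R ]_ n" := ('rV[R]_(n + n) * R)%type
  (at level 8, n at level 2, format "''H[' R ]_ n") : type_scope.

Definition lebesgue_H (R : realType) (n : nat) :
    set ('rV[R]_(n + n) * measurableTypeR R) -> \bar R :=
  (lebesgue_rV R (n + n) \x lebesgue_measure)%E.

HB.instance Definition _ (R : realType) (n : nat) :=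
  Measure.on (@lebesgue_H R n).

Section smooth_functions.
Context (R : realType) (n : nat).
Implicit Types u : 'H[R]_n -> R.

(* u is of class C^m: u is Frechet differentiable at every point and all its
   directional derivatives are of class C^(m-1). *)
Fixpoint class_C (m : nat) u : Prop :=
  match m with
  | 0 => continuous u
  | m'.+1 => (forall z, differentiable u z) /\
             forall v, class_C m' ('D_v u)
  end.

Definition smooth u := forall m, class_C m u.

Definition supp u : set 'H[R]_n := closure [set z | u z != 0].

(* C_0^oo(Omega), each function being extended by 0 outside Omega. *)
Definition test_function (Omega : set 'H[R]_n) : set ('H[R]_n -> R) :=
  [set u | [/\ smooth u, compact (supp u) & supp u `<=` Omega]].

End smooth_functions.

Section capacity.
Context (R : realType) (n : nat).
Variables (a : 'rV[R]_(n + n)) (c k : R).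
Implicit Types (u : 'H[R]_n -> R) (z : 'H[R]_n) (p : R).

Definition partial_x (i : 'I_(n + n)) u : 'H[R]_n -> R :=
  'D_((delta_mx ord0 i, 0) : 'H[R]_n) u.

Definition partial_t u : 'H[R]_n -> R := 'D_((0, 1) : 'H[R]_n) u.

Definition sumsq z : R := \sum_(l < n + n) (z.1 ord0 l - a ord0 l) ^+ 2.

(* X_i.  With 0-based indices, [lshift n j] is the index i = j < n, whose
   partner i + n is [rshift n j], and conversely.  At the points with
   sumsq z = 0, a Lebesgue-null set where sumsq z `^ (k - 1) is meaningless
   for k < 1, the other factor makes the coefficient of partial_t vanish. *)
Definition hfield (i : 'I_(n + n)) u z : R :=
  match fintype.split i with
  | inl j => partial_x i u z
      + 2 * k * c * (z.1 ord0 (rshift n j) - a ord0 (rshift n j))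
        * sumsq z `^ (k - 1) * partial_t u z
  | inr j => partial_x i u z
      - 2 * k * c * (z.1 ord0 (lshift n j) - a ord0 (lshift n j))
        * sumsq z `^ (k - 1) * partial_t u z
  end.

Definition hgrad u z : 'rV[R]_(n + n) := \row_i hfield i u z.

(* The Euclidean norm: the library's norm on row vectors is the sup norm. *)
Definition hgrad_norm u z : R :=
  Num.sqrt (\sum_(i < n + n) (hgrad u z ord0 i) ^+ 2).

Definition henergy p (Omega : set 'H[R]_n) u : \bar R :=
  (\int[@lebesgue_H R n]_(z in Omega) ((hgrad_norm u z) `^ p)%:E)%E.

Definition capacity p (K Omega : set 'H[R]_n) : \bar R :=
  ereal_inf [set henergy p Omega u | u in
    test_function Omega `&` [set u | forall z, K z -> u z = 1]].

End capacity.

Section gauge.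
Context (R : realType) (n : nat).
Variables (x0 : 'H[R]_n) (c k : R).

Definition gauge (z : 'H[R]_n) : R :=
  (c ^+ 2 * sumsq x0.1 z `^ (2 * k) + (z.2 - x0.2) ^+ 2) `^ (4 * k)^-1.

Definition gauge_ball (rho : R) : set 'H[R]_n := [set z | gauge z < rho].

(* Extended-real: it is +oo when (1 - 2k) p >= 2n, since the integrand is
   |c|^p (sumsq z)^((k - 1/2) p) (gauge z)^((1 - 2k) p). *)
Definition sigma (p : R) : \bar R := henergy x0.1 c k p (gauge_ball 1) gauge.

End gauge.

(* Main.v *)
From HB Require Import structures.
Require Import Defs.
From mathcomp Require Import all_boot all_order all_algebra.
From mathcomp Require Import all_classical all_reals all_analysis.
From mathcomp Require Import measurable_realfun.
From mathcomp Require Import ring lra.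

(** Let y = x - a, tau = t - s and S = |y|^2, let psi be the gauge, and let
    N = |c| S^(k - 1/2) psi^(1 - 2k), which is the norm of its horizontal
    gradient off the axis S = 0.  Under the dilations
    (y, tau) |-> (l y, l^(2k) tau) the gauge is of degree 1, Lebesgue measure
    is of degree Q = 2n + 2k, and N is of degree 0.  Let Lam be a primitive of
    x^(alpha - 1), namely x^alpha / alpha or ln, and let L = Lam R - Lam r.
    All three formulas then read cap = Q sigma_p L^(1 - p), which is
    [capacity_gauge].

    The minimizer is (Lam R - Lam psi) / L, truncated to [0, 1].  Since
    (alpha - 1) p = alpha - Q, its energy is L^(-p) times the integral of psi^(alpha - Q) N^p over the
    annulus r <= psi < R, and integration along the orbits of the dilations
    ([polar_const]) gives Q L sigma_p for the latter.

    Upper bound.  The minimizer is not smooth, and it has corners at the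
    spheres psi = r and psi = R.  Replacing S by S + e in psi makes it smooth,
    and the corners are removed by a smooth cutoff of slope at most exp (2d)
    together with a slightly larger inner radius r1 ([approx]).  Dominated
    convergence as e tends to 0 gives [capacity_le_approx]; then d tends to 0
    and r1 to r.

    Lower bound.  Let u be admissible, let E be the generator of the dilations
    and Th_j the generator of the rotations in the plane of the coordinates j
    and n + j.  Off the axis, the derivative of u in the direction of the
    horizontal gradient of psi is proportional to
    E u + tau / (c S^k) sum_j Th_j u, and the Cauchy-Schwarz inequality bounds
    N times the modulus of this sum by psi |grad u| ([euler_spin_le]).
    Integrate the sum against psi^(-Q) N^p over the annulus.  The integral of
    the term E u is minus Q sigma_p, because u goes from 1 to 0 along each
    orbit of the dilations; the terms Th_j u contribute 0, because their
    means over the rotation orbits vanish and the weight is invariant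
    ([rotation_average]).  Young's inequality with the scaling for which the
    minimizer gives equality yields the bound.  As N^p need not be integrable
    near the axis when k < 1/2, the argument is carried out with N^p
    restricted to |tau| <= M S^k ([weight_energy_le]), and M tends to infinity
    at the end ([energy_ge_sigma]); no finiteness of sigma_p is involved.

    Finally sigma_p is positive because N is ([sigma_gt0]).  It is finite if
    (1 - 2k) p < 2n ([sigma_lty]): for k >= 1/2 the function N is bounded, and
    for k < 1/2 the matter reduces to the integrability of |y|^(-b) near 0 in
    dimension 2n for b = (1 - 2k) p < 2n, which follows from the scaling by a
    factor 2. *)

Set Implicit Arguments.
Unset Strict Implicit.
Unset Printing Implicit Defensive.

Import Order.TTheory GRing.Theory Num.Theory.
Import numFieldNormedType.Exports.

Local Open Scope classical_set_scope.
Local Open Scope ring_scope.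

(** * Lebesgue measure on row vectors *)

Section lebV.
Context (R : realType).

(** A constant of its own, so that the sigma-finiteness instance is found on
    its head. *)
Definition lebV (m : nat) : set 'rV[R]_m -> \bar R := lebesgue_rV R m.

HB.instance Definition _ m := Measure.on (@lebV m).

Definition box (m : nat) (M : R) : set 'rV[R]_m :=
  [set x | forall i, `|x ord0 i| <= M].

Arguments box : clear implicits.

Lemma measurable_box m M : measurable (@box m M).
Proof.
rewrite (_ : box m M = \bigcap_(i in [set: 'I_m]) (rV_coord i @^-1` `[-M, M])).
  apply: fin_bigcap_measurable => // i _; rewrite -[X in measurable X]setTI.
  by apply: (@measurable_rV_coord R m i measurableT); exact: measurable_itv.
apply/seteqP; split=> x /=; first by move=> h i _ /=; rewrite in_itv/= -ler_norml; exact: h.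
by move=> h i; have := h i I; rewrite /= in_itv/= -ler_norml.
Qed.

Lemma lebVS m (A : set 'rV[R]_m.+1) :
  lebV A = ((@lebV m) \x (@lebesgue_measure R))%E (@rV_cons R m @^-1` A).
Proof. by []. Qed.

Lemma rV_cons0 m (z : 'rV[R]_m) (t : R) : rV_cons (z, t) ord0 ord0 = t.
Proof.
rewrite /rV_cons/= (_ : ord0 = lshift m (ord0 : 'I_1)); last exact/val_inj.
by etransitivity; [exact: row_mxEl|rewrite mxE eqxx mulr1n].
Qed.

Lemma rV_consS m (z : 'rV[R]_m) (t : R) (i : 'I_m) :
  rV_cons (z, t) ord0 (lift ord0 i) = z ord0 i.
Proof.
rewrite /rV_cons/= (_ : lift _ _ = rshift 1 i); last exact/val_inj.
exact: row_mxEr.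
Qed.

Lemma lebV_box_lty m M : (lebV (@box m M) < +oo)%E.
Proof.
elim: m => [|m IH]; first by rewrite /lebV/= diracE; case: (_ \in _); rewrite ltry.
rewrite lebVS (_ : _ @^-1` _ = box m M `*` `[-M, M]).
  rewrite product_measure1E//; [|exact: measurable_box].
  have mI : (lebesgue_measure [set` `[(- M)%R, M]] < +oo)%E.
    by rewrite lebesgue_measure_itv/=; case: ifP; rewrite ?ltry.
  by apply: lte_mul_pinfty => //; rewrite ge0_fin_numE.
apply/seteqP; split=> -[z t]/=.
  move=> h; split; last by rewrite in_itv/= -ler_norml -(rV_cons0 z t).
  by move=> i; rewrite -(rV_consS z t); exact: h.
move=> [hz]; rewrite in_itv/= -ler_norml => ht i.
by case: (unliftP ord0 i) => [j|] ->; rewrite ?rV_cons0// rV_consS.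
Qed.

Let lebV_sigma_finite m : sigma_finite setT (@lebV m).
Proof.
exists (fun N => box m N%:R).
  apply/seteqP; split=> // x _.
  exists (Num.truncn (`|x|)).+1 => // i.
  rewrite (le_trans _ (ltW (truncnS_gt _)))//.
  have -> : `|x| = mx_norm x by [].
  rewrite mx_normrE (le_trans _ (le_bigmax _ _ (ord0, i)))//.
by move=> N; split; [exact: measurable_box|exact: lebV_box_lty].
Qed.

HB.instance Definition _ m := @Measure_isSigmaFinite.Build _ _ _ (@lebV m)
  (@lebV_sigma_finite m).

Local Open Scope ereal_scope.

Lemma integral_lebVS m (F : 'rV[R]_m.+1 -> \bar R) :
  measurable_fun setT F -> (forall x, 0 <= F x) ->
  \int[@lebV m.+1]_x F x =
  \int[@lebV m]_x \int[lebesgue_measure]_t F (rV_cons (x, t)).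
Proof.
move=> mF F0.
have mFc : measurable_fun setT (F \o @rV_cons R m).
  by apply: measurableT_comp => //; exact: measurable_rV_cons.
rewrite -(fubini_tonelli1 _ mFc (fun z => F0 (rV_cons z))).
exact: (ge0_integral_pushforward (@measurable_rV_cons R m)
  ((@lebV m) \x (@lebesgue_measure R))%E measurableT mF (fun x _ => F0 x)).
Qed.

Lemma integral_lebVS2 m (F : 'rV[R]_m.+1 -> \bar R) :
  measurable_fun setT F -> (forall x, 0 <= F x) ->
  \int[@lebV m.+1]_x F x =
  \int[lebesgue_measure]_t \int[@lebV m]_x F (rV_cons (x, t)).
Proof.
move=> mF F0; rewrite integral_lebVS//.
have mFc : measurable_fun setT (F \o @rV_cons R m).
  by apply: measurableT_comp => //; exact: measurable_rV_cons.
exact: (fubini_tonelli _ mFc (fun z => F0 (rV_cons z))).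
Qed.

End lebV.

(** * Affine changes of variables, shears and rotations *)

#[local] Opaque rV_cons.

Section change_of_variables.
Context (R : realType).
Local Notation leb := (@lebesgue_measure R).

Lemma measurable_affine (l b : R) :
  measurable_fun setT (fun t : measurableTypeR R => l * t + b : measurableTypeR R).
Proof. by apply: measurable_funD => //; exact: measurable_funM. Qed.

(** The image of Lebesgue measure under t |-> l t + b, multiplied by l,
    gives every interval its length, so it is Lebesgue measure. *)
Lemma ge0_integral_affine (l b : R) (F : measurableTypeR R -> \bar R) : 0 < l ->
  measurable_fun setT F -> (forall t, 0 <= F t)%E ->
  (\int[leb]_t F t = l%:E * \int[leb]_t F (l * t + b)%R)%E.
Proof.
move=> l0 mF F0; pose phi (t : measurableTypeR R) : measurableTypeR R := l * t + b.
have mphi : measurable_fun setT phi by exact: measurable_affine.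
pose pf := measure_function_pushforward__canonical__measure_function_Measure leb mphi.
pose nu := mscale (NngNum (ltW l0)) pf.
transitivity (\int[nu]_t F t)%E.
  apply: eq_measure_integral => A mA _; apply: lebesgue_measure_unique => //= _ [[u v]] _ <-.
  rewrite /nu /mscale/= /pushforward.
  have -> : phi @^-1` `]u, v] = `](u - b) / l, (v - b) / l]%classic.
    apply/seteqP; split=> t; rewrite /= !in_itv/= /phi.
      by move=> /andP[h1 h2]; rewrite ltr_pdivrMr// ler_pdivlMr//; apply/andP; split; lra.
    by rewrite ltr_pdivrMr// ler_pdivlMr// => /andP[h1 h2]; apply/andP; split; lra.
  rewrite !lebesgue_measure_itv/= !lte_fin.
  rewrite ltr_pM2r ?invr_gt0// ltrD2r; case: ifP => _; last by rewrite mule0.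
  by rewrite -EFinD -EFinM; congr EFin; field; rewrite gt_eqF.
rewrite ge0_integral_mscale//=; congr (_ * _)%E.
by rewrite (ge0_integral_pushforward mphi).
Qed.

Lemma measurable_rV_axpy m (l : R) (b : 'rV[R]_m) :
  measurable_fun setT (fun x : 'rV[R]_m => l *: x + b).
Proof.
apply: measurable_fun_rVP => i.
rewrite (_ : _ \o _ = fun x => l * rV_coord i x + b ord0 i).
  apply: (measurableT_comp (measurable_affine l (b ord0 i))).
  exact: measurable_rV_coord.
by apply/funext => x; rewrite /rV_coord /= !mxE.
Qed.

Lemma measurable_rV_consl m (t : R) :
  measurable_fun setT (fun x : 'rV[R]_m => rV_cons (x, t)).
Proof.
by apply: measurableT_comp; [exact: measurable_rV_cons|exact: measurable_pair2].
Qed.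

Lemma measurable_rV_consr m (x : 'rV[R]_m) :
  measurable_fun setT (fun t : measurableTypeR R => rV_cons (x, t)).
Proof.
by apply: measurableT_comp; [exact: measurable_rV_cons|exact: measurable_pair1].
Qed.

Lemma rV_consP m (u v : 'rV[R]_m.+1) :
  u ord0 ord0 = v ord0 ord0 ->
  (forall i : 'I_m, u ord0 (lift ord0 i) = v ord0 (lift ord0 i)) -> u = v.
Proof.
by move=> h0 hS; apply/rowP => i; case: (unliftP ord0 i) => [j|] ->.
Qed.

Lemma ge0_integral_rV_affine m (l : R) (b : 'rV[R]_m) (F : 'rV[R]_m -> \bar R) :
  0 < l -> measurable_fun setT F -> (forall x, 0 <= F x)%E ->
  (\int[@lebV R m]_x F x = (l ^+ m)%:E * \int[@lebV R m]_x F (l *: x + b)%R)%E.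
Proof.
move=> l0; elim: m b F => [|m IH] b F mF F0.
  rewrite expr0 mul1e; apply: eq_integral => x _; congr F.
  by apply/rowP => -[].
rewrite [in LHS]integral_lebVS2// integral_lebVS2//; last first.
  by apply: measurableT_comp => //; exact: measurable_rV_axpy.
pose G (t : measurableTypeR R) :=
  (\int[@lebV R m]_x F (rV_cons ((l *: x + col' ord0 b)%R, t)))%E.
have mFc : measurable_fun setT (fun z : 'rV[R]_m * measurableTypeR R =>
    F (rV_cons (l *: z.1 + col' ord0 b, z.2))).
  apply: measurableT_comp => //; apply: measurableT_comp; first exact: measurable_rV_cons.
  apply/measurable_fun_pairP; split=> /=; last exact: measurable_snd.
  exact: (measurableT_comp (measurable_rV_axpy l (col' ord0 b)) measurable_fst).
have mG : measurable_fun setT G.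
  exact: (measurable_fun_fubini_tonelli_G _ mFc (fun z => F0 _)).
have G0 t : (0 <= G t)%E by exact: integral_ge0.
transitivity ((l ^+ m)%:E * \int[leb]_t G t)%E.
  rewrite -ge0_integralZl//; last by rewrite lee_fin exprn_ge0// ltW.
  apply: eq_integral => t _; apply: IH => [|x]; last exact: F0.
  by apply: measurableT_comp => //; exact: measurable_rV_consl.
rewrite (ge0_integral_affine (b ord0 ord0) l0 mG G0) muleA -EFinM exprSr; congr (_ * _)%E.
apply: eq_integral => t _; rewrite /G; apply: eq_integral => x _; congr F.
apply: rV_consP; first by rewrite !(rV_cons0, mxE).
by move=> i; rewrite !(rV_consS, mxE).
Qed.

Lemma measurable_rV_shear m (i : 'I_m) (g : 'rV[R]_m -> R) :
  measurable_fun setT g ->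
  measurable_fun setT (fun x : 'rV[R]_m => x + g x *: delta_mx ord0 i).
Proof.
move=> mg; apply: measurable_fun_rVP => j.
rewrite (_ : _ \o _ = fun x => rV_coord j x + g x * (j == i)%:R).
  apply: measurable_funD; first exact: measurable_rV_coord.
  by apply: measurable_funM.
by apply/funext => x; rewrite /rV_coord /= !mxE eqxx.
Qed.

(** By Tonelli's theorem, since on each line of direction i the shear is a
    translation. *)
Lemma ge0_integral_shear m (i : 'I_m) (g : 'rV[R]_m -> R) (F : 'rV[R]_m -> \bar R) :
  measurable_fun setT g ->
  (forall x t, g (x + t *: delta_mx ord0 i) = g x) ->
  measurable_fun setT F -> (forall x, 0 <= F x)%E ->
  (\int[@lebV R m]_x F (x + g x *: delta_mx ord0 i)%R = \int[@lebV R m]_x F x)%E.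
Proof.
elim: m i g F => [|m IH] i g F mg gi mF F0; first by case: i gi.
have mFg : measurable_fun setT (fun x : 'rV[R]_m.+1 => F (x + g x *: delta_mx ord0 i)).
  by apply: measurableT_comp => //; exact: measurable_rV_shear.
case: (unliftP ord0 i) gi mFg => [j|] -> gi mFg.
  rewrite !integral_lebVS2//; apply: eq_integral => t _.
  rewrite -(IH j (fun x : 'rV[R]_m => g (rV_cons (x, t))) (fun x : 'rV[R]_m => F (rV_cons (x, t))))//; last 3 first.
  - by apply: measurableT_comp => //; exact: measurable_rV_consl.
  - move=> x s; rewrite -(gi (rV_cons (x, t)) s); congr g; apply: rV_consP => [|k].
      by rewrite !(rV_cons0, mxE) mulr0 addr0.
    by rewrite !(rV_consS, mxE) (inj_eq lift_inj).
  - by apply: measurableT_comp => //; exact: measurable_rV_consl.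
  apply: eq_integral => x _; congr F; apply: rV_consP => [|k].
    by rewrite !(rV_cons0, mxE) mulr0 addr0.
  by rewrite !(rV_consS, mxE) (inj_eq lift_inj).
rewrite !integral_lebVS//; apply: eq_integral => x _.
have mFx : measurable_fun setT (fun t : measurableTypeR R => F (rV_cons (x, t))).
  by apply: measurableT_comp => //; exact: measurable_rV_consr.
rewrite [RHS](ge0_integral_affine (g (rV_cons (x, 0))) ltr01 mFx (fun t => F0 _)) mul1e.
apply: eq_integral => t _; congr F.
have -> : g (rV_cons (x, t)) = g (rV_cons (x, 0)).
  rewrite -(gi (rV_cons (x, 0)) t); congr g; apply: rV_consP => [|k].
    by rewrite !(rV_cons0, mxE) eqxx mulr1 add0r.
  by rewrite !(rV_consS, mxE) mulr0 addr0.
apply: rV_consP => [|k].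
  by rewrite !(rV_cons0, mxE) eqxx mulr1 mul1r.
by rewrite !(rV_consS, mxE) mulr0 addr0.
Qed.

(** The rotation about a of matrix (C, S; -S, C) in the plane of the
    coordinates i and j, written as a displacement along the two basis
    vectors. *)
Definition rotate m (i j : 'I_m) (a : 'rV[R]_m) (C S : R) (x : 'rV[R]_m) :=
  x + ((C - 1) * (x ord0 i - a ord0 i) + S * (x ord0 j - a ord0 j)) *: delta_mx ord0 i
    + ((C - 1) * (x ord0 j - a ord0 j) - S * (x ord0 i - a ord0 i)) *: delta_mx ord0 j.

(** A rotation is the product of the shears of slopes S / (1 + C), - S and S
    / (1 + C), except for the half turn C = -1, which is the square of a
    quarter turn. *)
Lemma ge0_integral_rotate m (i j : 'I_m) (a : 'rV[R]_m) (C S : R) (F : 'rV[R]_m -> \bar R) :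
  i != j -> C ^+ 2 + S ^+ 2 = 1 ->
  measurable_fun setT F -> (forall x, 0 <= F x)%E ->
  (\int[@lebV R m]_x F (rotate i j a C S x) = \int[@lebV R m]_x F x)%E.
Proof.
move=> ij.
have mc (k : 'I_m) (d : R) : measurable_fun setT (fun x : 'rV[R]_m => d * (x ord0 k - a ord0 k)).
  apply: measurable_funM => //; apply: measurable_funB => //.
  exact: measurable_rV_coord.
pose shear (k l : 'I_m) (d : R) (x : 'rV[R]_m) :=
  x + (d * (x ord0 l - a ord0 l)) *: delta_mx ord0 k.
have sh (k l : 'I_m) (d : R) (G : 'rV[R]_m -> \bar R) : k != l ->
    measurable_fun setT G -> (forall x, 0 <= G x)%E ->
    (\int[@lebV R m]_x G (shear k l d x) = \int[@lebV R m]_x G x)%E.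
  move=> kl mG G0; apply: (ge0_integral_shear (mc l d)) => // x t.
  by rewrite !mxE (eq_sym l) (negbTE kl) mulr0 addr0.
have shm (k l : 'I_m) (d : R) (G : 'rV[R]_m -> \bar R) : measurable_fun setT G ->
    measurable_fun setT (fun x => G (shear k l d x)).
  by move=> mG; apply: measurableT_comp => //; exact: measurable_rV_shear.
have gen D T (G : 'rV[R]_m -> \bar R) : D ^+ 2 + T ^+ 2 = 1 -> 1 + D != 0 ->
    measurable_fun setT G -> (forall x, 0 <= G x)%E ->
    measurable_fun setT (fun x : 'rV[R]_m => G (rotate i j a D T x)) /\
    (\int[@lebV R m]_x G (rotate i j a D T x) = \int[@lebV R m]_x G x)%E.
  move=> DT D1 mG G0; pose d := T / (1 + D).
  have Gm1 := shm i j d _ mG; have Gm2 := shm j i (- T) _ Gm1.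
  have Gm3 := shm i j d _ Gm2.
  rewrite -[in RHS](sh i j d _ ij mG G0).
  rewrite -[in RHS](sh j i (- T) _ _ Gm1)//; last by rewrite eq_sym.
  rewrite -[in RHS](sh i j d _ ij Gm2)//.
  have E x : rotate i j a D T x = shear i j d (shear j i (- T) (shear i j d x)).
    apply/rowP => k; rewrite /rotate /shear !mxE !eqxx/= (eq_sym j i) (negbTE ij) /d.
    have DE : T ^+ 2 = 1 - D ^+ 2 by lra.
    have [->|ki] := eqVneq k i.
      rewrite (negbTE ij) !(mulr0, mulr1, addr0); apply/eqP; rewrite -subr_eq0; apply/eqP.
      change (x 0 i) with (x ord0 i); move: (x ord0 i) (x ord0 j) (a ord0 i) (a ord0 j) => xi xj ai aj.
      transitivity ((T ^+ 2 - (1 - D ^+ 2)) *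
        ((xi - ai) / (1 + D) + T * (xj - aj) / (1 + D) ^+ 2)); last by rewrite DE; ring.
      by field.
    have [->|kj] := eqVneq k j; last by rewrite !(mulr0, addr0).
    rewrite !(mulr0, mulr1, addr0); apply/eqP; rewrite -subr_eq0; apply/eqP.
    change (x 0 j) with (x ord0 j); move: (x ord0 i) (x ord0 j) (a ord0 i) (a ord0 j) => xi xj ai aj.
    transitivity ((T ^+ 2 - (1 - D ^+ 2)) * (xj - aj) / (1 + D)); last by rewrite DE; ring.
    by field.
  split; last by apply: eq_integral => x _; rewrite E.
  by under eq_fun do rewrite E.
move=> CS mF F0; have [C1|] := eqVneq (1 + C) 0; last first.
  by move=> C1; have [] := gen C S F CS C1 mF F0.
have CE : C = -1 by lra.
have S0 : S = 0 by apply/eqP; rewrite -sqrf_eq0; apply/eqP; rewrite CE in CS; lra.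
have h01 : 0 ^+ 2 + 1 ^+ 2 = 1 :> R by ring.
have h1 : 1 + 0 != 0 :> R by rewrite addr0 oner_eq0.
have [m1 <-] := gen 0 1 F h01 h1 mF F0.
have [m2 <-] := gen 0 1 _ h01 h1 m1 (fun x => F0 _).
apply: eq_integral => x _; congr F; rewrite CE S0.
apply/rowP => k; rewrite /rotate !mxE !eqxx/= (eq_sym j i) (negbTE ij).
rewrite !(mulr0, mulr1, addr0).
by move: (k == i)%:R (k == j)%:R (x ord0 i) (x ord0 j) (x _ k) => di dj xi xj xk; ring.
Qed.

End change_of_variables.

(** * Lebesgue measure on R^(2n+1) *)

Section lebesgue_H_theory.
Context (R : realType) (n : nat).
Local Notation leb := (@lebesgue_measure R).
Local Notation muH := (@lebesgue_H R n).
Local Notation T := ('rV[R]_(n + n) * measurableTypeR R)%type.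

Lemma lebesgue_H_box_lty M M' : (muH (@box R (n + n) M `*` [set` `[(- M')%R, M']]) < +oo)%E.
Proof.
have -> : muH (@box R (n + n) M `*` [set` `[(- M')%R, M']]) =
  ((@lebV R (n + n)) \x leb)%E (@box R (n + n) M `*` [set` `[(- M')%R, M']]) by [].
rewrite product_measure1E//; last exact: measurable_box.
have mI : (leb [set` `[(- M')%R, M']] < +oo)%E.
  by rewrite lebesgue_measure_itv/=; case: ifP; rewrite ?ltry.
by apply: lte_mul_pinfty => //; rewrite ge0_fin_numE//; exact: lebV_box_lty.
Qed.

Let lebesgue_H_sigma_finite : sigma_finite setT muH.
Proof.
exists (fun N => @box R (n + n) N%:R `*` `[- N%:R, N%:R]%classic).
  apply/seteqP; split=> // -[x t] _.
  exists (Num.truncn (Num.max `|x| `|t|)).+1 => //; split=> /=.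
    move=> i; rewrite (le_trans _ (ltW (truncnS_gt _)))// le_max; apply/orP; left.
    have -> : `|x| = mx_norm x by [].
    by rewrite mx_normrE (le_trans _ (le_bigmax _ _ (ord0, i))).
  by rewrite in_itv/= -ler_norml (le_trans _ (ltW (truncnS_gt _)))// le_max lexx orbT.
move=> N; split; last exact: lebesgue_H_box_lty.
by apply: measurableX => //; exact: measurable_box.
Qed.

HB.instance Definition _ := @Measure_isSigmaFinite.Build _ _ _ muH
  lebesgue_H_sigma_finite.

Lemma integral_lebesgue_H2 (F : T -> \bar R) :
  measurable_fun setT F -> (forall z, 0 <= F z)%E ->
  (\int[muH]_z F z = \int[leb]_t \int[@lebV R (n + n)]_x F (x, t))%E.
Proof.
move=> mF F0.
exact (@fubini_tonelli2 _ _ _ _ R (@lebV R (n + n)) (@lebesgue_measure R) F mF F0).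
Qed.

Definition affine_H (l m : R) (b : 'rV[R]_(n + n)) (d : R) (z : T) : T :=
  (l *: z.1 + b, m * z.2 + d).

Lemma measurable_affine_H l m b d : measurable_fun setT (affine_H l m b d).
Proof.
apply/measurable_fun_pairP; split => /=.
  exact: (measurableT_comp (measurable_rV_axpy l b) measurable_fst).
exact: (measurableT_comp (measurable_affine m d) measurable_snd).
Qed.

Lemma ge0_integral_affine_H l m b d (F : T -> \bar R) : 0 < l -> 0 < m ->
  measurable_fun setT F -> (forall z, 0 <= F z)%E ->
  (\int[muH]_z F z = (l ^+ (n + n) * m)%:E * \int[muH]_z F (affine_H l m b d z))%E.
Proof.
move=> l0 m0 mF F0.
have mFa : measurable_fun setT (F \o affine_H l m b d).
  by apply: measurableT_comp => //; exact: measurable_affine_H.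
rewrite integral_lebesgue_H2// [in RHS]integral_lebesgue_H2//.
pose G t := (\int[@lebV R (n + n)]_x F ((l *: x + b)%R, t))%E.
have mFc : measurable_fun setT (fun z : T => F (l *: z.1 + b, z.2)).
  apply: measurableT_comp => //; apply/measurable_fun_pairP; split => /=.
    exact: (measurableT_comp (measurable_rV_axpy l b) measurable_fst).
  exact: measurable_snd.
have mG : measurable_fun setT (G : measurableTypeR R -> \bar R).
  exact: (measurable_fun_fubini_tonelli_G _ mFc (fun z => F0 _)).
have G0 t : (0 <= G t)%E by exact: integral_ge0.
transitivity ((l ^+ (n + n))%:E * \int[leb]_t G t)%E.
  rewrite -ge0_integralZl//; last by rewrite lee_fin exprn_ge0// ltW.
  apply: eq_integral => t _; apply: ge0_integral_rV_affine => //.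
  by apply: (measurableT_comp mF); exact: measurable_pair2.
by rewrite (ge0_integral_affine d m0 mG G0) muleA -EFinM.
Qed.

Definition rotate_H (i j : 'I_(n + n)) a (C S : R) (z : T) : T :=
  (rotate i j a C S z.1, z.2).

Lemma ge0_integral_rotate_H i j a C S (F : T -> \bar R) :
  i != j -> C ^+ 2 + S ^+ 2 = 1 ->
  measurable_fun setT F -> (forall z, 0 <= F z)%E ->
  measurable_fun setT (F \o rotate_H i j a C S) ->
  (\int[muH]_z F (rotate_H i j a C S z) = \int[muH]_z F z)%E.
Proof.
move=> ij CS mF F0 mFr; rewrite integral_lebesgue_H2// [in RHS]integral_lebesgue_H2//.
apply: eq_integral => t _.
rewrite -[RHS](ge0_integral_rotate a ij CS (F := fun x => F (x, t)))//.
by apply: (measurableT_comp mF); exact: measurable_pair2.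
Qed.

Let cube (q : 'rV[rat]_(n + n) * rat * nat) : set T :=
  [set z : T | (forall i, `|z.1 ord0 i - ratr (q.1.1 ord0 i)| < q.2.+1%:R^-1) /\
           `|(z.2 : R) - ratr q.1.2| < q.2.+1%:R^-1].

Lemma measurable_cube q : measurable (cube q).
Proof.
have E (c e : R) : [set x | `|x - c| < e] = `]c - e, c + e[%classic.
  by apply/seteqP; split=> x /=; rewrite in_itv/= ltr_distl.
rewrite (_ : cube q = (\bigcap_(i in [set: 'I_(n + n)])
    ((rV_coord i \o fst) @^-1` [set x : R | `|x - ratr (q.1.1 ord0 i)| < q.2.+1%:R^-1])) `&`
    (snd @^-1` [set x : R | `|x - ratr q.1.2| < q.2.+1%:R^-1])); last first.
  apply/seteqP; split=> z /=; first by move=> [h1 h2]; split=> // i _; exact: h1.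
  by move=> [h1 h2]; split=> // i; exact: h1.
apply: measurableI.
  apply: fin_bigcap_measurable => // i _; rewrite -[X in measurable X]setTI.
  apply: (measurableT_comp (@measurable_rV_coord R _ i) measurable_fst) => //.
  by rewrite E; exact: measurable_itv.
rewrite -[X in measurable X]setTI; apply: measurable_snd => //.
by rewrite E; exact: measurable_itv.
Qed.

(** Open sets are countable unions of cubes with rational centres, and these
    are measurable rectangles. *)
Lemma open_measurable_H (A : set 'H[R]_n) : open A -> measurable (A : set T).
Proof.
move=> oA.
rewrite (_ : A = \bigcup_(q in [set: 'rV[rat]_(n + n) * rat * nat])
    (if asbool (cube q `<=` A) then cube q else set0)).
  apply: countable_bigcupT_measurable; first exact: countableP.
  by move=> q; case: ifP => // _; exact: measurable_cube.
apply/seteqP; split=> z; last by move=> [q _]; case: ifPn => // /asboolP; apply.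
move=> Az; have : nbhs z A by exact: open_nbhs_nbhs.
move=> /nbhs_ballP[e /= e0 eA].
pose N := Num.truncn (2 / e).
have Ne : 2 * N.+1%:R^-1 < e.
  by rewrite ltr_pdivrMr// mulrC -ltr_pdivrMr//; exact: truncnS_gt.
have N0 : 0 < N.+1%:R^-1 :> R by rewrite invr_gt0.
have rq (x d : R) : 0 < d -> exists q : rat, `|x - ratr q| < d.
  move=> d0; have [q] : exists q : rat, ratr q \in `]x - d, x + d[.
    by have [q qP] := @rat_in_itvoo R (x - d) (x + d) ltac:(lra); exists q.
  by rewrite in_itv/= => qP; exists q; rewrite distrC ltr_distl.
have /choice[f fP] : forall i, exists q : rat, `|z.1 ord0 i - ratr q| < N.+1%:R^-1.
  by move=> i; exact: rq.
have [q qP] := rq z.2 _ N0.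
have zc : cube (\row_i f i, q, N) z by split=> //= i; rewrite mxE.
exists (\row_i f i, q, N) => //.
have -> : `[< cube (\row_i f i, q, N) `<=` A >] = true; last exact: zc.
apply/asboolP => w [/= w1 w2]; apply: eA; split=> /=.
  split=> // i j; rewrite (ord1 i) /ball/=; have := w1 j; rewrite mxE => wj.
  rewrite (le_lt_trans (ler_distD (ratr (f j)) _ _))//.
  have := fP j; rewrite (distrC (ratr _)).
  by move: Ne wj; set d := _^-1 => Ne wj fj; lra.
rewrite /ball/= (le_lt_trans (ler_distD (ratr q) _ _))//.
rewrite (distrC (ratr _)).
by move: Ne w2 qP; set d := _^-1 => Ne w2 qP; lra.
Qed.

Lemma continuous_measurable_H (u : 'H[R]_n -> R) :
  continuous u -> measurable_fun setT (u : T -> R).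
Proof.
move=> /continuousP cu; apply: (measurability _ (RGenOpens.measurableE R)).
move=> _ [_ [a [b ->] <-]]; rewrite setTI.
by apply: open_measurable_H; apply: cu; exact: interval_open.
Qed.

Lemma lebV_setT_gt0 m : (0 < @lebV R m setT)%E.
Proof.
elim: m => [|m IH]; first by rewrite /lebV/= diracT lte01.
rewrite lebVS preimage_setT -setXTT product_measure1E// mule_gt0//.
apply: (@lt_le_trans _ _ (leb `[0%R, 1%R]%classic)).
  by rewrite lebesgue_measure_itv/= lte_fin ltr01 oppr0 adde0 lte01.
by apply: le_measure; rewrite ?inE.
Qed.

Lemma lebesgue_H_setT_gt0 : (0 < muH setT)%E.
Proof.
have -> : muH setT = ((@lebV R (n + n)) \x leb)%E setT by [].
rewrite -setXTT product_measure1E// mule_gt0//; first exact: lebV_setT_gt0.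
apply: (@lt_le_trans _ _ (leb `[0%R, 1%R]%classic)).
  by rewrite lebesgue_measure_itv/= lte_fin ltr01 oppr0 adde0 lte01.
by apply: le_measure; rewrite ?inE.
Qed.

End lebesgue_H_theory.

Lemma lebesgue_H_hyperplane (R : realType) (n : nat) (i : 'I_(n + n)) (c : R) :
  (@lebesgue_H R n) [set z : 'rV[R]_(n + n) * measurableTypeR R | z.1 ord0 i = c] = 0%E.
Proof.
have lV m (j : 'I_m) : measurable [set x : 'rV[R]_m | x ord0 j = c].
  rewrite -[X in measurable X]setTI.
  exact: (@measurable_rV_coord R m j measurableT [set c]).
have -> : [set z : 'rV[R]_(n + n) * measurableTypeR R | z.1 ord0 i = c] =
    [set x : 'rV[R]_(n + n) | x ord0 i = c] `*` [set: measurableTypeR R].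
  by apply/seteqP; split=> z //= [].
suff h m (j : 'I_m) : lebV [set x : 'rV[R]_m | x ord0 j = c] = 0%E.
  rewrite [LHS](_ : _ = ((@lebV R (n + n)) \x (@lebesgue_measure R))%E
    ([set x : 'rV[R]_(n + n) | x ord0 i = c] `*` [set: measurableTypeR R]))// product_measure1E//; last exact: lV.
  by rewrite [X in (X * _)%E](_ : _ = 0%E) ?mul0e//; exact: h.
elim: m j => [[]//|m IH] j; rewrite lebVS.
case: (unliftP ord0 j) => [k|] ->.
  rewrite (_ : _ @^-1` _ = [set x : 'rV[R]_m | x ord0 k = c] `*` [set: measurableTypeR R]).
    rewrite product_measure1E//; last exact: lV.
    by rewrite [X in (X * _)%E](_ : _ = 0%E) ?mul0e//; exact: IH.
  by apply/seteqP; split=> -[x t]/=; rewrite rV_consS//; case.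
rewrite (_ : _ @^-1` _ = [set: 'rV[R]_m] `*` [set c : measurableTypeR R]).
  rewrite product_measure1E//.
  by rewrite [X in (_ * X)%E](_ : _ = 0%E) ?mule0//; exact: lebesgue_measure_set1.
by apply/seteqP; split=> -[x t]/=; rewrite rV_cons0//; case.
Qed.

(** * Directional derivatives along curves *)

Section directional_derivatives.
Context (R : realType) (V : normedModType R).

(** Reduces the chain rule for directional derivatives to the chain rule for
    real functions. *)
Lemma is_derive_lineP (f : V -> R) (x v : V) (df : R) :
  is_derive x v f df <-> is_derive (0 : R) 1 (fun h : R => f (h *: v + x)) df.
Proof.
have E : (fun h : R => h^-1 *: ((f \o shift x) (h *: v) - f x)) =
    (fun h : R => h^-1 *: (((fun h : R => f (h *: v + x)) \o shift 0) (h *: 1) -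
       (fun h : R => f (h *: v + x)) 0)).
  by apply/funext => h /=; rewrite addr0 scaler1 scale0r add0r.
by split=> -[d1 d2]; split; move: d1 d2; rewrite /derivable /derive E.
Qed.

Lemma is_derive_comp1 (f : V -> R) (F : R -> R) (x v : V) (df dF : R) :
  is_derive x v f df -> is_derive (f x) 1 F dF ->
  is_derive x v (F \o f) (dF * df).
Proof.
move=> /is_derive_lineP hf hF; apply/is_derive_lineP.
apply: (@is_derive1_comp _ F (fun h : R => f (h *: v + x))).
by rewrite scale0r add0r.
Qed.

Lemma is_derive_sqr (f : V -> R) (x v : V) (df : R) :
  is_derive x v f df -> is_derive x v (fun x => f x ^+ 2) (2 * f x * df).
Proof.
move=> h; have := is_deriveX 2 h; rewrite /GRing.scale/= expr1.
by rewrite (_ : f ^+ 2 = (fun x => f x ^+ 2))//; apply/funext => w; rewrite !expr2.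
Qed.

Lemma is_derive_affine (b d x : R) : is_derive x 1 (fun h : R => h * b + d) b.
Proof.
have h : is_derive x (1 : R) (fun h : R => b *: h + d) (b *: (1 : R) + 0).
  exact: (is_deriveD (is_deriveZ b (is_derive_id x (1 : R))) (is_derive_cst d x (1 : R))).
rewrite addr0 /GRing.scale/= mulr1 in h.
by under eq_fun do rewrite mulrC.
Qed.

(** The orbits of the dilations and of the rotations are curves of this
    form. *)
Lemma is_derive_curve (u : V -> R) (f1 f2 : R -> R) (v1 v2 w : V) (t d1 d2 : R) :
  (forall z, differentiable u z) ->
  is_derive t 1 f1 d1 -> is_derive t 1 f2 d2 ->
  is_derive t 1 (fun t => u (f1 t *: v1 + f2 t *: v2 + w))
    ('D_(d1 *: v1 + d2 *: v2) u (f1 t *: v1 + f2 t *: v2 + w)).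
Proof.
move=> du [h1 e1] [h2 e2].
have D1 : differentiable f1 t by exact/derivable1_diffP.
have D2 : differentiable f2 t by exact/derivable1_diffP.
pose g t : V := f1 t *: v1 + f2 t *: v2 + w.
have Dg1 := differentiableZl v1 D1; have Dg2 := differentiableZl v2 D2.
have Dg : differentiable g t by do ?apply: differentiableD.
have dg : 'd g t (1 : R) = d1 *: v1 + d2 *: v2.
  rewrite /g (diffD (differentiableD Dg1 Dg2) (differentiable_cst w t)).
  rewrite (diffD Dg1 Dg2) (diffZl v1 D1) (diffZl v2 D2) diff_cst /=.
  rewrite -[RHS]addr0 -e1 -e2; congr (_ + _).
  by rewrite !deriveE.
have Dc : differentiable (u \o g) t by apply: differentiable_comp.
split; first exact/diff_derivable.
by rewrite (deriveE _ Dc) (diff_comp Dg (du _)) /= dg deriveE.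
Qed.

End directional_derivatives.

(** With FF, FG and GG the three sums of products, expand the sum of the
    squares of FG F i - FF G i, which is FF (FF GG - FG^2). *)
Lemma sum_sqr_CauchySchwarz (R : realFieldType) m (F G : 'I_m -> R) :
  (\sum_i F i * G i) ^+ 2 <= (\sum_i F i ^+ 2) * (\sum_i G i ^+ 2).
Proof.
have E0 p q : \sum_i (q * F i - p * G i) ^+ 2 = q ^+ 2 * (\sum_i F i ^+ 2) +
    (- (2 * q * p)) * (\sum_i F i * G i) + p ^+ 2 * (\sum_i G i ^+ 2).
  by rewrite !mulr_sumr -!big_split/=; apply: eq_bigr => i _; ring.
set FF := \sum_i F i ^+ 2; set GG := \sum_i G i ^+ 2; set FG := \sum_i F i * G i.
have FF0 : 0 <= FF by apply: sumr_ge0 => i _; rewrite sqr_ge0.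
have [FF00|FFn0] := eqVneq FF 0.
  have F0 i : F i = 0.
    apply/eqP; rewrite -sqrf_eq0; apply/eqP; move: i isT.
    by apply: psumr_eq0P FF00 => i _; rewrite sqr_ge0.
  by rewrite /FG big1 ?expr0n/= ?FF00 ?mul0r// => i _; rewrite F0 mul0r.
have FFp : 0 < FF by rewrite lt0r FFn0.
have h : 0 <= \sum_i (FG * F i - FF * G i) ^+ 2 by apply: sumr_ge0 => i _; rewrite sqr_ge0.
have E : \sum_i (FG * F i - FF * G i) ^+ 2 = FF * (FF * GG - FG ^+ 2) by rewrite E0 -/FF -/GG -/FG; ring.
by move: h; rewrite E pmulr_rge0// subr_ge0.
Qed.

(** * Horizontal gradients and the gauge *)

Section geometry.
Context (R : realType) (n : nat) (x0 : 'H[R]_n) (c k : R).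
Hypotheses (c0 : c != 0) (k0 : 0 < k).
Implicit Types (z v : 'H[R]_n) (u : 'H[R]_n -> R).
Local Notation a := x0.1.
Local Notation Sg := (@sumsq R n a).
Local Notation psi := (@gauge R n x0 c k).

Definition offs z (l : 'I_(n + n)) : R := z.1 ord0 l - a ord0 l.
Definition vtau z : R := z.2 - x0.2.
Definition gauge4k z : R := c ^+ 2 * Sg z `^ (2 * k) + vtau z ^+ 2.
Local Notation y := offs.

Lemma sumsq_ge0 z : 0 <= Sg z.
Proof. by apply: sumr_ge0 => i _; rewrite sqr_ge0. Qed.

Lemma gauge4k_ge0 z : 0 <= gauge4k z.
Proof. by rewrite addr_ge0 ?sqr_ge0// mulr_ge0 ?sqr_ge0 ?powR_ge0. Qed.

Lemma gauge_ge0 z : 0 <= psi z.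
Proof. exact: powR_ge0. Qed.

Lemma gauge4kE z : psi z `^ (4 * k) = gauge4k z.
Proof.
by rewrite /gauge -powRrM mulVf ?powRr1 ?gauge4k_ge0// mulf_neq0// gt_eqF.
Qed.

Lemma gauge_gt0 z : 0 < Sg z -> 0 < psi z.
Proof.
move=> S0; apply: powR_gt0; rewrite ltr_pwDl ?sqr_ge0// mulr_gt0 ?powR_gt0//.
by rewrite exprn_even_gt0.
Qed.

Lemma is_derive_coord1 z v (l : 'I_(n + n)) :
  is_derive z v (fun z => z.1 ord0 l) (v.1 ord0 l).
Proof.
apply/is_derive_lineP.
have -> : (fun h : R => (h *: v + z).1 ord0 l) = (fun h : R => h * v.1 ord0 l + z.1 ord0 l).
  by apply/funext => h; rewrite !mxE.
exact: is_derive_affine.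
Qed.

Lemma is_derive_coord2 z v : is_derive z v (fun z => z.2) v.2.
Proof.
apply/is_derive_lineP.
have -> : (fun h : R => (h *: v + z).2) = (fun h : R => h * v.2 + z.2) by [].
exact: is_derive_affine.
Qed.

Lemma is_derive_sumsq z v :
  is_derive z v Sg (2 * \sum_l y z l * v.1 ord0 l).
Proof.
rewrite mulr_sumr.
have -> : Sg = \sum_(l < n + n) (fun z => (z.1 ord0 l - a ord0 l) ^+ 2).
  by apply/funext => w; rewrite /sumsq fct_sumE.
apply: is_derive_sum => l.
have h := is_derive_coord1 z v l.
have h2 : is_derive z v (fun z => z.1 ord0 l - a ord0 l) (v.1 ord0 l).
  by rewrite -[v.1 ord0 l]subr0; apply: is_deriveB.
by have := is_derive_sqr h2; rewrite mulrA.
Qed.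

Lemma is_derive_vtau z v : is_derive z v vtau v.2.
Proof.
have h := is_derive_coord2 z v.
by rewrite -[v.2]subr0; apply: is_deriveB.
Qed.

(** The horizontal gradient of a function of the two quantities S = sumsq
    and tau = vtau, in terms of the coefficients of radial_derivative. *)
Definition hvec (A B : R) z (i : 'I_(n + n)) : R :=
  match fintype.split i with
  | inl j => A * y z (lshift n j) + 2 * k * c * y z (rshift n j) * Sg z `^ (k - 1) * B
  | inr j => A * y z (rshift n j) - 2 * k * c * y z (lshift n j) * Sg z `^ (k - 1) * B
  end.

(** A is twice the partial derivative in S, and B is the partial derivative
    in tau. *)
Definition radial_derivative u (A B : R) z :=
  forall v, is_derive z v u (A * (\sum_l y z l * v.1 ord0 l) + B * v.2).

Lemma hfield_radial u A B z i : radial_derivative u A B z ->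
  hfield a c k i u z = hvec A B z i.
Proof.
move=> h.
have px l : partial_x l u z = A * y z l.
  rewrite /partial_x; have [_ ->] := h (delta_mx ord0 l, 0).
  rewrite /= mulr0 addr0 (bigD1 l)//= big1 ?addr0.
    by rewrite mxE !eqxx mulr1.
  by move=> j jl; rewrite mxE (negbTE jl) andbF mulr0.
have pt : partial_t u z = B.
  rewrite /partial_t; have [_ ->] := h (0, 1).
  by rewrite /= big1 ?mulr0 ?mulr1 ?add0r// => j _; rewrite mxE mulr0.
rewrite -(splitK i); case: (fintype.split i) => j; rewrite /hfield /hvec.
  by rewrite (unsplitK (inl j)) px pt.
by rewrite (unsplitK (inr j)) px pt.
Qed.

Lemma sumsqE z : Sg z = \sum_(j < n) (y z (lshift n j) ^+ 2 + y z (rshift n j) ^+ 2).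
Proof. by rewrite /sumsq big_split_ord/= -big_split. Qed.

(** A multiplies the vector y = offs z, and B multiplies a multiple of y
    turned by a quarter turn in each of the planes of the coordinates j and
    n + j; these are orthogonal. *)
Lemma sum_hvec_sqr A B z :
  \sum_i hvec A B z i ^+ 2 = Sg z * (A ^+ 2 + (2 * k * c * Sg z `^ (k - 1) * B) ^+ 2).
Proof.
rewrite big_split_ord/= -big_split/= [in RHS]mulrC {2}sumsqE mulr_sumr.
apply: eq_bigr => j _; rewrite /hvec (unsplitK (inl j)) (unsplitK (inr j)).
move: (Sg z `^ _) => P; ring.
Qed.

(** The infinitesimal generator of the dilations about x0. *)
Definition euler u z : R :=
  \sum_l y z l * partial_x l u z + 2 * k * vtau z * partial_t u z.

(** The infinitesimal generator of the rotations in the plane of the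
    coordinates j and n + j. *)
Definition spin (j : 'I_n) u z : R :=
  y z (rshift n j) * partial_x (lshift n j) u z - y z (lshift n j) * partial_x (rshift n j) u z.

Lemma sum_hfield_hvec A B u z :
  \sum_i hfield a c k i u z * hvec A B z i =
  A * (\sum_l y z l * partial_x l u z) +
  2 * k * c * Sg z `^ (k - 1) * B * (\sum_j spin j u z) +
  (2 * k * c * Sg z `^ (k - 1)) ^+ 2 * B * Sg z * partial_t u z.
Proof.
have T3 (p q : R) : p * Sg z * q =
    \sum_(j < n) p * (y z (lshift n j) ^+ 2 + y z (rshift n j) ^+ 2) * q.
  by rewrite sumsqE mulr_sumr mulr_suml.
rewrite T3 !big_split_ord/= -!big_split/= !mulr_sumr -!big_split/=.
apply: eq_bigr => j _; rewrite /hfield /hvec (unsplitK (inl j)) (unsplitK (inr j)) /spin -!/(offs _ _).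
move: (Sg z `^ _) (partial_t u z) (partial_x _ u z) (partial_x _ u z) => P pt p1 p2.
rewrite /offs; ring.
Qed.

(** The norm of the horizontal gradient of the gauge off the axis S = 0, by
    hgrad_norm_gauge. *)
Definition ngrad z : R := `|c| * Sg z `^ (k - 2^-1) * psi z `^ (1 - 2 * k).

Lemma ngrad_ge0 z : 0 <= ngrad z.
Proof. by rewrite !mulr_ge0 ?powR_ge0. Qed.

Lemma ngrad_gt0 z : 0 < Sg z -> 0 < ngrad z.
Proof.
move=> S0; rewrite /ngrad; apply: mulr_gt0; last exact/powR_gt0/gauge_gt0.
by apply: mulr_gt0; [rewrite normr_gt0|exact: powR_gt0].
Qed.

Lemma hgrad_normE u z : hgrad_norm a c k u z = Num.sqrt (\sum_i hfield a c k i u z ^+ 2).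
Proof. by rewrite /hgrad_norm; under eq_bigr do rewrite mxE. Qed.

Lemma hgrad_norm_radial u A B z : radial_derivative u A B z ->
  hgrad_norm a c k u z = Num.sqrt (Sg z * (A ^+ 2 + (2 * k * c * Sg z `^ (k - 1) * B) ^+ 2)).
Proof.
move=> h; rewrite hgrad_normE -sum_hvec_sqr; congr Num.sqrt.
by apply: eq_bigr => i _; rewrite (hfield_radial _ h).
Qed.

Lemma radial_gauge4k z : 0 < Sg z ->
  radial_derivative gauge4k (4 * k * c ^+ 2 * Sg z `^ (2 * k - 1)) (2 * vtau z) z.
Proof.
move=> S0 v; have h1 := is_derive_sumsq z v; have h2 := is_derive_vtau z v.
have h3 := is_derive_comp1 h1 (is_derive1_powR (2 * k) S0).
have h4 := is_derive_sqr h2; have h5 := is_deriveZ (c ^+ 2) h3.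
apply: is_derive_eq (is_deriveD h5 h4) _.
by rewrite /GRing.scale/=; ring.
Qed.

Lemma sumsq_powRD z (r s : R) : 0 < Sg z -> Sg z `^ (r + s) = Sg z `^ r * Sg z `^ s.
Proof. by move=> S0; rewrite powRD// (gt_eqF S0) implybT. Qed.

Lemma sumsq_powR_sqr z : 0 < Sg z ->
  Sg z * (Sg z `^ (k - 1)) ^+ 2 = Sg z `^ (2 * k - 1).
Proof.
move=> S0; rewrite expr2 -sumsq_powRD// -{1}[Sg z]powRr1 ?sumsq_ge0// -sumsq_powRD//.
by congr (_ `^ _); ring.
Qed.

Lemma hvec_gauge4k_sqr z : 0 < Sg z ->
  Sg z * ((4 * k * c ^+ 2 * Sg z `^ (2 * k - 1)) ^+ 2 +
    (2 * k * c * Sg z `^ (k - 1) * (2 * vtau z)) ^+ 2) =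
  (4 * k * psi z `^ (4 * k - 1) * ngrad z) ^+ 2.
Proof.
move=> S0; have p0 := gauge_gt0 S0.
rewrite /ngrad.
have -> : 4 * k * psi z `^ (4 * k - 1) * (`|c| * Sg z `^ (k - 2^-1) * psi z `^ (1 - 2 * k)) =
    4 * k * `|c| * Sg z `^ (k - 2^-1) * (psi z `^ (4 * k - 1) * psi z `^ (1 - 2 * k)) by ring.
rewrite -powRD ?(gt_eqF p0) ?implybT//.
have -> : 4 * k - 1 + (1 - 2 * k) = (4 * k) / 2 by field.
rewrite powRrM gauge4kE powR12_sqrt ?gauge4k_ge0//.
rewrite !exprMn sqr_sqrtr ?gauge4k_ge0// real_normK ?num_real//.
have -> : (Sg z `^ (k - 2^-1)) ^+ 2 = Sg z `^ (2 * k - 1).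
  by rewrite expr2 -sumsq_powRD//; congr (_ `^ _); field.
have -> : (Sg z `^ (2 * k - 1)) ^+ 2 = Sg z `^ (2 * k - 1) * Sg z `^ (2 * k - 1) by ring.
have E1 : Sg z `^ (2 * k) = Sg z * Sg z `^ (2 * k - 1).
  by rewrite mulr_powRB1 ?sumsq_ge0// mulr_gt0.
have E2 := sumsq_powR_sqr S0.
rewrite /gauge4k E1; transitivity (Sg z * (Sg z `^ (2 * k - 1)) * (4 ^+ 2 * k ^+ 2 * (c ^+ 2) ^+ 2 * Sg z `^ (2 * k - 1)) + 4 ^+ 2 * k ^+ 2 * c ^+ 2 * (Sg z * (Sg z `^ (k - 1)) ^+ 2) * vtau z ^+ 2); first by ring.
rewrite E2; ring.
Qed.

Lemma hgrad_norm_gauge z : 0 < Sg z -> hgrad_norm a c k psi z = ngrad z.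
Proof.
move=> S0; have p0 := gauge_gt0 S0.
have g0 : 0 < gauge4k z by rewrite -gauge4kE powR_gt0.
pose D := (4 * k)^-1 * gauge4k z `^ ((4 * k)^-1 - 1).
have D0 : 0 <= D by rewrite mulr_ge0 ?powR_ge0// invr_ge0 mulr_ge0// ltW.
have h : radial_derivative psi (D * (4 * k * c ^+ 2 * Sg z `^ (2 * k - 1))) (D * (2 * vtau z)) z.
  move=> v; have h1 := radial_gauge4k S0 v.
  apply: is_derive_eq (is_derive_comp1 h1 (is_derive1_powR (4 * k)^-1 g0)) _.
  by rewrite -/D; ring.
rewrite (hgrad_norm_radial h).
transitivity (Num.sqrt (D ^+ 2 * (4 * k * psi z `^ (4 * k - 1) * ngrad z) ^+ 2)).
  by rewrite -hvec_gauge4k_sqr//; congr Num.sqrt; ring.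
rewrite -exprMn sqrtr_sqr ger0_norm; last first.
  apply: mulr_ge0 => //; apply: mulr_ge0; last exact: ngrad_ge0.
  by apply: mulr_ge0; [rewrite mulr_ge0// ltW|exact: powR_ge0].
rewrite /D -gauge4kE -powRrM; move: (ngrad z) => N.
have -> : 4 * k * ((4 * k)^-1 - 1) = 1 - 4 * k.
  by field; rewrite gt_eqF.
transitivity ((4 * k)^-1 * (4 * k) * (psi z `^ (1 - 4 * k) * psi z `^ (4 * k - 1)) * N); first by ring.
rewrite -powRD ?(gt_eqF p0) ?implybT//.
by rewrite mulVf ?mul1r ?mulf_neq0 ?gt_eqF// addrC subrKA subrr powRr0 mul1r.
Qed.

(** The scalar product of the horizontal gradients of u and of gauge^(4k) is
    a positive multiple of the combination of euler and spin below; the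
    inequality is the Cauchy-Schwarz inequality for it. *)
Lemma euler_spin_le u z : 0 < Sg z ->
  ngrad z * `|euler u z + vtau z / (c * Sg z `^ k) * \sum_j spin j u z| <=
  psi z * hgrad_norm a c k u z.
Proof.
move=> S0; have p0 := gauge_gt0 S0.
set A := 4 * k * c ^+ 2 * Sg z `^ (2 * k - 1).
have A0 : 0 < A.
  apply: mulr_gt0; last exact: powR_gt0.
  by apply: mulr_gt0; [exact: mulr_gt0|rewrite exprn_even_gt0].
have N0 := ngrad_gt0 S0.
have h1 := sum_hfield_hvec A (2 * vtau z) u z.
have E2 := sumsq_powR_sqr S0.
have E3 : Sg z `^ (k - 1) * Sg z `^ k = Sg z `^ (2 * k - 1).
  by rewrite -sumsq_powRD//; congr (_ `^ _); ring.
have E : \sum_i hfield a c k i u z * hvec A (2 * vtau z) z i =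
   A * (euler u z + vtau z / (c * Sg z `^ k) * \sum_j spin j u z).
  rewrite h1 /euler; set P := \sum_j spin _ _ _; set Y := \sum_l _ * _.
  have -> : (2 * k * c * Sg z `^ (k - 1)) ^+ 2 * (2 * vtau z) * Sg z * partial_t u z =
     A * (2 * k * vtau z * partial_t u z).
    by rewrite /A -E2; ring.
  have -> : 2 * k * c * Sg z `^ (k - 1) * (2 * vtau z) * P = A * (vtau z / (c * Sg z `^ k) * P).
    rewrite /A -E3; field.
    by rewrite c0/= gt_eqF// powR_gt0.
  by ring.
have CS := sum_sqr_CauchySchwarz (fun i => hfield a c k i u z) (hvec A (2 * vtau z) z).
rewrite E sum_hvec_sqr hvec_gauge4k_sqr// in CS.
have H0 : 0 <= \sum_i hfield a c k i u z ^+ 2 by apply: sumr_ge0 => i _; rewrite sqr_ge0.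
rewrite -(sqr_sqrtr H0) -hgrad_normE -exprMn in CS.
have W0 : 0 <= hgrad_norm a c k u z * (4 * k * psi z `^ (4 * k - 1) * ngrad z).
  apply: mulr_ge0; first exact: sqrtr_ge0.
  by apply: mulr_ge0; [apply: mulr_ge0; [rewrite mulr_ge0// ltW|exact: powR_ge0]|exact: ltW].
have := CS; rewrite -(real_normK (num_real (A * _))) ler_pXn2r ?nnegrE// normrM (gtr0_norm A0).
set X := `|_ + _|; set H := hgrad_norm _ _ _ _ _ => le.
have NA : ngrad z * (ngrad z * (4 * k * psi z `^ (4 * k - 1))) = A * psi z.
  rewrite /ngrad /A.
  transitivity (`|c| ^+ 2 * (Sg z `^ (k - 2^-1) * Sg z `^ (k - 2^-1)) * (4 * k) *
    (psi z `^ (1 - 2 * k) * psi z `^ (1 - 2 * k) * psi z `^ (4 * k - 1))); first by ring.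
  rewrite -sumsq_powRD// -!powRD ?(gt_eqF p0) ?implybT// real_normK ?num_real//.
  have -> : 1 - 2 * k + (1 - 2 * k) + (4 * k - 1) = 1 by ring.
  have -> : k - 2^-1 + (k - 2^-1) = 2 * k - 1 by field.
  by rewrite powRr1 ?gauge_ge0//; ring.
rewrite -(ler_pM2l A0) mulrCA (mulrA A) -NA.
have -> : ngrad z * (ngrad z * (4 * k * psi z `^ (4 * k - 1))) * H =
   ngrad z * (H * (4 * k * psi z `^ (4 * k - 1) * ngrad z)) by ring.
by rewrite ler_pM2l.
Qed.

End geometry.

Lemma is_derive_continuous (R : realType) (f : R -> R) (x d : R) :
  is_derive x (1 : R) f d -> {for x, continuous f}.
Proof. by move=> [/derivable1_diffP/differentiable_continuous]. Qed.

(** * Dilations *)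

Section dilations.
Context (R : realType) (n : nat) (x0 : 'H[R]_n) (c k : R).
Hypotheses (c0 : c != 0) (k0 : 0 < k).
Local Notation leb := (@lebesgue_measure R).
Local Notation muH := (@lebesgue_H R n).
Local Notation T := ('rV[R]_(n + n) * measurableTypeR R)%type.
Local Notation a := x0.1.
Local Notation Sg := (@sumsq R n a).
Local Notation psi := (@gauge R n x0 c k).
Local Notation tau := (@vtau R n x0).
Local Notation ngr := (@ngrad R n x0 c k).
Local Notation Q := ((2 * n)%:R + 2 * k).

Lemma Q_gt0 : 0 < Q :> R.
Proof. by rewrite ltr_wpDl ?ler0n// mulr_gt0. Qed.

Lemma measurable_offs l : measurable_fun setT (fun z : T => offs x0 z l).
Proof.
apply: measurable_funB => //.
exact: (measurableT_comp (@measurable_rV_coord R _ l) measurable_fst).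
Qed.

Lemma measurable_sumsq : measurable_fun setT (Sg : T -> R).
Proof.
apply: measurable_sum => l; apply: measurable_funX; exact: measurable_offs.
Qed.

Lemma measurable_vtau : measurable_fun setT (tau : T -> R).
Proof. by apply: measurable_funB => //; exact: measurable_snd. Qed.

Lemma measurable_gauge4k : measurable_fun setT (@gauge4k R n x0 c k : T -> R).
Proof.
apply: measurable_funD.
  apply: measurable_funM => //.
  by apply: (measurableT_comp (measurable_powR (2 * k))); exact: measurable_sumsq.
by apply: measurable_funX; exact: measurable_vtau.
Qed.

Lemma measurable_gauge : measurable_fun setT (psi : T -> R).
Proof. exact: (measurableT_comp (measurable_powR _) measurable_gauge4k). Qed.

Lemma measurable_gauge_powR s : measurable_fun setT (fun z : T => psi z `^ s).
Proof. exact: (measurableT_comp (measurable_powR s) measurable_gauge). Qed.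

Lemma measurable_ngrad : measurable_fun setT (ngr : T -> R).
Proof.
apply: measurable_funM; last first.
  by apply: (measurableT_comp (measurable_powR _)); exact: measurable_gauge.
apply: measurable_funM => //.
by apply: (measurableT_comp (measurable_powR _)); exact: measurable_sumsq.
Qed.

Definition dil (l : R) (z : T) : T :=
  (l *: (z.1 - a) + a, l `^ (2 * k) * (z.2 - x0.2) + x0.2).

Lemma dilE l : dil l =
  affine_H l (l `^ (2 * k)) (a - l *: a) (x0.2 - l `^ (2 * k) * x0.2).
Proof.
apply/funext => z; rewrite /dil /affine_H; congr (_, _); last by ring.
by rewrite scalerBr -addrA (addrC _ a).
Qed.

Lemma measurable_dil2 :
  measurable_fun setT (fun w : measurableTypeR R * T => dil w.1 w.2).
Proof.
have m1 : measurable_fun setT (fun w : measurableTypeR R * T => w.1 : R).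
  exact: measurable_fst.
apply/measurable_fun_pairP; split => /=.
  apply: measurable_fun_rVP => i.
  rewrite (_ : _ \o _ = fun w => w.1 * offs x0 w.2 i + a ord0 i); last first.
    by apply/funext => w; rewrite /rV_coord/= !mxE.
  apply: measurable_funD => //; apply: measurable_funM => //.
  exact: (measurableT_comp (measurable_offs i) measurable_snd).
apply: measurable_funD => //; apply: measurable_funM.
  exact: (measurableT_comp (measurable_powR _) m1).
exact: (measurableT_comp measurable_vtau measurable_snd).
Qed.

Lemma sumsq_dil l z : Sg (dil l z) = l ^+ 2 * Sg z.
Proof.
by rewrite /sumsq mulr_sumr; apply: eq_bigr => i _; rewrite /= !mxE addrK exprMn.
Qed.

Lemma vtau_dil l z : tau (dil l z) = l `^ (2 * k) * tau z.
Proof. by rewrite /vtau/= addrK. Qed.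

Lemma sumsq_dil_powR l z (r : R) : 0 < l -> Sg (dil l z) `^ r = l `^ (2 * r) * Sg z `^ r.
Proof.
move=> l0; rewrite sumsq_dil powRM ?sumsq_ge0 ?exprn_ge0 ?ltW//.
by rewrite -powR_mulrn ?ltW// -powRrM.
Qed.

Lemma gauge_dil l z : 0 < l -> psi (dil l z) = l * psi z.
Proof.
move=> l0; rewrite /gauge sumsq_dil_powR// -!/(tau _) vtau_dil.
have -> : c ^+ 2 * (l `^ (2 * (2 * k)) * Sg z `^ (2 * k)) + (l `^ (2 * k) * tau z) ^+ 2 =
    l `^ (4 * k) * (c ^+ 2 * Sg z `^ (2 * k) + tau z ^+ 2).
  rewrite exprMn -(powR_mulrn 2 (powR_ge0 _ _)) -powRrM.
  have -> : 2 * k * 2%:R = 4 * k by ring.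
  have -> : 2 * (2 * k) = 4 * k by ring.
  by ring.
rewrite powRM ?powR_ge0 ?(gauge4k_ge0 x0 c k)// -powRrM.
by rewrite mulfV ?powRr1 ?ltW// mulf_neq0// gt_eqF.
Qed.

Lemma ngrad_dil l z : 0 < l -> ngr (dil l z) = ngr z.
Proof.
move=> l0; rewrite /ngrad (sumsq_dil_powR _ _ l0) (gauge_dil _ l0) (powRM _ (ltW l0) (gauge_ge0 x0 c k z)).
move: (Sg z `^ _) (psi z `^ _) => A B; rewrite -!mulrA; congr (_ * _).
rewrite (mulrCA A) !mulrA -powRD ?(gt_eqF l0) ?implybT//.
have -> : 2 * (k - 2^-1) + (1 - 2 * k) = 0 by field.
by rewrite powRr0 mul1r.
Qed.

(** The dilations multiply the volume by l^Q, where Q = 2n + 2k. *)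
Lemma integral_dil l (F : T -> \bar R) : 0 < l ->
  measurable_fun setT F -> (forall z, 0 <= F z)%E ->
  (\int[muH]_z F z = (l `^ Q)%:E * \int[muH]_z F (dil l z))%E.
Proof.
move=> l0 mF F0; rewrite dilE.
rewrite (@ge0_integral_affine_H _ _ l (l `^ (2 * k)) (a - l *: a)
  (x0.2 - l `^ (2 * k) * x0.2) _ l0 (powR_gt0 _ l0) mF F0); congr (_%:E * _)%E.
rewrite powRD ?(gt_eqF l0) ?implybT//; congr (_ * _).
by rewrite powR_mulrn ?ltW// addnn mul2n.
Qed.

Lemma integral_powR_tail (t : R) : 0 < t ->
  (\int[leb]_(l in `]t, +oo[) ((l `^ (- Q - 1))%:E) = (t `^ (- Q) / Q)%:E)%E.
Proof.
move=> t0; have Q0 := Q_gt0.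
rewrite integral_itv_obnd_cbnd; last first.
  apply/measurable_EFinP; apply: measurable_funTS; exact: measurable_powR.
have dF (x : R) : 0 < x -> is_derive x (1 : R) (fun l : R => - Q^-1 * l `^ (- Q)) (x `^ (- Q - 1)).
  move=> x0'; have h := is_deriveZ (- Q^-1) (is_derive1_powR (- Q) x0').
  apply: is_derive_eq h _; rewrite /GRing.scale/= mulrA.
  by rewrite mulrNN mulVf ?mul1r// gt_eqF.
rewrite (@ge0_continuous_FTC2y _ _ (fun l : R => - Q^-1 * l `^ (- Q)) t 0).
- by rewrite sub0e -EFinN mulNr opprK mulrC.
- by move=> x _; exact: powR_ge0.
- apply: derivable_within_continuous => x; rewrite in_itv/= andbT => tx.
  by have [] := is_derive1_powR (- Q - 1) (lt_le_trans t0 tx).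
- rewrite -[X in _ --> X](mulr0 (- Q^-1)); apply: cvgMr.
  under eq_fun do rewrite powRN.
  have h : \forall x \near +oo, 0 < x `^ Q.
    by near=> x; apply: powR_gt0; near: x; exact: nbhs_pinfty_gt.
  apply/(gtr0_cvgV0 h)/cvgryPge => A; near=> x.
  rewrite (le_trans (ler_norm A))//.
  rewrite -[leLHS](@powRr1 _ `|A|)// -[X in `|A| `^ X](@mulVf _ Q) ?gt_eqF// powRrM.
  apply: ge0_ler_powR; rewrite ?nnegrE ?powR_ge0 ?ltW//.
- by move=> x tx; have [] := dF x (lt_trans t0 tx).
- by apply: cvg_at_right_filter; exact: is_derive_continuous (dF t t0).
- by move=> x; rewrite in_itv/= andbT => tx; have [_ e] := dF x (lt_trans t0 tx); rewrite derive1E.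
Unshelve. all: by end_near. Qed.

End dilations.

(** * Polar integration *)

Lemma eq_mem_set (U V : Type) (A : set U) (B : set V) x y :
  (A x <-> B y) -> (x \in A) = (y \in B).
Proof. by move=> AB; apply/idP/idP; rewrite !inE => /AB. Qed.

Lemma integral_indicl d (T : measurableType d) (R : realType)
    (mu : {measure set T -> \bar R}) (D : set T) (g : T -> R) :
  (\int[mu]_(x in D) (g x)%:E = \int[mu]_x (\1_D x * g x)%:E)%E.
Proof.
rewrite integral_mkcond; apply: eq_integral => x _; rewrite patchE indicE.
by case: ifP => _; rewrite ?mul1r// mul0r.
Qed.

Section polar.
Context (R : realType) (n : nat) (x0 : 'H[R]_n) (c k : R).
Hypotheses (c0 : c != 0) (k0 : 0 < k).
Local Notation leb := (@lebesgue_measure R).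
Local Notation muH := (@lebesgue_H R n).
Local Notation T := ('rV[R]_(n + n) * measurableTypeR R)%type.
Local Notation psi := (@gauge R n x0 c k).
Local Notation Q := ((2 * n)%:R + 2 * k).
Local Notation dl := (@dil R n x0 k).

Lemma measurable_gauge_ball (t : R) : measurable ([set z | psi z < t] : set T).
Proof.
rewrite -[X in measurable X]setTI.
rewrite (_ : [set z | psi z < t] = psi @^-1` `]-oo, t[%classic).
  by apply: (measurable_gauge x0 c k measurableT); exact: measurable_itv.
by apply/seteqP; split=> z /=; rewrite in_itv.
Qed.

(** Write psi^(-Q) as Q times the integral of l^(-Q-1) over l > psi,
    exchange the integrals and substitute the dilation of ratio l: the
    region psi < l becomes the unit ball, and W, being of degree 0, comes
    out of the integral in l. *)
Lemma polar_integral (W f : T -> R) :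
  measurable_fun setT W -> measurable_fun setT f ->
  (forall z, 0 <= W z) -> (forall z, 0 <= f z) ->
  (forall l z, 0 < l -> W (dl l z) = W z) -> (forall z, psi z = 0 -> W z = 0) ->
  (\int[muH]_z (psi z `^ (- Q) * W z * f z)%:E =
   Q%:E * \int[muH]_(z in gauge_ball x0 c k 1)
     ((W z)%:E * \int[leb]_(l in `]0%R, +oo[) (f (dl l z) * l `^ (-1))%:E))%E.
Proof.
move=> mW mf W0 f0 Wd Wz; have Q0 : 0 < Q := Q_gt0 n k0.
pose B1 : set T := [set z | psi z < 1].
pose D : set (measurableTypeR R * T) := [set w | psi w.2 < w.1].
pose P : set (measurableTypeR R) := `]0, +oo[%classic.
have mB1 : measurable B1 by exact: measurable_gauge_ball.
have mP : measurable P by exact: measurable_itv.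
have mD : measurable D.
  rewrite -[X in measurable X]setTI.
  have -> : D = (fun w : measurableTypeR R * T => w.1 - psi w.2) @^-1` `]0, +oo[%classic.
    by apply/seteqP; split=> z /=; rewrite in_itv/= andbT subr_gt0.
  have m : measurable_fun setT (fun w : measurableTypeR R * T => w.1 - psi w.2).
    apply: measurable_funB; first exact: measurable_fst.
    exact: (measurableT_comp (measurable_gauge x0 c k) measurable_snd).
  by apply: m => //; exact: measurable_itv.
pose K (w : measurableTypeR R * T) : R :=
  \1_P w.1 * (\1_B1 w.2 * (W w.2 * (f (dl w.1 w.2) * w.1 `^ (-1)))).
pose K2 (w : measurableTypeR R * T) : R :=
  \1_P w.1 * (\1_D w * (w.1 `^ (- Q - 1) * (W w.2 * f w.2))).
have m1 : measurable_fun setT (fun w : measurableTypeR R * T => w.1 : R).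
  exact: measurable_fst.
have mi1 : measurable_fun setT (fun w : measurableTypeR R * T => \1_P w.1 : R).
  exact: (measurableT_comp (measurable_indic mP) measurable_fst).
have mW2 : measurable_fun setT (fun w : measurableTypeR R * T => W w.2).
  exact: (measurableT_comp mW measurable_snd).
have mK : measurable_fun setT (EFin \o K).
  apply/measurable_EFinP; apply: measurable_funM => //.
  apply: measurable_funM; first exact: (measurableT_comp (measurable_indic mB1) measurable_snd).
  apply: measurable_funM => //; apply: measurable_funM.
    exact: (measurableT_comp mf (measurable_dil2 x0 k)).
  exact: (measurableT_comp (measurable_powR _) m1).
have mK2 : measurable_fun setT (EFin \o K2).
  apply/measurable_EFinP; apply: measurable_funM => //.
  apply: measurable_funM; first exact: measurable_indic.
  apply: measurable_funM.
    exact: (measurableT_comp (measurable_powR _) m1).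
  by apply: measurable_funM => //; exact: (measurableT_comp mf measurable_snd).
have i0 d (U : measurableType d) (A : set U) x : 0 <= \1_A x :> R by rewrite indicE ler0n.
have K0 w : (0 <= (EFin \o K) w)%E.
  rewrite lee_fin /K indicE; have [|_] := boolP (w.1 \in P); last by rewrite mul0r.
  rewrite inE /P/= in_itv/= andbT => w0; rewrite mul1r.
  by rewrite !mulr_ge0// powR_ge0.
have K20 w : (0 <= (EFin \o K2) w)%E.
  by rewrite lee_fin /K2 !mulr_ge0// powR_ge0.
transitivity (Q%:E * \int[muH]_z \int[leb]_l (K (l, z))%:E)%E; last first.
  congr (_ * _)%E; rewrite [RHS]integral_mkcond; apply: eq_integral => z _.
  rewrite patchE; have -> : (z \in gauge_ball x0 c k 1) = (z \in B1) by [].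
  rewrite /K /=; case: ifPn => zB; last first.
    rewrite integral0_eq// => l _.
    by rewrite (indicE _ B1) (negbTE zB) mul0r mulr0.
  rewrite [in RHS]integral_indicl -ge0_integralZl//; last 3 first.
  - apply/measurable_EFinP; apply: measurable_funM; first exact: measurable_indic.
    apply: measurable_funM; last exact: measurable_powR.
    apply: (measurableT_comp mf).
    exact: (measurableT_comp (measurable_dil2 x0 k) (measurable_pair2 z)).
  - move=> l _; rewrite lee_fin indicE; have [|_] := boolP (l \in _); last by rewrite mul0r.
    by rewrite inE/= in_itv/= andbT => l0; rewrite mul1r mulr_ge0// powR_ge0.
  - by rewrite lee_fin.
  apply: eq_integral => l _; rewrite -EFinM; congr (_%:E).
  by rewrite (indicE _ B1) zB mul1r mulrCA.
have -> : (\int[muH]_z \int[leb]_l (K (l, z))%:E = \int[leb]_l \int[muH]_z (K (l, z))%:E)%E.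
  by rewrite (@fubini_tonelli _ _ _ _ R leb muH (EFin \o K) mK K0).
have -> : (\int[leb]_l \int[muH]_z (K (l, z))%:E = \int[leb]_l \int[muH]_z (K2 (l, z))%:E)%E.
  apply: eq_integral => l _; rewrite /K /K2/=.
  have [|lP] := boolP (l \in P); last first.
    by rewrite !integral0_eq// => z _; rewrite (indicE _ P) (negbTE lP) mul0r.
  rewrite inE /P/= in_itv/= andbT => l0.
  have lP : l \in P by rewrite inE /P/= in_itv/= andbT.
  pose F (z : T) : \bar R := (\1_[set z | psi z < l] z * (W z * (f z * l `^ (-1))))%:E.
  have mF : measurable_fun setT F.
    apply/measurable_EFinP; apply: measurable_funM.
      by apply: measurable_indic; exact: measurable_gauge_ball.
    by apply: measurable_funM => //; apply: measurable_funM.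
  have F0 z : (0 <= F z)%E by rewrite lee_fin !mulr_ge0// powR_ge0.
  transitivity (\int[muH]_z F (dl l z))%E.
    apply: eq_integral => z _; rewrite /F !indicE lP mul1r (Wd _ _ l0); congr ((_%:R * _)%:E).
    by congr nat_of_bool; apply: eq_mem_set; rewrite /B1/= (gauge_dil _ _ k0 _ l0) gtr_pMr.
  transitivity ((l `^ (- Q))%:E * \int[muH]_z F z)%E.
    rewrite (integral_dil x0 k l0 mF F0) muleA -EFinM -powRD ?(gt_eqF l0) ?implybT//.
    by rewrite addNr powRr0 mul1e.
  rewrite -ge0_integralZl//; last by rewrite lee_fin powR_ge0.
  apply: eq_integral => z _; rewrite -EFinM; congr (_%:E).
  rewrite !indicE lP mul1r powRD ?(gt_eqF l0) ?implybT//.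
  have -> : ((l, z) \in D) = (z \in [set z | psi z < l]) by exact: eq_mem_set.
  by ring.
rewrite (@fubini_tonelli _ _ _ _ R leb muH (EFin \o K2) mK2 K20).
rewrite -ge0_integralZl//; last 3 first.
- exact: (@measurable_fun_fubini_tonelli_G _ _ _ _ R leb (EFin \o K2) mK2 K20).
- by move=> z _; apply: integral_ge0 => l _; exact: K20.
- by rewrite lee_fin ltW.
apply: eq_integral => z _ /=.
have [pz|pn] := eqVneq (psi z) 0.
  rewrite (Wz _ pz) mulr0 mul0r integral0_eq ?mule0// => l _.
  by rewrite /K2/= (Wz _ pz) mul0r !mulr0.
have p0 : 0 < psi z by rewrite lt0r pn (gauge_ge0 x0 c k).
transitivity (Q%:E * ((W z * f z)%:E * \int[leb]_(l in `](psi z), +oo[) (l `^ (- Q - 1))%:E))%E.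
  rewrite (integral_powR_tail n k0 p0) -!EFinM; congr (_%:E).
  by rewrite [RHS]mulrC -!mulrA (mulVf (lt0r_neq0 Q0)) mulr1; ring.
congr (_ * _)%E; rewrite [in LHS]integral_indicl -ge0_integralZl//; last 3 first.
- apply/measurable_EFinP; apply: measurable_funM; last exact: measurable_powR.
  by apply: measurable_indic; exact: measurable_itv.
- by move=> l _; rewrite lee_fin mulr_ge0// powR_ge0.
- by rewrite lee_fin mulr_ge0.
apply: eq_integral => l _; rewrite -EFinM; congr (_%:E); rewrite /K2/=.
have -> : \1_`](psi z), +oo[ l = \1_P l * \1_D (l, z) :> R.
  rewrite !indicE -natrM mulnb; congr ((nat_of_bool _)%:R).
  rewrite /D /P; apply/idP/andP => [|[_]]; rewrite !inE/= !in_itv/= !andbT//.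
  by move=> h; split=> //; exact: lt_trans h.
by ring.
Qed.

End polar.

(** * Derivatives along dilations and rotations *)

Lemma pair_ext (A B : Type) (u v : A * B) : u.1 = v.1 -> u.2 = v.2 -> u = v.
Proof. by case: u => u1 u2; case: v => v1 v2 /= -> ->. Qed.

Section partial_derivatives.
Context (R : realType) (n : nat) (x0 : 'H[R]_n) (c k : R).
Hypotheses (c0 : c != 0) (k0 : 0 < k).
Local Notation a := x0.1.
Local Notation T := ('rV[R]_(n + n) * measurableTypeR R)%type.
Implicit Types (u : 'H[R]_n -> R) (z v : 'H[R]_n).

Lemma derive_partials u z v : differentiable u z ->
  'D_v u z = \sum_l v.1 ord0 l * partial_x l u z + v.2 * partial_t u z.
Proof.
move=> du; rewrite deriveE//.
have E : v = \sum_l v.1 ord0 l *: ((delta_mx ord0 l, 0) : 'H[R]_n) + v.2 *: ((0, 1) : 'H[R]_n).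
  have fstD (w1 w2 : 'H[R]_n) : (w1 + w2).1 = w1.1 + w2.1 by [].
  have sndD (w1 w2 : 'H[R]_n) : (w1 + w2).2 = w1.2 + w2.2 by [].
  have h1 : (\sum_l v.1 ord0 l *: ((delta_mx ord0 l, 0) : 'H[R]_n)).1 = v.1.
    rewrite (big_morph fst fstD (erefl _)) [RHS]row_sum_delta//.
  have h2 : (\sum_l v.1 ord0 l *: ((delta_mx ord0 l, 0) : 'H[R]_n)).2 = 0.
    by rewrite (big_morph snd sndD (erefl _)) big1// => l _; rewrite /= scaler0.
  apply: pair_ext.
    by rewrite fstD h1 /= scaler0 addr0.
  by rewrite sndD h2 /= /GRing.scale/= mulr1 add0r.
rewrite {1}E linearD linear_sum linearZ/= /partial_t deriveE//; congr (_ + _).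
by apply: eq_bigr => l _; rewrite linearZ/= /partial_x deriveE.
Qed.

Lemma continuous_offs l : continuous (fun z => offs x0 z l).
Proof.
move=> z; apply: cvgB; last exact: cvg_cst.
by apply: (@continuous_comp _ _ _ (fst : 'H[R]_n -> 'rV[R]_(n + n)) (fun x => x ord0 l));
  [exact: cvg_fst|exact: coord_continuous].
Qed.

Lemma continuous_vtau : continuous (vtau x0).
Proof. by move=> z; apply: cvgB; [exact: cvg_snd|exact: cvg_cst]. Qed.

Lemma continuous_euler u : (forall v, continuous ('D_v u)) -> continuous (euler x0 k u).
Proof.
move=> cu z; apply: cvgD.
  apply: cvg_big => [|l _]; first exact: add_continuous.
  by apply: cvgM; [exact: continuous_offs|exact: cu].
apply: cvgM; last exact: cu.
by apply: cvgM; [exact: cvg_cst|exact: continuous_vtau].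
Qed.

Lemma continuous_spin j u : (forall v, continuous ('D_v u)) -> continuous (spin x0 j u).
Proof.
move=> cu z; apply: cvgB.
  by apply: cvgM; [exact: continuous_offs|exact: cu].
by apply: cvgM; [exact: continuous_offs|exact: cu].
Qed.

Lemma dil_curve l z : dil x0 k l z =
  l *: ((z.1 - a, 0) : 'H[R]_n) + l `^ (2 * k) *: ((0, vtau x0 z) : 'H[R]_n) + x0.
Proof.
by apply: pair_ext; rewrite /= scaler0 ?addr0 ?add0r.
Qed.

Lemma is_derive_dil u z (l : R) : (forall w, differentiable u w) -> 0 < l ->
  is_derive l (1 : R) (fun l => u (dil x0 k l z)) (l `^ (-1) * euler x0 k u (dil x0 k l z)).
Proof.
move=> du l0.
pose v1 : 'H[R]_n := (z.1 - a, 0); pose v2 : 'H[R]_n := (0, vtau x0 z).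
have E l' : dil x0 k l' z = l' *: v1 + l' `^ (2 * k) *: v2 + x0 by exact: dil_curve.
have H := is_derive_curve v1 v2 x0 du (is_derive_id l (1 : R)) (is_derive1_powR (2 * k) l0).
under eq_fun do rewrite E.
apply: is_derive_eq H _; rewrite -E.
rewrite derive_partials// /euler mulrDr mulr_sumr; congr (_ + _).
  apply: eq_bigr => i _; rewrite /offs /= !mxE mulr0 addr0 mul1r addrK.
  by rewrite mulrA mulrA powR_inv1 ?ltW// mulVf ?gt_eqF// mul1r.
rewrite vtau_dil -[vtau x0 z]/(v2.2) /=.
rewrite scaler0 add0r /GRing.scale/=.
have -> : l `^ (2 * k - 1) = l `^ (-1) * l `^ (2 * k).
  by rewrite -powRD ?(gt_eqF l0) ?implybT// addrC.
by ring.
Qed.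

Definition plane_rot (j : 'I_n) (t : R) (z : 'H[R]_n) : 'H[R]_n :=
  rotate_H (lshift n j) (rshift n j) a (cos t) (sin t) z.

Let circ1 (j : 'I_n) (z : 'H[R]_n) : 'H[R]_n :=
  (offs x0 z (lshift n j) *: delta_mx ord0 (lshift n j) +
   offs x0 z (rshift n j) *: delta_mx ord0 (rshift n j), 0).

Let circ2 (j : 'I_n) (z : 'H[R]_n) : 'H[R]_n :=
  (offs x0 z (rshift n j) *: delta_mx ord0 (lshift n j) -
   offs x0 z (lshift n j) *: delta_mx ord0 (rshift n j), 0).

Lemma plane_rotE j t z :
  plane_rot j t z = cos t *: circ1 j z + sin t *: circ2 j z + (z - circ1 j z).
Proof.
apply: pair_ext; rewrite /=; last by rewrite !scaler0 !add0r subr0.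
by apply/rowP => l; rewrite /rotate /offs !mxE; ring.
Qed.

Lemma lrshift_neq (j : 'I_n) : lshift n j != rshift n j.
Proof. by rewrite eq_lrshift. Qed.

Lemma offs_rot j t z l : offs x0 (plane_rot j t z) l =
  if l == lshift n j then cos t * offs x0 z (lshift n j) + sin t * offs x0 z (rshift n j)
  else if l == rshift n j then cos t * offs x0 z (rshift n j) - sin t * offs x0 z (lshift n j)
  else offs x0 z l.
Proof.
rewrite /offs /plane_rot /rotate_H /rotate /= !mxE eqxx/=.
have [->|ni] := eqVneq l (lshift n j).
  by rewrite (negbTE (lrshift_neq j)) mulr1 mulr0; ring.
have [->|nj] := eqVneq l (rshift n j).
  by rewrite mulr1 mulr0; ring.
by rewrite !mulr0 !addr0.
Qed.

Lemma is_derive_rot u z j (t : R) : (forall w, differentiable u w) ->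
  is_derive t (1 : R) (fun t => u (plane_rot j t z)) (spin x0 j u (plane_rot j t z)).
Proof.
move=> du.
pose i := lshift n j; pose i' := rshift n j.
have H := is_derive_curve (circ1 j z) (circ2 j z) (z - circ1 j z) du
  (is_derive_cos t) (is_derive_sin t).
under eq_fun do rewrite plane_rotE.
apply: is_derive_eq H _; rewrite -plane_rotE.
rewrite derive_partials// /= !scaler0 addr0 mul0r addr0.
rewrite (bigD1 i)//= (bigD1 i')/=; last by rewrite eq_sym lrshift_neq.
rewrite big1 ?addr0; last first.
  move=> l /andP[/negbTE h1 /negbTE h2].
  by rewrite !mxE h1 h2 !andbF !(mulr0, mulr1); ring.
have ii : (i == i') = false by exact/negbTE/lrshift_neq.
have i'i : (i' == i) = false by rewrite eq_sym.
rewrite /spin !offs_rot -/i -/i' ii i'i !eqxx !mxE !eqxx ii i'i /= !(mulr0, mulr1).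
by move: (partial_x _ _ _) (partial_x _ _ _) => p q; ring.
Qed.

Lemma sumsq_rot j t z : sumsq a (plane_rot j t z) = sumsq a z.
Proof.
rewrite /sumsq -!/(offs x0 _ _).
under eq_bigr do rewrite -/(offs x0 _ _) offs_rot.
under [RHS]eq_bigr do rewrite -/(offs x0 _ _).
rewrite [LHS](bigD1 (lshift n j))//= [RHS](bigD1 (lshift n j))//= eqxx.
rewrite [X in _ + X = _](bigD1 (rshift n j)) /=; last by rewrite eq_sym lrshift_neq.
rewrite [X in _ = _ + X](bigD1 (rshift n j)) /=; last by rewrite eq_sym lrshift_neq.
rewrite (eq_sym (rshift n j)) (negbTE (lrshift_neq j)) eqxx !addrA; congr (_ + _).
  have := cos2Dsin2 t; move: (offs _ _ _) (offs _ _ _) (cos t) (sin t) => p q C S CS.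
  transitivity ((C ^+ 2 + S ^+ 2) * (p ^+ 2 + q ^+ 2)); first by ring.
  by rewrite CS mul1r addrC.
by apply: eq_bigr => l /andP[/negbTE -> /negbTE ->].
Qed.

Lemma gauge_rot j t z : gauge x0 c k (plane_rot j t z) = gauge x0 c k z.
Proof. by rewrite /gauge sumsq_rot. Qed.

Lemma ngrad_rot j t z : ngrad x0 c k (plane_rot j t z) = ngrad x0 c k z.
Proof. by rewrite /ngrad sumsq_rot gauge_rot. Qed.

Lemma measurable_rot2 j :
  measurable_fun setT (fun w : measurableTypeR R * T => plane_rot j w.1 w.2 : T).
Proof.
have mc : measurable_fun setT (fun w : measurableTypeR R * T => cos (w.1 : R)).
  by apply: (measurableT_comp _ measurable_fst); apply: continuous_measurable_fun; exact: continuous_cos.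
have ms : measurable_fun setT (fun w : measurableTypeR R * T => sin (w.1 : R)).
  by apply: (measurableT_comp _ measurable_fst); apply: continuous_measurable_fun; exact: continuous_sin.
have mo l : measurable_fun setT (fun w : measurableTypeR R * T => offs x0 w.2 l).
  exact: (measurableT_comp (measurable_offs x0 l) measurable_snd).
apply/measurable_fun_pairP; split => /=; last exact: (measurableT_comp measurable_snd measurable_snd).
apply: measurable_fun_rVP => l.
rewrite (_ : _ \o _ = fun w => offs x0 (plane_rot j w.1 w.2) l + a ord0 l); last first.
  by apply/funext => w; rewrite /offs subrK.
apply: measurable_funD => //.
case e1: (l == lshift n j); first under eq_fun do rewrite offs_rot e1.
  by apply: measurable_funD; apply: measurable_funM.
case e2: (l == rshift n j); under eq_fun do rewrite offs_rot e1 e2; last exact: mo.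
by apply: measurable_funB; apply: measurable_funM.
Qed.

End partial_derivatives.

(** * Averages over rotations *)

Section averages.
Context (R : realType) (n : nat) (x0 : 'H[R]_n) (c k : R).
Hypotheses (c0 : c != 0) (k0 : 0 < k).
Local Notation leb := (@lebesgue_measure R).
Local Notation muH := (@lebesgue_H R n).
Local Notation T := ('rV[R]_(n + n) * measurableTypeR R)%type.
Variable u : 'H[R]_n -> R.
Hypotheses (du : forall z, differentiable u z) (cu : forall v, continuous ('D_v u)).

Lemma measurable_spin j : measurable_fun setT (spin x0 j u : T -> R).
Proof. by apply: continuous_measurable_H; apply: continuous_spin. Qed.

Lemma measurable_euler : measurable_fun setT (euler x0 k u : T -> R).
Proof. by apply: continuous_measurable_H; apply: continuous_euler. Qed.

Lemma integral_is_derive (F f : R -> R) (s t : R) :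
  s < t -> (forall x, s <= x <= t -> is_derive x (1 : R) F (f x)) ->
  (forall x, s <= x <= t -> {for x, continuous f}) ->
  (\int[leb]_(x in `[s, t]) (f x)%:E = (F t)%:E - (F s)%:E)%E.
Proof.
move=> st dF cf; apply: continuous_FTC2 => //.
- apply: continuous_in_subspaceT => x; rewrite inE/= in_itv/=; exact: cf.
- have cF x : s <= x <= t -> {for x, continuous F}.
    by move=> h; exact: is_derive_continuous (dF x h).
  split.
  + by move=> x; rewrite in_itv/= => /andP[/ltW h1 /ltW h2]; have [] := dF x ltac:(by rewrite h1).
  + by apply: cvg_at_right_filter; apply: cF; rewrite lexx ltW.
  + by apply: cvg_at_left_filter; apply: cF; rewrite lexx ltW.
- move=> x; rewrite in_itv/= => /andP[/ltW h1 /ltW h2]; rewrite derive1E.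
  by have [_ ->] := dF x ltac:(by rewrite h1).
Qed.

Lemma continuous_rot j z : continuous (fun t => plane_rot x0 j t z).
Proof.
under eq_fun do rewrite plane_rotE.
move=> t; apply: cvgD; last exact: cvg_cst.
by apply: cvgD; apply: cvgZr_tmp; [exact: continuous_cos|exact: continuous_sin].
Qed.

(** spin u is the derivative of u along a closed orbit, so its integral over
    the orbit vanishes. *)
Lemma integral_spin_rot j z (C : R) :
  (\int[leb]_(t in `[0%R, (2 * pi)%R]) (spin x0 j u (plane_rot x0 j t z) + C)%:E =
   (2 * pi * C)%:E)%E.
Proof.
have p0 : 0 < 2 * pi :> R by rewrite mulr_gt0// pi_gt0.
have dF (t : R) : 0 <= t <= 2 * pi -> is_derive t (1 : R)
    (fun t => u (plane_rot x0 j t z) + t * C) (spin x0 j u (plane_rot x0 j t z) + C).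
  move=> _; apply: is_deriveD; first exact: is_derive_rot.
  by have := is_derive_affine C 0 t; under eq_fun do rewrite addr0.
rewrite (integral_is_derive p0 dF); last first.
  move=> x _; apply: cvgD; last exact: cvg_cst.
  apply: (@continuous_comp _ _ _ (fun t => plane_rot x0 j t z) (spin x0 j u)).
    exact: continuous_rot.
  exact: continuous_spin.
rewrite -EFinB; congr (_%:E).
have -> : plane_rot x0 j (2 * pi) z = plane_rot x0 j 0 z.
  by rewrite /plane_rot cos0 sin0 mulr_natl cos2pi sin2pi.
by ring.
Qed.

(** The measure and h are invariant under rotations, so spin u may be
    replaced by its mean over the rotation orbits, which is 0. Adding C
    makes the integrand nonnegative, as Tonelli's theorem requires. *)
Lemma rotation_average (h : T -> R) (j : 'I_n) (C : R) :
  measurable_fun setT h -> (forall z, 0 <= h z) ->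
  (forall t z, h (plane_rot x0 j t z) = h z) ->
  (forall z, h z != 0 -> `|spin x0 j u z| <= C) ->
  (\int[muH]_z (h z * (spin x0 j u z + C))%:E = \int[muH]_z (h z * C)%:E)%E.
Proof.
move=> mh h0 hr hC; have p0 : 0 < 2 * pi :> R by rewrite mulr_gt0// pi_gt0.
pose I : set (measurableTypeR R) := `[0, 2 * pi]%classic.
have mI : measurable I by exact: measurable_itv.
pose F (z : T) : \bar R := (h z * (spin x0 j u z + C))%:E.
have mF : measurable_fun setT F.
  apply/measurable_EFinP; apply: measurable_funM => //; apply: measurable_funD => //.
  exact: measurable_spin.
have F0 z : (0 <= F z)%E.
  rewrite lee_fin; have [->|hz] := eqVneq (h z) 0; first by rewrite mul0r.
  rewrite mulr_ge0//; have := hC z hz; rewrite ler_norml => /andP[+ _].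
  by rewrite -subr_ge0 opprK.
pose K (w : measurableTypeR R * T) : \bar R :=
  (((2 * pi)^-1 * \1_I w.1)%:E * F (plane_rot x0 j w.1 w.2))%E.
have mFr : measurable_fun setT (fun w : measurableTypeR R * T => F (plane_rot x0 j w.1 w.2)).
  exact: (measurableT_comp mF (measurable_rot2 x0 j)).
have mK : measurable_fun setT K.
  apply: emeasurable_funM => //; apply/measurable_EFinP; apply: measurable_funM => //.
  exact: (measurableT_comp (measurable_indic mI) measurable_fst).
have c0' t : 0 <= (2 * pi)^-1 * \1_I t :> R.
  by rewrite mulr_ge0// ?invr_ge0 ?ltW// indicE ler0n.
have K0 w : (0 <= K w)%E by rewrite /K mule_ge0// lee_fin.
have Fub := @fubini_tonelli _ _ _ _ R leb muH K mK K0.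
have L : (\int[leb]_t \int[muH]_z K (t, z) = \int[muH]_z F z)%E.
  transitivity (\int[leb]_t (((2 * pi)^-1 * \1_I t)%:E * \int[muH]_z F z))%E.
    apply: eq_integral => t _; pose Ft z := F (plane_rot x0 j t z).
    have mFt : measurable_fun setT (Ft : T -> \bar R).
      exact: (measurableT_comp mFr (measurable_pair1 t)).
    have EFt : (\int[muH]_z Ft z = \int[muH]_z F z)%E.
      apply: (ge0_integral_rotate_H (lrshift_neq j)) => //.
      by rewrite cos2Dsin2.
    rewrite -EFt -(ge0_integralZl muH measurableT mFt); first by [].
      by move=> z _; exact: F0.
    by rewrite lee_fin.
  have mc : measurable_fun setT (fun t : measurableTypeR R => ((2 * pi)^-1 * \1_I t : R)%:E).
    by apply/measurable_EFinP; apply: measurable_funM => //; exact: measurable_indic.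
  have c0e (t : measurableTypeR R) : setT t -> (0 <= ((2 * pi)^-1 * \1_I t : R)%:E)%E.
    by move=> _; rewrite lee_fin.
  have F00 : (0 <= \int[muH]_z F z)%E by apply: integral_ge0 => z _; exact: F0.
  rewrite (ge0_integralZr leb measurableT mc c0e F00).
  rewrite [X in (X * _)%E](_ : _ = 1%E) ?mul1e//.
  under eq_integral do rewrite EFinM.
  have mI1 : measurable_fun setT (fun t : measurableTypeR R => (\1_I t : R)%:E).
    by apply/measurable_EFinP; exact: measurable_indic.
  rewrite (ge0_integralZl leb measurableT mI1); last 2 first.
  - by move=> t _; rewrite lee_fin indicE ler0n.
  - by rewrite lee_fin invr_ge0 ltW.
  have lI : leb I = (2 * pi : R)%:E.
    by rewrite /I lebesgue_measure_itv/= lte_fin p0 -EFinB subr0.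
  rewrite integral_indic// setIT (etrans (congr1 (fun e => _ * e)%E lI) (esym (EFinM _ _))).
  by rewrite mulVf// gt_eqF.
transitivity (\int[muH]_z F z)%E => //; rewrite -L Fub; apply: eq_integral => z _.
rewrite /K /F/=.
transitivity ((h z * (2 * pi)^-1)%:E * \int[leb]_(t in I) (spin x0 j u (plane_rot x0 j t z) + C)%:E)%E.
  have [hz|hz] := eqVneq (h z) 0.
    rewrite hz mul0r mul0e integral0_eq// => t _.
    by rewrite hr hz mul0r mule0.
  rewrite -ge0_integralZl//; last 3 first.
  - apply/measurable_EFinP; apply: measurable_funD => //; apply: measurable_funTS.
    exact: (measurableT_comp (measurable_spin j) (measurableT_comp (measurable_rot2 x0 j) (measurable_pair2 z))).
  - move=> t _; rewrite lee_fin; have := hC (plane_rot x0 j t z); rewrite hr => /(_ hz).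
    by rewrite ler_norml => /andP[h1 _]; rewrite -(opprK C) subr_ge0.
  - by rewrite lee_fin mulr_ge0// invr_ge0 ltW.
  under [in RHS]eq_integral do rewrite -EFinM.
  rewrite [RHS]integral_indicl; apply: eq_integral => t _.
  by rewrite -EFinM hr; congr (_%:E); ring.
rewrite integral_spin_rot -EFinM; congr (_%:E).
by rewrite mulrA mulfVK// gt_eqF.
Qed.

End averages.

(** * Gauge balls, truncated weights and annuli *)

Section bounds.
Context (R : realType) (n : nat) (x0 : 'H[R]_n) (c k : R).
Hypotheses (c0 : c != 0) (k0 : 0 < k).
Local Notation leb := (@lebesgue_measure R).
Local Notation muH := (@lebesgue_H R n).
Local Notation T := ('rV[R]_(n + n) * measurableTypeR R)%type.
Local Notation psi := (@gauge R n x0 c k).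
Local Notation Sg := (@sumsq R n x0.1).
Local Notation tau := (@vtau R n x0).
Local Notation ngr := (@ngrad R n x0 c k).
Local Notation Q := ((2 * n)%:R + 2 * k).

Definition boxH (M : R) : set 'H[R]_n := @box R (n + n) M `*` `[- M, M]%classic.

Lemma boxH_lty M : (muH (boxH M) < +oo)%E.
Proof. exact: lebesgue_H_box_lty. Qed.

Lemma measurable_boxH M : measurable (boxH M : set T).
Proof. by apply: measurableX; [exact: measurable_box|exact: measurable_itv]. Qed.

Lemma compact_boxH M : compact (boxH M).
Proof.
apply: compact_setX; last exact: segment_compact.
rewrite (_ : box M = [set v : 'rV[R]_(n + n) | forall i, `[- M, M]%classic (v ord0 i)]).
  by apply: (@rV_compact R (n + n) (fun=> `[- M, M]%classic)) => i; exact: segment_compact.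
by apply/seteqP; split=> v h i; have := h i; rewrite /= in_itv/= ler_norml.
Qed.

Lemma continuous_bounded_boxH (f : 'H[R]_n -> R) M : continuous f ->
  exists C, forall z, boxH M z -> `|f z| <= C.
Proof.
move=> cf; have : compact (f @` boxH M).
  apply: continuous_compact; last exact: compact_boxH.
  exact: continuous_subspaceT.
move=> /compact_bounded[C [_ h]]; exists (C + 1) => z zM.
by apply: (h (C + 1)); [rewrite ltrDl|exists z].
Qed.

Lemma powR_le_inv (e x y : R) : 0 < e -> 0 <= x -> 0 <= y ->
  x `^ e <= y `^ e -> x <= y.
Proof.
move=> e0 x00 y00 h; rewrite leNgt; apply/negP => yx.
have := gt0_ltr_powR e0 (x := y) (y := x); rewrite !nnegrE => /(_ y00 x00 yx).
by rewrite ltNge h.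
Qed.

Lemma powR_le_mono (e x y : R) : 0 <= e -> 0 <= x -> x <= y -> x `^ e <= y `^ e.
Proof.
by move=> e0 x00 xy; apply: ge0_ler_powR; rewrite // nnegrE (le_trans x00).
Qed.

Lemma gauge_sumsq_le z : `|c| * Sg z `^ k <= psi z `^ (2 * k).
Proof.
have h : 0 <= `|c| * Sg z `^ k by rewrite mulr_ge0 ?powR_ge0.
rewrite -(@ler_pXn2r _ 2) ?nnegrE ?powR_ge0//.
rewrite -(powR_mulrn 2 (powR_ge0 (psi z) _)) -powRrM.
have -> : 2 * k * 2%:R = 4 * k by ring.
rewrite gauge4kE// exprMn real_normK ?num_real// -(powR_mulrn 2 (powR_ge0 (Sg z) _)) -powRrM.
by rewrite (mulrC k) /gauge4k lerDl sqr_ge0.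
Qed.

Lemma gauge_vtau_le z : `|tau z| <= psi z `^ (2 * k).
Proof.
rewrite -(@ler_pXn2r _ 2) ?nnegrE ?powR_ge0//.
rewrite -(powR_mulrn 2 (powR_ge0 (psi z) _)) -powRrM.
have -> : 2 * k * 2%:R = 4 * k by ring.
rewrite gauge4kE// real_normK ?num_real// /gauge4k lerDr.
by rewrite mulr_ge0 ?sqr_ge0 ?powR_ge0.
Qed.

Lemma sumsq_le_gauge z (rho : R) : psi z <= rho ->
  Sg z <= (rho `^ (2 * k) / `|c|) `^ k^-1.
Proof.
move=> pr; have cp : 0 < `|c| by rewrite normr_gt0.
have r0 : 0 <= rho by rewrite (le_trans (gauge_ge0 x0 c k z)).
apply: (powR_le_inv k0 (sumsq_ge0 x0 z) (powR_ge0 _ _)).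
rewrite -powRrM mulVf ?gt_eqF// powRr1 ?divr_ge0 ?powR_ge0//.
rewrite ler_pdivlMr// mulrC (le_trans (gauge_sumsq_le z))//.
by apply: powR_le_mono; [rewrite mulr_ge0// ltW|exact: gauge_ge0|].
Qed.

Lemma vtau_le_gauge z (rho : R) : psi z <= rho -> `|tau z| <= rho `^ (2 * k).
Proof.
move=> pr; apply: le_trans (gauge_vtau_le z) _.
by apply: powR_le_mono; [rewrite mulr_ge0// ltW|exact: gauge_ge0|].
Qed.

Lemma gauge_le_boxH (rho : R) : exists M, forall z, psi z <= rho -> boxH M z.
Proof.
pose S := (rho `^ (2 * k) / `|c|) `^ k^-1.
exists (S + 1 + (\sum_l `|x0.1 ord0 l|) + rho `^ (2 * k) + `|x0.2|) => z pr.
have r0 : 0 <= rho by rewrite (le_trans (gauge_ge0 x0 c k z)).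
have hS := sumsq_le_gauge pr; rewrite -/S in hS.
have ht := vtau_le_gauge pr.
have S0 : 0 <= S by exact: powR_ge0.
have s0 : 0 <= \sum_l `|x0.1 ord0 l| by apply: sumr_ge0.
have p0 : 0 <= rho `^ (2 * k) by exact: powR_ge0.
split=> /=.
  move=> l; have -> : z.1 ord0 l = offs x0 z l + x0.1 ord0 l by rewrite /offs subrK.
  have hl : `|offs x0 z l| <= S + 1.
    have h1 : offs x0 z l ^+ 2 <= S.
      apply: le_trans hS; rewrite /sumsq (bigD1 l)//= lerDl.
      by apply: sumr_ge0 => i _; rewrite sqr_ge0.
    rewrite -(@ler_pXn2r _ 2) ?nnegrE ?addr_ge0// real_normK ?num_real//.
    by rewrite (le_trans h1)// sqrrD expr1n mulr1 -addrA addrCA -mulr_natl; nra.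
  have ha : `|x0.1 ord0 l| <= \sum_l `|x0.1 ord0 l|.
    by rewrite (bigD1 l)//= lerDl; apply: sumr_ge0.
  rewrite (le_trans (ler_normD _ _))//.
  have := normr_ge0 x0.2; move: hl ha s0 p0 S0.
  move: `|offs _ _ _| `|x0.1 _ _| (\sum_l _) (rho `^ _) `|x0.2| => A B X Y Z; lra.
rewrite in_itv/= -ler_norml.
have -> : z.2 = tau z + x0.2 by rewrite /vtau subrK.
rewrite (le_trans (ler_normD _ _))//.
move: ht s0 p0 S0; move: `|tau _| (\sum_l _) (rho `^ _) `|x0.2| => A X Y Z; lra.
Qed.

Lemma measurable_gauge_le rho : measurable ([set z | psi z <= rho] : set T).
Proof.
rewrite -[X in measurable X]setTI (_ : mkset _ = psi @^-1` `]-oo, rho]%classic).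
  by apply: (measurable_gauge x0 c k measurableT); exact: measurable_itv.
by apply/seteqP; split=> z /=; rewrite in_itv.
Qed.

Lemma gauge_le_lty (rho : R) : (muH [set z | (psi z <= rho)%R] < +oo)%E.
Proof.
have [M hM] := gauge_le_boxH rho.
apply: le_lt_trans (boxH_lty M); apply: le_measure; rewrite ?inE//.
  exact: measurable_gauge_le.
exact: measurable_boxH.
Qed.

(** A region invariant under dilations and rotations on which ngrad is
    bounded; these regions exhaust the complement of the axis as M grows. *)
Definition offaxis (M : R) : set T := [set z | 0 < Sg z /\ `|tau z| <= M * Sg z `^ k].

Lemma measurable_offaxis M : measurable (offaxis M).
Proof.
rewrite (_ : offaxis M = (Sg @^-1` `]0, +oo[%classic) `&`
    ((fun z : T => M * Sg z `^ k - `|tau z|) @^-1` `[0, +oo[%classic)).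
  apply: measurableI; rewrite -[X in measurable X]setTI.
    by apply: (measurable_sumsq x0 measurableT); exact: measurable_itv.
  have m : measurable_fun setT (fun z : T => M * Sg z `^ k - `|tau z|).
    apply: measurable_funB.
      apply: measurable_funM => //.
      exact: (measurableT_comp (measurable_powR k) (measurable_sumsq x0)).
    by apply: (measurableT_comp _ (measurable_vtau x0)); exact: normr_measurable.
  by apply: m => //; exact: measurable_itv.
by apply/seteqP; split=> z /=; rewrite /offaxis/= !in_itv/= !andbT subr_ge0.
Qed.

Lemma offaxis_dil M l z : 0 < l -> offaxis M (dil x0 k l z) <-> offaxis M z.
Proof.
move=> l0; rewrite /offaxis/= sumsq_dil_powR// vtau_dil sumsq_dil pmulr_rgt0 ?exprn_gt0//.
rewrite normrM (ger0_norm (powR_ge0 _ _)) mulrCA ler_pM2l ?powR_gt0//.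
Qed.

Lemma offaxis_rot M j t z : offaxis M (plane_rot x0 j t z) <-> offaxis M z.
Proof. by rewrite /offaxis/= sumsq_rot. Qed.

Lemma offaxis_mono M M' : M <= M' -> offaxis M `<=` offaxis M'.
Proof.
by move=> MM z [S0 h]; split=> //; rewrite (le_trans h)// ler_wpM2r ?powR_ge0.
Qed.

Lemma ngrad_offaxis_le M z : offaxis M z -> ngr z <= (c ^+ 2 + M ^+ 2) `^ (4 * k)^-1.
Proof.
move=> [S0 hM]; have p0 := gauge_gt0 k c0 S0.
have k4 : 0 < 4 * k by rewrite mulr_gt0.
have X0 : 0 <= c ^+ 2 + M ^+ 2 by rewrite addr_ge0 ?sqr_ge0.
have h1 : psi z <= (c ^+ 2 + M ^+ 2) `^ (4 * k)^-1 * Sg z `^ 2^-1.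
  apply: (powR_le_inv k4 (ltW p0)); first by rewrite mulr_ge0 ?powR_ge0.
  rewrite gauge4kE// powRM ?powR_ge0// -!powRrM mulVf ?gt_eqF// powRr1//.
  have -> : 2^-1 * (4 * k) = 2 * k by field.
  rewrite mulrDl /gauge4k lerD2l.
  have -> : Sg z `^ (2 * k) = (Sg z `^ k) ^+ 2.
    by rewrite -(powR_mulrn 2 (powR_ge0 _ _)) -powRrM mulrC.
  rewrite -exprMn -(real_normK (num_real (tau z))) ler_pXn2r ?nnegrE//.
  exact: le_trans hM.
have -> : ngr z = (`|c| * Sg z `^ k / psi z `^ (2 * k)) * (psi z * Sg z `^ (- 2^-1)).
  rewrite /ngrad (@powRD _ (Sg z)) ?(gt_eqF S0) ?implybT// (@powRD _ (psi z)) ?(gt_eqF p0) ?implybT//.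
  rewrite powRr1 ?ltW// powRN; move: (_^-1) (Sg z `^ k) (Sg z `^ _) => A B C; ring.
rewrite -[leRHS]mul1r ler_pM//.
- by rewrite !mulr_ge0 ?invr_ge0 ?powR_ge0.
- by rewrite mulr_ge0 ?powR_ge0 ?ltW.
- by rewrite (ler_pdivrMr _ _ (powR_gt0 _ p0)) mul1r gauge_sumsq_le.
- by rewrite powRN (ler_pdivrMr _ _ (powR_gt0 _ S0)).
Qed.

(** When k < 1/2 the p-th power of ngrad blows up at the axis and may fail
    to be integrable; its truncation is always bounded. *)
Definition weight (p M : R) (z : T) : R := ngr z `^ p * \1_(offaxis M) z.

Lemma measurable_weight p M : measurable_fun setT (weight p M).
Proof.
apply: measurable_funM.
  exact: (measurableT_comp (measurable_powR p) (measurable_ngrad x0 c k)).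
by apply: measurable_indic; exact: measurable_offaxis.
Qed.

Lemma weight_ge0 p M z : 0 <= weight p M z.
Proof. by rewrite mulr_ge0 ?powR_ge0// indicE ler0n. Qed.

Lemma weight_dil p M l z : 0 < l -> weight p M (dil x0 k l z) = weight p M z.
Proof.
move=> l0; rewrite /weight (ngrad_dil _ _ k0 _ l0) !indicE; congr (_ * (nat_of_bool _)%:R).
by apply: eq_mem_set; exact: offaxis_dil.
Qed.

Lemma weight_rot p M j t z : weight p M (plane_rot x0 j t z) = weight p M z.
Proof.
rewrite /weight ngrad_rot !indicE; congr (_ * (nat_of_bool _)%:R).
by apply: eq_mem_set; exact: offaxis_rot.
Qed.

Lemma weight_neq0 p M z : weight p M z != 0 -> offaxis M z.
Proof.
rewrite /weight indicE; case: (boolP (z \in _)) => [|_]; last by rewrite mulr0 eqxx.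
by rewrite inE.
Qed.

Lemma weight_axis p M z : psi z = 0 -> weight p M z = 0.
Proof.
move=> pz; apply/eqP/negPn/negP => /weight_neq0[S0 _].
by have := gauge_gt0 k c0 S0; rewrite pz ltxx.
Qed.

Lemma weight_le p M z : 0 <= p -> weight p M z <= ((c ^+ 2 + M ^+ 2) `^ (4 * k)^-1) `^ p.
Proof.
move=> p0; rewrite /weight indicE; case: (boolP (z \in _)) => [|_]; last first.
  by rewrite mulr0 powR_ge0.
rewrite inE mulr1 => /ngrad_offaxis_le h.
by apply: powR_le_mono => //; exact: ngrad_ge0.
Qed.

Definition annulus (r r' : R) : set T := [set z | r <= psi z < r'].

Lemma measurable_annulus r r' : measurable (annulus r r').
Proof.
rewrite -[X in measurable X]setTI.
rewrite (_ : annulus r r' = psi @^-1` `[r, r'[%classic).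
  by apply: (measurable_gauge x0 c k measurableT); exact: measurable_itv.
by apply/seteqP; split=> z /=; rewrite in_itv.
Qed.

Lemma annulus_lty r r' : (muH (annulus r r') < +oo)%E.
Proof.
apply: le_lt_trans (gauge_le_lty r'); apply: le_measure; rewrite ?inE.
- exact: measurable_annulus.
- exact: measurable_gauge_le.
by move=> z /andP[_ /ltW].
Qed.

Lemma ray_integral (r r' : R) (f : T -> R) (z : T) : 0 < r -> r < r' -> 0 < psi z ->
  measurable_fun setT f ->
  (\int[leb]_(l in `]0%R, +oo[)
     ((f (dil x0 k l z) * \1_(annulus r r') (dil x0 k l z)) * l `^ (-1))%:E =
   \int[leb]_(l in `[(r / psi z)%R, (r' / psi z)%R]) (l `^ (-1) * f (dil x0 k l z))%:E)%E.
Proof.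
move=> r0 rr p0 mf.
have mfl : measurable_fun setT (fun l : measurableTypeR R => f (dil x0 k l z)).
  exact: (measurableT_comp mf (measurableT_comp (measurable_dil2 x0 k) (measurable_pair2 z))).
rewrite -integral_itv_bndo_bndc; last first.
  apply/measurable_EFinP; apply: measurable_funTS.
  by apply: measurable_funM; [exact: (@measurable_powR R (- 1))|exact: mfl].
rewrite [LHS]integral_indicl [RHS]integral_indicl; apply: eq_integral => l _; congr (_%:E); rewrite !indicE.
have [|lP] := boolP (l \in `]0, +oo[%classic); last first.
  rewrite mul0r; have -> : (l \in `[r / psi z, r' / psi z[%classic) = false; last by rewrite mul0r.
  apply: contraNF lP; rewrite !inE/= !in_itv/= andbT => /andP[h _].
  by apply: lt_le_trans h; rewrite divr_gt0.
rewrite inE/= in_itv/= andbT => l0.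
have -> : (l \in `[r / psi z, r' / psi z[%classic) = (dil x0 k l z \in annulus r r').
  apply: eq_mem_set; rewrite /annulus/= in_itv/= (gauge_dil _ _ k0 _ l0).
  by rewrite ler_pdivrMr// ltr_pdivlMr.
ring.
Qed.

(** The instance of polar_integral in which all the rays that meet the
    support of W have the same radial integral K. *)
Lemma polar_const (W f : T -> R) (K : R) :
  measurable_fun setT W -> measurable_fun setT f ->
  (forall z, 0 <= W z) -> (forall z, 0 <= f z) ->
  (forall l z, 0 < l -> W (dil x0 k l z) = W z) -> (forall z, psi z = 0 -> W z = 0) ->
  0 <= K ->
  (forall z, W z != 0 ->
    (\int[leb]_(l in `]0%R, +oo[) (f (dil x0 k l z) * l `^ (-1))%:E = K%:E)%E) ->
  (\int[muH]_z (psi z `^ (- Q) * W z * f z)%:E =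
   (Q * K)%:E * \int[muH]_(z in gauge_ball x0 c k 1) (W z)%:E)%E.
Proof.
move=> mW mf W0 f0 Wd Wz K0 hK.
rewrite (polar_integral k0 mW mf W0 f0 Wd Wz) EFinM -muleA; congr (_ * _)%E.
rewrite -ge0_integralZl//; last 3 first.
- exact: measurable_gauge_ball.
- by apply/measurable_EFinP; apply: measurable_funTS.
- by move=> z _; rewrite lee_fin.
apply: eq_integral => z _; rewrite muleC.
have [->|Wn] := eqVneq (W z) 0; first by rewrite !mule0.
by rewrite hK.
Qed.

End bounds.

(** * The lower bound for the energy *)

Import HBSimple HBNNSimple.

(** Nothing is known about the horizontal gradient of the gauge on the axis,
    not even its measurability. This lemma and the next one deal with
    integrals of arbitrary nonnegative functions. *)
Lemma ge0_integral_mono d (T : measurableType d) (R : realType)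
    (mu : {measure set T -> \bar R}) (f g : T -> \bar R) :
  (forall x, 0 <= f x)%E -> (forall x, f x <= g x)%E ->
  (\int[mu]_x f x <= \int[mu]_x g x)%E.
Proof.
move=> f0 fg; have g0 x : (0 <= g x)%E by exact: le_trans (f0 x) (fg x).
rewrite !ge0_integralTE//; apply: le_ereal_sup => _ [h hf <-].
by exists h => // x; exact: le_trans (hf x) (fg x).
Qed.

(** The integral of f is the supremum of the integrals of the simple
    functions below f, and these are not changed by the null set N. *)
Lemma ge0_integral_setD_null d (T : measurableType d) (R : realType)
    (mu : {measure set T -> \bar R}) (D N : set T) (f : T -> \bar R) :
  measurable N -> mu N = 0%E -> (forall x, 0 <= f x)%E ->
  (\int[mu]_(x in D) f x = \int[mu]_(x in D `\` N) f x)%E.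
Proof.
move=> mN N0 f0; apply/eqP; rewrite eq_le; apply/andP; split; last first.
  rewrite integral_mkcond [leRHS]integral_mkcond; apply: ge0_integral_mono => x.
    exact: erestrict_ge0.
  rewrite !patchE; case: ifPn => [|_]; last by case: ifP.
  by rewrite inE => -[Dx _]; rewrite mem_set.
rewrite [leLHS]ge0_integralE//; apply: ge_ereal_sup => _ [h hf <-].
have mh : measurable_fun setT (EFin \o h) by apply/measurable_EFinP.
have h0 x : setT x -> (0 <= (EFin \o h) x)%E by move=> _; rewrite /= lee_fin fun_ge0.
rewrite -integralT_nnsfun (ge0_negligible_integral mN measurableT mh h0 N0) setTD.
rewrite integral_mkcond [leRHS]integral_mkcond; apply: ge0_integral_mono => x.
  by apply: erestrict_ge0 => y; rewrite lee_fin fun_ge0.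
have := hf x; rewrite ![(_ \_ _) x]patchE.
have [xN|xN] := boolP (x \in ~` N); last by case: (x \in D `\` N).
have [xD|xD] := boolP (x \in D).
  by rewrite mem_set//; split; exact: set_mem.
by rewrite (@memNset _ (D `\` N))// => -[/mem_set]; rewrite (negbTE xD).
Qed.

Lemma annulus_rot (R : realType) (n : nat) (x0 : 'H[R]_n) (c k r r' : R) (j : 'I_n) t z :
  annulus x0 c k r r' (plane_rot x0 j t z) = annulus x0 c k r r' z.
Proof. by rewrite /annulus /mkset gauge_rot. Qed.

Section lower_bound.
Context (R : realType) (n : nat) (x0 : 'H[R]_n) (c k p : R).
Hypotheses (c0 : c != 0) (k0 : 0 < k) (p1 : 1 < p).
Local Notation leb := (@lebesgue_measure R).
Local Notation muH := (@lebesgue_H R n).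
Local Notation T := ('rV[R]_(n + n) * measurableTypeR R)%type.
Local Notation psi := (@gauge R n x0 c k).
Local Notation Sg := (@sumsq R n x0.1).
Local Notation tau := (@vtau R n x0).
Local Notation ngr := (@ngrad R n x0 c k).
Local Notation Q := ((2 * n)%:R + 2 * k).
Variables (r r' : R).
Hypotheses (r0 : 0 < r) (rr : r < r').
Local Notation A := (@annulus R n x0 c k r r').
Local Notation W := (@weight R n x0 c k p).
Local Notation B1 := (@gauge_ball R n x0 c k 1).

Let p0 : 0 < p. Proof. exact: lt_trans p1. Qed.

Lemma continuous_dil z (l : R) : 0 < l -> {for l, continuous (fun l => dil x0 k l z)}.
Proof.
move=> l0.
rewrite (funext (dil_curve x0 k ^~ z)); apply: cvgD; last exact: cvg_cst.
apply: cvgD; apply: cvgZr_tmp; first exact: cvg_id.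
exact: is_derive_continuous (is_derive1_powR (2 * k) l0).
Qed.

(** In the variable x = l psi(z) the integral is that of x^(al - 1) from r
    to r'. *)
Lemma ray_gauge z (al : R) (Lam : R -> R) : 0 < psi z ->
  (forall x : R, 0 < x -> is_derive x (1 : R) Lam (x `^ (al - 1))) ->
  (\int[leb]_(l in `[(r / psi z)%R, (r' / psi z)%R])
     (l `^ (-1) * psi (dil x0 k l z) `^ al)%:E = (Lam r' - Lam r)%:E)%E.
Proof.
move=> pz dLam.
have rp : r / psi z < r' / psi z by rewrite ltr_pM2r ?invr_gt0.
have l0 (l : R) : r / psi z <= l <= r' / psi z -> 0 < l.
  by move=> /andP[h _]; rewrite (lt_le_trans _ h)// divr_gt0.
transitivity (\int[leb]_(l in `[(r / psi z)%R, (r' / psi z)%R])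
     ((l * psi z) `^ (al - 1) * psi z)%:E)%E.
  apply: eq_integral => l; rewrite inE/= in_itv/= => /l0 lp; congr (_%:E).
  rewrite (gauge_dil _ _ k0 _ lp).
  rewrite (@powRD _ (l * psi z)) ?(gt_eqF (mulr_gt0 lp pz)) ?implybT//.
  rewrite (@powRM _ l (psi z) (-1) (ltW lp) (ltW pz)) (@powR_inv1 _ (psi z)) ?(ltW pz)//.
  by rewrite -!mulrA mulVf ?gt_eqF// mulr1 mulrC.
have dF (l : R) : r / psi z <= l <= r' / psi z ->
   is_derive l (1 : R) (fun l => Lam (l * psi z)) ((l * psi z) `^ (al - 1) * psi z).
  move=> /l0 lp; have h := is_derive_affine (psi z) 0 l.
  have lp' : 0 < l * psi z + 0 by rewrite addr0 mulr_gt0.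
  have := @is_derive1_comp _ Lam (fun l => l * psi z + 0) l _ _ (dLam _ lp') h.
  by rewrite addr0; rewrite (_ : _ \o _ = (fun l => Lam (l * psi z)))//;
    apply/funext => x /=; rewrite addr0.
rewrite (integral_is_derive rp dF).
  by rewrite !divfK ?gt_eqF// EFinB.
move=> l /l0 lp; apply: cvgM; last exact: cvg_cst.
have lp' : 0 < l * psi z by rewrite mulr_gt0.
apply: (@cvg_comp _ _ _ (fun l : R => l * psi z) (fun x : R => x `^ (al - 1)) _ (nbhs (l * psi z))).
  by apply: cvgM; [exact: cvg_id|exact: cvg_cst].
exact: is_derive_continuous (is_derive1_powR _ lp').
Qed.

Variable (M : R).

Let s : \bar R := (\int[muH]_(z in B1) (W M z)%:E)%E.

Lemma weight_integral_fin : (0 <= s)%E /\ (s < +oo)%E.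
Proof.
split; first by apply: integral_ge0 => z _; rewrite lee_fin weight_ge0.
pose CW := ((c ^+ 2 + M ^+ 2) `^ (4 * k)^-1) `^ p.
have mB : measurable (B1 : set T) by exact: measurable_gauge_ball.
apply: (@le_lt_trans _ _ (\int[muH]_(z in B1) CW%:E)%E).
  apply: ge0_le_integral => //.
  - by move=> z _; rewrite lee_fin weight_ge0.
  - by apply/measurable_EFinP; apply: measurable_funTS; exact: measurable_weight.
  - by move=> z _; rewrite lee_fin weight_le// ltW.
rewrite integral_cst// lte_mul_pinfty ?lee_fin ?powR_ge0//.
apply: le_lt_trans (gauge_le_lty x0 c0 k0 1); apply: le_measure; rewrite ?inE//.
  exact: measurable_gauge_le.
by move=> z /ltW.
Qed.

Let sr : R := fine s.
Let sE : s = sr%:E.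
Proof. by rewrite fineK// ge0_fin_numE; case: weight_integral_fin. Qed.
Let sr0 : 0 <= sr.
Proof. by rewrite fine_ge0//; case: weight_integral_fin. Qed.

Let G (z : T) : R := psi z `^ (- Q) * W M z * \1_A z.

Let G0 z : 0 <= G z.
Proof. by rewrite !mulr_ge0 ?powR_ge0 ?weight_ge0// indicE ler0n. Qed.

Let mG : measurable_fun setT G.
Proof.
apply: measurable_funM; last by apply: measurable_indic; exact: measurable_annulus.
apply: measurable_funM; last exact: measurable_weight.
exact: measurable_gauge_powR.
Qed.

Let GA z : G z != 0 -> z \in A /\ offaxis x0 k M z.
Proof.
rewrite /G; have [->|/weight_neq0 h] := eqVneq (W M z) 0; first by rewrite mulr0 mul0r eqxx.
by rewrite indicE; case: (z \in A) => //; rewrite mulr0 eqxx.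
Qed.

Lemma integral_annulus_powR (al : R) (Lam : R -> R) :
  (forall x : R, 0 < x -> is_derive x (1 : R) Lam (x `^ (al - 1))) ->
  0 <= Lam r' - Lam r ->
  (\int[muH]_z (psi z `^ (- Q) * W M z * (psi z `^ al * \1_A z))%:E =
    (Q * (Lam r' - Lam r) * sr)%:E)%E.
Proof.
move=> dLam L0.
have mf := measurable_gauge_powR x0 c k al.
rewrite (@polar_const _ _ x0 c k k0 (W M) (fun z => psi z `^ al * \1_A z) (Lam r' - Lam r)) //.
- by rewrite [RHS]EFinM -sE.
- exact: measurable_weight.
- apply: measurable_funM => //.
  by apply: measurable_indic; exact: measurable_annulus.
- exact: weight_ge0.
- by move=> z; rewrite mulr_ge0 ?powR_ge0// indicE ler0n.
- by move=> l z; exact: weight_dil.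
- exact: weight_axis.
- move=> z /weight_neq0[S0 _]; have pz := gauge_gt0 k c0 S0.
  by rewrite (@ray_integral _ _ x0 c k k0 r r' (fun z => psi z `^ al) z r0 rr pz mf) (ray_gauge pz dLam).
Qed.

Let L0 := ln r' - ln r.
Let L0_ge0 : 0 <= L0.
Proof. by rewrite subr_ge0 ler_ln ?posrE ?ltW// (lt_trans r0). Qed.

Let dln (x : R) : 0 < x -> is_derive x (1 : R) (@ln R) (x `^ (0 - 1)).
Proof. by move=> x00; rewrite sub0r powR_inv1 ?ltW//; exact: is_derive1_ln. Qed.

Let intG : (\int[muH]_z (G z)%:E = (Q * L0 * sr)%:E)%E.
Proof.
rewrite -(integral_annulus_powR dln L0_ge0); apply: eq_integral => z _.
by rewrite powRr0 mul1r.
Qed.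

Let integrableG (b : T -> R) (C : R) : measurable_fun setT b ->
  (forall z, G z != 0 -> `|b z| <= C) ->
  muH.-integrable setT (fun z => (G z * b z)%:E).
Proof.
move=> mb bC; apply: (@le_integrable _ _ _ muH _ measurableT _ (fun z => (C * G z)%:E)).
- by apply/measurable_EFinP; exact: measurable_funM.
- move=> z _; rewrite !abse_EFin lee_fin.
  have [->|Gn] := eqVneq (G z) 0; first by rewrite mul0r mulr0.
  have hC := bC z Gn; have C0 := le_trans (normr_ge0 _) hC.
  by rewrite (normrM (G z)) (normrM C) (ger0_norm (G0 z)) (ger0_norm C0) mulrC ler_wpM2r.
- apply: (@integrableZl _ _ _ muH _ measurableT C (EFin \o G)).
  apply/integrableP; split; first exact/measurable_EFinP.
  have -> : (\int[muH]_z `|(EFin \o G) z| = \int[muH]_z (G z)%:E)%E.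
    by apply: eq_integral => z _; rewrite [LHS]abse_EFin (ger0_norm (G0 z)).
  by rewrite intG ltry.
Qed.

Variable u : 'H[R]_n -> R.
Hypotheses (du : forall z, differentiable u z) (cu : forall v, continuous ('D_v u)).
Hypotheses (u1 : forall z, psi z <= r -> u z = 1) (u0 : forall z, r' <= psi z -> u z = 0).

Lemma ray_euler z (C : R) : 0 < psi z ->
  (\int[leb]_(l in `[(r / psi z)%R, (r' / psi z)%R])
     (l `^ (-1) * (euler x0 k u (dil x0 k l z) + C))%:E = (C * L0 - 1)%:E)%E.
Proof.
move=> pz.
have rp : r / psi z < r' / psi z by rewrite ltr_pM2r ?invr_gt0.
have l0 (l : R) : r / psi z <= l <= r' / psi z -> 0 < l.
  by move=> /andP[h _]; rewrite (lt_le_trans _ h)// divr_gt0.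
have dF (l : R) : r / psi z <= l <= r' / psi z ->
   is_derive l (1 : R) (fun l => u (dil x0 k l z) + C * ln l)
     (l `^ (-1) * (euler x0 k u (dil x0 k l z) + C)).
  move=> /l0 lp; have h1 := is_derive_dil x0 k z du lp.
  have h2 := is_deriveZ C (is_derive1_ln lp).
  apply: is_derive_eq (is_deriveD h1 h2) _.
  by rewrite /GRing.scale/= powR_inv1 ?ltW//; ring.
rewrite (integral_is_derive rp dF).
  have rp0 : 0 < r / psi z by rewrite divr_gt0.
  have rp0' : 0 < r' / psi z by rewrite divr_gt0// (lt_trans r0).
  rewrite u0 ?u1; last 2 first.
  - by rewrite (gauge_dil _ _ k0 _ rp0) divfK ?gt_eqF.
  - by rewrite (gauge_dil _ _ k0 _ rp0') divfK ?gt_eqF.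
  rewrite !ln_div ?posrE ?(lt_trans r0 rr)// -EFinB; congr (_%:E).
  by rewrite /L0; ring.
move=> l /l0 lp; apply: cvgM.
  exact: is_derive_continuous (is_derive1_powR (-1) lp).
apply: cvgD; last exact: cvg_cst.
apply: (@continuous_comp _ _ _ (fun l => dil x0 k l z) (euler x0 k u)).
  exact: continuous_dil.
exact: continuous_euler.
Qed.

Let bound_on_A (f : 'H[R]_n -> R) : continuous f ->
  exists2 C, 0 <= C & forall z, z \in A -> `|f z| <= C.
Proof.
move=> cf; have [B hB] := gauge_le_boxH x0 c0 k0 r'.
have [C hC] := continuous_bounded_boxH B cf.
exists `|C| => // z; rewrite inE => /andP[_ /ltW /hB /hC h].
by rewrite (le_trans h)// ler_norm.
Qed.

(** Along each ray u goes from 1 to 0, so the radial integral of euler u is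
    -1. *)
Let intGeuler : muH.-integrable setT (fun z => (G z * euler x0 k u z)%:E) /\
  (\int[muH]_z (G z * euler x0 k u z)%:E = (- (Q * sr))%:E)%E.
Proof.
have [C0 C00 hC0] := bound_on_A (continuous_euler (x0 := x0) (k := k) cu).
(* euler u + C is nonnegative because C >= C0, and so is its radial integral C L0 - 1 because C L0 >= 1 *)
pose C := C0 + L0^-1.
have L0p : 0 < L0 by rewrite subr_gt0 ltr_ln ?posrE// (lt_trans r0).
have C0C : C0 <= C by rewrite lerDl invr_ge0.
have Cp : 0 <= C by rewrite addr_ge0// invr_ge0.
have me := measurable_euler x0 k cu.
have i1 := integrableG me (fun z h => hC0 z (GA h).1).
split=> //.
have i2 : muH.-integrable setT (fun z => (G z * C)%:E).
  by apply: (integrableG (b := fun=> C) (C := C)) => // z _; rewrite ger0_norm.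
have E1 : (\int[muH]_z (G z * (euler x0 k u z + C))%:E = (Q * (C * L0 - 1) * sr)%:E)%E.
  have mf : measurable_fun setT (fun z : T => euler x0 k u z + C) by apply: measurable_funD.
  have K0 : 0 <= C * L0 - 1.
    by rewrite mulrDl mulVf ?gt_eqF// addrK mulr_ge0.
  transitivity (\int[muH]_z (psi z `^ (- Q) * W M z * ((euler x0 k u z + C) * \1_A z))%:E)%E.
    by apply: eq_integral => z _; congr (_%:E); rewrite /G; ring.
  rewrite (@polar_const _ _ x0 c k k0 (W M) (fun z => (euler x0 k u z + C) * \1_A z) (C * L0 - 1)) //.
  - by rewrite [RHS]EFinM -sE.
  - exact: measurable_weight.
  - apply: measurable_funM => //.
    by apply: measurable_indic; exact: measurable_annulus.
  - exact: weight_ge0.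
  - move=> z; rewrite indicE; case: (boolP (z \in A)) => [zA|_]; last by rewrite mulr0.
    rewrite mulr1; have := hC0 z zA; rewrite ler_norml => /andP[h _].
    by rewrite -lerBlDr sub0r (le_trans _ h)// lerN2.
  - by move=> l z; exact: weight_dil.
  - exact: weight_axis.
  - move=> z /weight_neq0[S0 _]; have pz := gauge_gt0 k c0 S0.
    by rewrite (@ray_integral _ _ x0 c k k0 r r' (fun z => euler x0 k u z + C) z r0 rr pz mf) (ray_euler C pz).
have E2 : (\int[muH]_z (G z * C)%:E = (Q * L0 * sr * C)%:E)%E.
  under eq_integral do rewrite EFinM.
  rewrite ge0_integralZr//; last 2 first.
  - exact/measurable_EFinP.
  - by move=> z _; rewrite lee_fin G0.
  by rewrite intG.
transitivity (\int[muH]_z ((G z * (euler x0 k u z + C))%:E - (G z * C)%:E))%E.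
  by apply: eq_integral => z _; rewrite -EFinB; congr (_%:E); ring.
rewrite integralB_EFin//.
  by rewrite E1 E2 -EFinB; congr (_%:E); ring.
apply: (integrableG (b := fun z => euler x0 k u z + C) (C := C0 + C)).
  by apply: measurable_funD.
move=> z /GA[zA _]; rewrite (le_trans (ler_normD _ _))//.
by rewrite (ger0_norm Cp) lerD2r hC0.
Qed.

(** By rotation_average when b >= 0; in general b is the difference of the
    nonnegative functions b + |B| and |B|. *)
Let spin0 (j : 'I_n) (b : T -> R) (B : R) : measurable_fun setT b ->
  (forall z, G z != 0 -> `|b z| <= B) ->
  (forall t z, b (plane_rot x0 j t z) = b z) ->
  muH.-integrable setT (fun z => (G z * (b z * spin x0 j u z))%:E) /\
  (\int[muH]_z (G z * (b z * spin x0 j u z))%:E = 0)%E.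
Proof.
move=> mb bB brot.
have cs : continuous (spin x0 j u) by apply: continuous_spin.
have [C C0 hC] := bound_on_A cs.
have ms := measurable_spin x0 cu j.
have B0' : 0 <= `|B| by [].
have i0 (b' : T -> R) (B' : R) : measurable_fun setT b' ->
    (forall z, G z != 0 -> `|b' z| <= B') ->
    muH.-integrable setT (fun z => (G z * (b' z * spin x0 j u z))%:E).
  move=> mb' bB'; apply: (integrableG (b := fun z => b' z * spin x0 j u z) (C := `|B'| * C)).
    by apply: measurable_funM.
  move=> z zG; rewrite normrM ler_pM// ?hC ?(GA zG).1//.
  by rewrite (le_trans (bB' _ zG))// ler_norm.
split; first exact: i0 bB.
have pos (b' : T -> R) (B' : R) : measurable_fun setT b' ->
    (forall z, G z != 0 -> 0 <= b' z <= B') ->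
    (forall t z, b' (plane_rot x0 j t z) = b' z) ->
    (\int[muH]_z (G z * (b' z * spin x0 j u z))%:E = 0)%E.
  move=> mb' bB' brot'.
  pose h z := G z * b' z.
  have mh : measurable_fun setT h by exact: measurable_funM.
  have Grot t z : G (plane_rot x0 j t z) = G z.
    have e1 : psi (plane_rot x0 j t z) = psi z by exact: gauge_rot.
    have e2 : W M (plane_rot x0 j t z) = W M z by exact: weight_rot.
    have e3 : \1_A (plane_rot x0 j t z) = \1_A z :> R.
      have e4 : (plane_rot x0 j t z \in A) = (z \in A).
        exact: (congr1 asbool (annulus_rot x0 c k r r' j t z)).
      by rewrite !indicE e4.
    by rewrite /G e1 e2 e3.
  have h0 z : 0 <= h z.
    rewrite /h; have [->|zG] := eqVneq (G z) 0; first by rewrite mul0r.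
    by rewrite mulr_ge0//; have /andP[] := bB' z zG.
  have hrot t z : h (plane_rot x0 j t z) = h z by rewrite /h Grot brot'.
  have hs z : h z != 0 -> `|spin x0 j u z| <= C.
    by rewrite /h mulf_eq0 negb_or => /andP[/GA[zA _] _]; exact: hC.
  have E := rotation_average du cu mh h0 hrot hs.
  have bn z : G z != 0 -> `|b' z| <= `|B'|.
    by move=> /bB' /andP[h1 h2]; rewrite ger0_norm// (le_trans h2)// ler_norm.
  have iC : muH.-integrable setT (fun z => (h z * C)%:E).
    under eq_fun do rewrite /h -mulrA.
    apply: (integrableG (b := fun z => b' z * C) (C := `|B'| * C)).
      by apply: measurable_funM.
    by move=> z zG; rewrite normrM (ger0_norm C0) ler_wpM2r// bn.
  have is1 : muH.-integrable setT (fun z => (h z * (spin x0 j u z + C))%:E).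
    under eq_fun do rewrite mulrDr EFinD.
    apply: integrableD => //.
    by under eq_fun do rewrite /h -mulrA; exact: i0 bn.
  transitivity (\int[muH]_z ((h z * (spin x0 j u z + C))%:E - (h z * C)%:E))%E.
    by apply: eq_integral => z _; rewrite -EFinB; congr (_%:E); rewrite /h; ring.
  rewrite integralB_EFin// E subee//.
  exact: integrable_fin_num.
transitivity (\int[muH]_z ((G z * ((b z + `|B|) * spin x0 j u z))%:E - (G z * (`|B| * spin x0 j u z))%:E))%E.
  by apply: eq_integral => z _; rewrite -EFinB; congr (_%:E); ring.
have mbB : measurable_fun setT (fun z => b z + `|B|) by apply: measurable_funD.
have bB2 z : G z != 0 -> 0 <= b z + `|B| <= `|B| + `|B|.
  move=> /bB h; have h2 := le_trans h (ler_norm B); move: h2; rewrite ler_norml => /andP[h2 h3].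
  by rewrite lerD2r h3 andbT -lerBlDr sub0r.
rewrite integralB_EFin//.
- rewrite (pos _ _ mbB bB2); last by move=> t z; rewrite brot.
  rewrite (pos (fun=> `|B|) `|B|) ?sube0//.
  by move=> z _; rewrite lexx normr_ge0.
- apply: (i0 (fun z => b z + `|B|) (`|B| + `|B|)) => // z /bB2 /andP[h1 h2].
  by rewrite ger0_norm.
- by apply: (i0 (fun=> `|B|) `|B|) => // z _; rewrite normr_id.
Qed.

(** The coefficient of the rotations in euler_spin_le. *)
Let kap (z : T) : R := tau z / (c * Sg z `^ k).

Let mkap : measurable_fun setT kap.
Proof.
rewrite (_ : kap = fun z => c^-1 * (tau z * Sg z `^ (- k))).
  apply: measurable_funM => //; apply: measurable_funM; first exact: measurable_vtau.
  exact: (measurableT_comp (measurable_powR _) (measurable_sumsq x0)).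
by apply/funext => z; rewrite /kap powRN invfM mulrCA.
Qed.

Let V (z : T) : R := G z * (euler x0 k u z + kap z * \sum_j spin x0 j u z).

Let intV : muH.-integrable setT (EFin \o V) /\ (\int[muH]_z (V z)%:E = (- (Q * sr))%:E)%E.
Proof.
have [i1 E1] := intGeuler.
have kB z : G z != 0 -> `|kap z| <= M / `|c|.
  move=> /GA[_ [S0 h]]; rewrite /kap normrM normfV normrM (ger0_norm (powR_ge0 _ _)) invfM mulrA.
  by rewrite mulrAC ler_wpM2r ?invr_ge0// ler_pdivrMr ?powR_gt0.
have kr j t z : kap (plane_rot x0 j t z) = kap z by rewrite /kap sumsq_rot.
have hj j := spin0 mkap kB (kr j).
have VE : EFin \o V = fun z => ((G z * euler x0 k u z)%:E +
    \sum_j (G z * (kap z * spin x0 j u z))%:E)%E.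
  apply/funext => z; rewrite /V /= sumEFin -EFinD mulrDr; congr (_ + _)%:E.
  by rewrite !mulr_sumr.
have isum : muH.-integrable setT (fun z => \sum_j (G z * (kap z * spin x0 j u z))%:E)%E.
  by apply: integrable_sum => // j _; exact: (hj j).1.
split; first by rewrite VE; apply: integrableD.
rewrite (_ : (fun z => _) = (EFin \o V))// VE integralD//.
rewrite E1 integral_sum//; last by move=> j; exact: (hj j).1.
by rewrite big1 ?adde0// => j _; exact: (hj j).2.
Qed.

Lemma measurable_hgrad_norm : measurable_fun setT (hgrad_norm x0.1 c k u : T -> R).
Proof.
have mD v : measurable_fun setT ('D_v u : T -> R) by apply: continuous_measurable_H; exact: cu.
have mS : measurable_fun setT (fun z : T => Sg z `^ (k - 1)).
  exact: (measurableT_comp (measurable_powR _) (measurable_sumsq x0)).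
have mh i : measurable_fun setT (hfield x0.1 c k i u : T -> R).
  rewrite /hfield; case: (fintype.split i) => j.
    apply: measurable_funD; first exact: mD.
    apply: measurable_funM; last exact: mD.
    apply: measurable_funM => //; apply: measurable_funM => //.
    exact: (measurable_offs x0).
  apply: measurable_funB; first exact: mD.
  apply: measurable_funM; last exact: mD.
  apply: measurable_funM => //; apply: measurable_funM => //.
  exact: (measurable_offs x0).
have -> : (hgrad_norm x0.1 c k u : T -> R) = fun z => Num.sqrt (\sum_i (hfield x0.1 c k i u z) ^+ 2).
  by apply/funext => z; exact: hgrad_normE.
apply: (@measurableT_comp _ _ _ _ _ _ (@Num.sqrt R)).
  by apply: continuous_measurable_fun; exact: sqrt_continuous.
by apply: measurable_sum => i; apply: measurable_funX; exact: mh.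
Qed.

Variables (al : R) (Lam : R -> R).
Hypothesis alE : al = (Q - p) / (1 - p).
Hypothesis dLam : forall x : R, 0 < x -> is_derive x (1 : R) Lam (x `^ (al - 1)).
Local Notation L := (Lam r' - Lam r).
Hypothesis L_gt0 : 0 < L.

Let q := p / (p - 1).

(** Young's inequality applied to the bound of euler_spin_le. The scaling by
    t gives equality for the minimizer (Lam r' - Lam psi) / L, whose
    gradient has norm psi^(al - 1) ngrad / L. *)
Lemma young_pointwise z : `|V z| <=
  L `^ (p - 1) / p * (hgrad_norm x0.1 c k u z `^ p * \1_(gauge_ball x0 c k r') z) +
  (L^-1 / q) * (psi z `^ (- Q) * W M z * (psi z `^ al * \1_A z)).
Proof.
have p10 : 0 < p - 1 by rewrite subr_gt0.
have q0 : 0 < q by rewrite divr_gt0.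
set H := hgrad_norm _ _ _ _ _.
have H0 : 0 <= H by exact: sqrtr_ge0.
have [Gz|Gn] := eqVneq (G z) 0.
  rewrite /V Gz mul0r normr0 addr_ge0// mulr_ge0 ?divr_ge0 ?powR_ge0 ?(ltW p0)//.
  - by rewrite mulr_ge0 ?powR_ge0// indicE ler0n.
  - by rewrite invr_ge0 ltW.
  - exact: ltW.
  - by rewrite !mulr_ge0 ?powR_ge0 ?weight_ge0// indicE ler0n.
have [zA zO] := GA Gn; have [S0 _] := zO.
have pz := gauge_gt0 k c0 S0; have N0 := ngrad_gt0 k c0 S0.
have zB : z \in gauge_ball x0 c k r' by move: zA; rewrite !inE => /andP[].
have h := euler_spin_le c0 k0 u S0; rewrite -/(kap z) -/H in h.
rewrite /V /G /weight !indicE zA zB (mem_set zO) !mulr1.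
set E := euler x0 k u z + _ in h *.
have Np : ngr z `^ p = ngr z `^ (p - 1) * ngr z.
  by rewrite -{3}(@powRr1 _ (ngr z) (ltW N0)) -powRD ?(gt_eqF N0) ?implybT// subrK.
rewrite !normrM !(ger0_norm (powR_ge0 _ _)) Np.
have b0 : 0 <= psi z `^ (- Q) * ngr z `^ (p - 1) * psi z by rewrite !mulr_ge0 ?powR_ge0// ltW.
apply: (@le_trans _ _ (H * (psi z `^ (- Q) * ngr z `^ (p - 1) * psi z))).
  have -> : forall w x y e : R, w * (x * y) * e = (w * x) * (y * e) by move=> *; ring.
  rewrite [leRHS](_ : _ = psi z `^ (- Q) * ngr z `^ (p - 1) * (psi z * H)); last by rewrite [LHS]mulrC mulrA.
  apply: ler_wpM2l; last exact: h.
  by apply: mulr_ge0; exact: powR_ge0.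
set b := (X in H * X) in b0 *.
pose t := L `^ q^-1.
have t0 : 0 < t by exact: powR_gt0.
have -> : H * b = (t * H) * (t^-1 * b).
  by rewrite mulrACA mulfV ?gt_eqF// mul1r.
have pq : p^-1 + q^-1 = 1.
  by rewrite /q; field; rewrite !gt_eqF.
have Y := @conjugate_powR _ (t * H) (t^-1 * b) p q
  (mulr_ge0 (ltW t0) H0) (mulr_ge0 (eq_ind_r (fun x => 0 <= x) (ltW (divr_gt0 ltr01 t0)) (esym (mul1r t^-1))) b0) p0 q0 pq.
apply: (le_trans Y); rewrite le_eqVlt; apply/orP; left; apply/eqP.
rewrite (powRM _ (ltW t0) H0) powRM ?invr_ge0 ?(ltW t0)//.
congr (_ + _).
  rewrite /t -powRrM; have -> : q^-1 * p = p - 1 by rewrite /q; field; rewrite !gt_eqF.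
  by rewrite mulrAC.
have -> : t^-1 `^ q = L^-1.
  rewrite /t -powRN -powRrM mulNr mulVf ?gt_eqF// powR_inv1 ?ltW//.
rewrite mulrAC; congr (_ * _).
rewrite -Np.
have bE : b = psi z `^ (1 - Q) * ngr z `^ (p - 1).
  rewrite /b mulrAC -{2}(@powRr1 _ (psi z) (ltW pz)); congr (_ * _).
  by rewrite -powRD ?(gt_eqF pz) ?implybT// addrC.
rewrite bE (@powRM _ (psi z `^ (1 - Q)) _ q (powR_ge0 _ _) (powR_ge0 _ _)) -(powRrM (psi z)) -(powRrM (ngr z)).
have -> : (p - 1) * q = p by rewrite /q mulrC divfK ?gt_eqF.
rewrite mulrAC -(@powRD _ (psi z) (- Q) al) ?(gt_eqF pz) ?implybT//; congr (_ `^ _ * _).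
rewrite alE /q; have p1n : 1 - p != 0 by rewrite subr_eq0 lt_eqF.
have p1n' : p - 1 != 0 by rewrite gt_eqF.
by generalize Q => Q0; field; rewrite p1n p1n'.
Qed.

Let Bs := gauge_ball x0 c k r'.

(** In the integral of young_pointwise the last term is the fraction 1/q of
    the left-hand side Q sr, and what remains is Q sr / p. *)
Lemma weight_energy_le :
  (((Q * sr) * L `^ (1 - p))%:E <= henergy x0.1 c k p Bs u)%E.
Proof.
set E := henergy _ _ _ _ _ _.
have p10 : 0 < p - 1 by rewrite subr_gt0.
have mB : measurable (Bs : set T) by exact: measurable_gauge_ball.
have mH : measurable_fun setT (fun z : T => hgrad_norm x0.1 c k u z `^ p * \1_Bs z).
  apply: measurable_funM; last exact: measurable_indic.
  exact: (measurableT_comp (measurable_powR _) measurable_hgrad_norm).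
have H0 z : 0 <= hgrad_norm x0.1 c k u z `^ p * \1_Bs z.
  by rewrite mulr_ge0 ?powR_ge0// indicE ler0n.
have EE : E = (\int[muH]_z (hgrad_norm x0.1 c k u z `^ p * \1_Bs z)%:E)%E.
  rewrite /E /henergy integral_mkcond; apply: eq_integral => z _.
  by rewrite patchE indicE; case: ifP => _; rewrite ?mulr1// mulr0.
have [->|Efin] := eqVneq E +oo%E; first by rewrite leey.
have E0 : (0 <= E)%E by apply: integral_ge0 => z _; rewrite lee_fin powR_ge0.
have [e Ee] : exists e, E = e%:E by exists (fine E); rewrite fineK// fin_numE; apply/andP; split=> //; apply/eqP => h; rewrite h in E0.
have [iV EV] := intV.
have Lp0 : 0 < L `^ (p - 1) by exact: powR_gt0.
pose F z := psi z `^ (- Q) * W M z * (psi z `^ al * \1_A z).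
have F0 z : 0 <= F z.
  by rewrite /F !mulr_ge0 ?powR_ge0 ?weight_ge0// indicE ler0n.
have mF : measurable_fun setT F.
  apply: measurable_funM; apply: measurable_funM.
  - exact: measurable_gauge_powR.
  - exact: measurable_weight.
  - exact: measurable_gauge_powR.
  - by apply: measurable_indic; exact: measurable_annulus.
have EF := integral_annulus_powR dLam (ltW L_gt0).
have q0 : 0 < q by rewrite divr_gt0.
have C10 : 0 <= L `^ (p - 1) / p by rewrite divr_ge0 ?powR_ge0 ?ltW.
have C20 : 0 <= L^-1 / q by rewrite divr_ge0 ?invr_ge0 ?ltW.
have le1 : ((Q * sr)%:E <= (L `^ (p - 1) / p)%:E * E + (L^-1 / q)%:E * (Q * L * sr)%:E)%E.
  have -> : ((Q * sr)%:E = `| \int[muH]_z (V z)%:E |)%E.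
    by rewrite EV abse_EFin normrN ger0_norm// (mulr_ge0 (ltW (Q_gt0 n k0)) sr0).
  apply: (le_trans (le_abse_integral muH measurableT (measurable_int _ iV))).
  rewrite EE -EF.
  have mH' := (measurable_EFinP _ _).2 mH; have mF' := (measurable_EFinP _ _).2 mF.
  have H0' z : [set: T] z -> (0 <= (hgrad_norm x0.1 c k u z `^ p * \1_Bs z)%:E)%E.
    by move=> _; rewrite lee_fin; exact: H0.
  have F0' z : [set: T] z -> (0 <= (F z)%:E)%E by move=> _; rewrite lee_fin; exact: F0.
  have C10' : (0 <= (L `^ (p - 1) / p)%:E)%E by rewrite lee_fin.
  have C20' : (0 <= (L^-1 / q)%:E)%E by rewrite lee_fin.
  rewrite -(ge0_integralZl muH measurableT mH' H0' C10').
  rewrite -(ge0_integralZl muH measurableT mF' F0' C20').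
  rewrite -ge0_integralD//; last 4 first.
  - by move=> z _; rewrite lee_fin mulr_ge0.
  - exact: measurable_funeM.
  - by move=> z _; rewrite lee_fin mulr_ge0.
  - exact: measurable_funeM.
  apply: ge0_le_integral => //.
  - by apply: measurableT_comp => //; exact: (measurable_int _ iV).
  - by apply: emeasurable_funD; exact: measurable_funeM.
  - by move=> z _; rewrite abse_EFin -!EFinM -EFinD lee_fin young_pointwise.
move: le1; rewrite Ee -!EFinM -EFinD !lee_fin => le1.
have qE : q^-1 = 1 - p^-1 by rewrite /q; field; rewrite !gt_eqF.
have Ln : L != 0 by rewrite gt_eqF.
have e1 : L^-1 / q * (Q * L * sr) = (Q * sr) * (1 - p^-1).
  rewrite qE -[RHS]mul1r -(mulVf Ln); move: (L^-1) (p^-1) L Q => *; ring.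
rewrite e1 in le1.
have le2 : Q * sr <= L `^ (p - 1) * e.
  move: le1; move: (Q * sr) (L `^ (p - 1)) => X Y le1.
  rewrite -(@ler_pM2r _ p^-1) ?invr_gt0//.
  by move: le1; move: (p^-1) => pv h; lra.
by rewrite -(opprB p 1) powRN ler_pdivrMr// (mulrC e).
Qed.

End lower_bound.

Section lower_bound_limit.
Context (R : realType) (n : nat) (x0 : 'H[R]_n) (c k p : R).
Hypotheses (n0 : (0 < n)%N) (c0 : c != 0) (k0 : 0 < k) (p1 : 1 < p).
Local Notation muH := (@lebesgue_H R n).
Local Notation T := ('rV[R]_(n + n) * measurableTypeR R)%type.
Local Notation psi := (@gauge R n x0 c k).
Local Notation Sg := (@sumsq R n x0.1).
Local Notation ngr := (@ngrad R n x0 c k).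
Local Notation Q := ((2 * n)%:R + 2 * k).
Local Notation W := (@weight R n x0 c k p).
Local Notation B1 := (@gauge_ball R n x0 c k 1).

Lemma axis_negligible :
  measurable [set z : T | Sg z = 0] /\ muH [set z : T | Sg z = 0] = 0%E.
Proof.
have mA : measurable [set z : T | Sg z = 0].
  rewrite -[X in measurable X]setTI; exact: (measurable_sumsq x0 measurableT (measurable_set1 0)).
split=> //; pose i := lshift n (Ordinal n0).
have mH : measurable [set z : T | z.1 ord0 i = x0.1 ord0 i].
  rewrite (_ : [set z : T | _] = setT `&` (fun z : T => z.1 ord0 i - x0.1 ord0 i) @^-1` [set 0]).
    exact: (measurable_offs x0 i measurableT (measurable_set1 0)).
  rewrite setTI; apply/seteqP; split=> z /= h; first by rewrite h subrr.
  by apply/eqP; rewrite -subr_eq0 h.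
apply/eqP; rewrite -measure_le0 -(lebesgue_H_hyperplane i (x0.1 ord0 i)).
apply: le_measure; rewrite ?inE// => z /= /eqP; rewrite psumr_eq0; last by move=> l _; rewrite sqr_ge0.
by move=> /allP /(_ i (mem_index_enum _)); rewrite sqrf_eq0 subr_eq0 => /eqP.
Qed.

Definition axisC : set T := [set z | 0 < Sg z].

Lemma measurable_axisC : measurable axisC.
Proof.
rewrite -[X in measurable X]setTI (_ : axisC = Sg @^-1` `]0, +oo[%classic).
  by apply: (measurable_sumsq x0 measurableT); exact: measurable_itv.
by apply/seteqP; split=> z /=; rewrite in_itv/= andbT.
Qed.

Lemma gauge_ball_axisC rho :
  gauge_ball x0 c k rho `\` [set z : T | Sg z = 0] = gauge_ball x0 c k rho `&` axisC.
Proof.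
apply/seteqP; split=> z [zB zS]; split=> //.
  by rewrite /axisC/= lt0r sumsq_ge0 andbT; apply/eqP.
by move=> h; move: zS; rewrite /axisC/= h ltxx.
Qed.

Lemma sigma_ngrad :
  (sigma x0 c k p = \int[muH]_(z in B1) ((ngr z `^ p) * \1_axisC z)%:E)%E.
Proof.
have [mA A0] := axis_negligible.
rewrite /sigma /henergy.
rewrite (ge0_integral_setD_null _ mA A0); last by move=> z; rewrite lee_fin powR_ge0.
rewrite [RHS](ge0_integral_setD_null _ mA A0); last first.
  by move=> z; rewrite lee_fin mulr_ge0 ?powR_ge0// indicE ler0n.
apply: eq_integral => z; rewrite gauge_ball_axisC inE => -[_ S0].
by rewrite indicE (mem_set S0) mulr1 (hgrad_norm_gauge c0 k0 S0).
Qed.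

(** Monotone convergence in weight_energy_le as the truncation parameter
    goes to infinity. *)
Lemma energy_ge_sigma (r r' al : R) (Lam : R -> R) (u : 'H[R]_n -> R) :
  0 < r -> r < r' -> al = (Q - p) / (1 - p) ->
  (forall x : R, 0 < x -> is_derive x (1 : R) Lam (x `^ (al - 1))) ->
  0 < Lam r' - Lam r ->
  (forall z, differentiable u z) -> (forall v, continuous ('D_v u)) ->
  (forall z, psi z <= r -> u z = 1) -> (forall z, r' <= psi z -> u z = 0) ->
  ((Q * (Lam r' - Lam r) `^ (1 - p))%:E * sigma x0 c k p <=
     henergy x0.1 c k p (gauge_ball x0 c k r') u)%E.
Proof.
move=> r0 rr alE dLam L0 du cu u1 u0.
set E := henergy _ _ _ _ _ _; set K := Q * _.
have K0 : 0 < K by rewrite mulr_gt0 ?powR_gt0 ?Q_gt0.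
pose s m : \bar R := (\int[muH]_(z in B1) (W m%:R z)%:E)%E.
have hm (m : nat) : (K%:E * s m <= E)%E.
  have := weight_energy_le c0 k0 p1 r0 rr m%:R du cu u1 u0 alE dLam L0.
  have [s0 sf] := weight_integral_fin x0 c0 k0 p1 m%:R.
  rewrite -/E; apply: le_trans.
  rewrite -/(s m) -{1}(@fineK _ (s m)) ?ge0_fin_numE// -EFinM lee_fin /K.
  by rewrite mulrAC.
have scvg : s @ \oo --> sigma x0 c k p.
  rewrite sigma_ngrad.
  have mW (m : nat) : measurable_fun B1 (fun z : T => (W m%:R z)%:E).
    by apply/measurable_EFinP; apply: measurable_funTS; exact: measurable_weight.
  have mB : measurable (B1 : set T) by exact: measurable_gauge_ball.
  have W0 (m : nat) z : B1 z -> (0 <= (W m%:R z)%:E)%E by move=> _; rewrite lee_fin weight_ge0.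
  have Wnd z : B1 z -> nondecreasing_seq (fun m : nat => (W m%:R z)%:E).
    move=> _ m m' mm'; rewrite lee_fin /weight ler_wpM2l ?powR_ge0// !indicE ler_nat.
    case: (boolP (z \in offaxis x0 k m%:R)) => // /set_mem h; rewrite mem_set//.
    by apply: offaxis_mono h; rewrite ler_nat.
  have := @cvg_monotone_convergence _ _ _ muH _ mB _ mW W0 Wnd.
  rewrite (_ : (\int[muH]_(z in B1) limn _)%E = (\int[muH]_(z in B1) (ngr z `^ p * \1_axisC z)%:E)%E)//.
  apply: eq_integral => z _; apply: lim_near_cst => //.
  have [S0|S0] := ltP 0 (Sg z); last first.
    apply: nearW => m; rewrite /weight !indicE !memNset ?mulr0//.
      by rewrite /axisC/= ltNge S0.
    by move=> -[]; rewrite ltNge S0.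
  near=> m; rewrite /weight !indicE !mem_set//.
  split=> //; rewrite -ler_pdivrMr ?powR_gt0//.
  by near: m; exact: nbhs_infty_ger.
have : (fun m => K%:E * s m)%E @ \oo --> (K%:E * sigma x0 c k p)%E.
  by apply: cvgeZl.
move=> h; rewrite -(cvg_lim _ h)//.
apply: lime_le; first by apply/cvg_ex; exists (K%:E * sigma x0 c k p)%E.
by near=> m; exact: hm.
Unshelve. all: by end_near.
Qed.

End lower_bound_limit.

(** * Smooth functions *)

Section smooth_closure.
Context (R : realType) (n : nat).
Local Notation H := ('H[R]_n).
Implicit Types (u w : H -> R) (m : nat).

Lemma class_C_continuous m u : class_C m u -> continuous u.
Proof.
case: m => // m [du _] z; exact: differentiable_continuous.
Qed.

Lemma class_CS m u : class_C m.+1 u -> class_C m u.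
Proof.
elim: m u => [|m IH] u; first exact: class_C_continuous.
by move=> [du cu]; split=> // v; apply: IH; exact: cu.
Qed.

Lemma class_C_cst m (b : R) : class_C m (fun _ : H => b).
Proof.
elim: m b => [|m IH] b; first exact: cst_continuous.
split=> [z|v]; first exact: differentiable_cst.
have -> : 'D_v (fun _ : H => b) = fun=> 0 by apply/funext => z; exact: derive_cst.
exact: IH.
Qed.

Lemma class_CD m u w : class_C m u -> class_C m w -> class_C m (fun z => u z + w z).
Proof.
elim: m u w => [|m IH] u w.
  by move=> cu cw z; apply: cvgD; [exact: cu|exact: cw].
move=> [du cu] [dw cw]; split=> [z|v]; first exact: differentiableD.
have -> : 'D_v (fun z => u z + w z) = fun z => 'D_v u z + 'D_v w z.
  by apply/funext => z; apply: deriveD; exact: diff_derivable.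
by apply: IH; [exact: cu|exact: cw].
Qed.

Lemma class_CM m u w : class_C m u -> class_C m w -> class_C m (fun z => u z * w z).
Proof.
elim: m u w => [|m IH] u w.
  by move=> cu cw z; apply: cvgM; [exact: cu|exact: cw].
move=> hu hw; have cu' := class_CS hu; have cw' := class_CS hw.
case: hu hw => [du cu] [dw cw]; split=> [z|v]; first exact: differentiableM.
have -> : 'D_v (fun z => u z * w z) = fun z => u z * 'D_v w z + w z * 'D_v u z.
  by apply/funext => z; apply: deriveM; exact: diff_derivable.
by apply: class_CD; [exact: IH cu' (cw v)|exact: IH cw' (cu v)].
Qed.

Lemma smooth_cst (b : R) : smooth (fun _ : H => b).
Proof. by move=> m; exact: class_C_cst. Qed.

Lemma smoothD u w : smooth u -> smooth w -> smooth (fun z => u z + w z).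
Proof. by move=> hu hw m; apply: class_CD. Qed.

Lemma smoothM u w : smooth u -> smooth w -> smooth (fun z => u z * w z).
Proof. by move=> hu hw m; apply: class_CM. Qed.

Lemma smooth_sum (I : Type) (s : seq I) (F : I -> H -> R) :
  (forall i, smooth (F i)) -> smooth (fun z => \sum_(i <- s) F i z).
Proof.
move=> hF; elim: s => [|i s IH].
  rewrite (_ : (fun z => _) = fun=> 0); first exact: smooth_cst.
  by apply/funext => z; rewrite big_nil.
rewrite (_ : (fun z => _) = fun z => F i z + \sum_(j <- s) F j z); first exact: smoothD.
by apply/funext => z; rewrite big_cons.
Qed.

Lemma smooth_affine u (D : H -> R) : (forall z, differentiable u z) ->
  (forall v z, 'D_v u z = D v) -> smooth u.
Proof.
move=> du Du [|m]; first by move=> z; exact: differentiable_continuous.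
split=> // v; have -> : 'D_v u = fun=> D v by apply/funext => z.
exact: class_C_cst.
Qed.

End smooth_closure.

Section smooth_comp.
Context (R : realType) (n : nat).
Local Notation H := ('H[R]_n).

(** Used with open sets D only, for which it says that f is of class C^m on
    D; the powers, for instance, are smooth on the positive half line. *)
Fixpoint smooth_on (m : nat) (D : set R) (f : R -> R) : Prop :=
  match m with
  | 0 => forall x, D x -> {for x, continuous f}
  | m'.+1 => exists2 f', forall x, D x -> is_derive x (1 : R) f (f' x) &
               smooth_on m' D f'
  end.

Lemma class_C_comp m (D : set R) (f : R -> R) (u : H -> R) :
  smooth_on m D f -> class_C m u -> (forall z, D (u z)) -> class_C m (fun z => f (u z)).
Proof.
elim: m f => [|m IH] f.
  by move=> cf cu Du z; apply: continuous_comp; [exact: cu|exact: cf].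
move=> [f' df cf'] hu Du; have hu' := class_CS hu; case: hu => [du cu].
have dfd z : differentiable f (u z).
  by apply/derivable1_diffP; have := df _ (Du z); move=> /@ex_derive.
split=> [z|v]; first exact: differentiable_comp.
have -> : 'D_v (fun z => f (u z)) = fun z => f' (u z) * 'D_v u z.
  apply/funext => z.
  rewrite (deriveE _ (differentiable_comp (du z) (dfd z))) diff_comp//=.
  rewrite -(deriveE _ (du z)).
  have -> : 'd f (u z) ('D_v u z) = 'D_v u z *: 'd f (u z) 1.
    by rewrite -linearZ /= /GRing.scale/= mulr1.
  rewrite -deriveE// (@derive_val _ _ _ _ _ _ _ (df _ (Du z))).
  by rewrite mulrC.
by apply: class_CM; [exact: IH cf' hu' Du|exact: cu].
Qed.

Lemma smooth_comp (D : set R) (f : R -> R) (u : H -> R) :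
  (forall m, smooth_on m D f) -> smooth u -> (forall z, D (u z)) -> smooth (fun z => f (u z)).
Proof. by move=> hf hu Du m; apply: class_C_comp (hu m) Du. Qed.

Lemma smooth_onD m (D : set R) f g :
  smooth_on m D f -> smooth_on m D g -> smooth_on m D (fun x => f x + g x).
Proof.
elim: m f g => [|m IH] f g; first by move=> cf cg x Dx; apply: cvgD; [exact: cf|exact: cg].
move=> [f' df hf] [g' dg hg]; exists (fun x => f' x + g' x); last exact: IH.
by move=> x Dx; exact: is_deriveD (df x Dx) (dg x Dx).
Qed.

Lemma smooth_onZ m (D : set R) (b : R) f :
  smooth_on m D f -> smooth_on m D (fun x => b * f x).
Proof.
elim: m f => [|m IH] f.
  by move=> cf x Dx; apply: cvgM; [exact: cvg_cst|exact: cf].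
move=> [f' df hf]; exists (fun x => b * f' x); last exact: IH.
by move=> x Dx; apply: is_derive_eq (is_deriveZ b (df x Dx)) _.
Qed.

Lemma smooth_on_powR m (s : R) : smooth_on m [set x : R | 0 < x] (fun x => x `^ s).
Proof.
elim: m s => [|m IH] s.
  by move=> x x0; exact: is_derive_continuous (is_derive1_powR s x0).
exists (fun x => s * x `^ (s - 1)); first by move=> x x0; exact: is_derive1_powR.
exact: smooth_onZ.
Qed.

Lemma smooth_on_antiderivative (s : R) (F : R -> R) :
  (forall x : R, 0 < x -> is_derive x (1 : R) F (x `^ s)) ->
  forall m, smooth_on m [set x : R | 0 < x] F.
Proof.
move=> dF [|m]; first by move=> x x0; exact: is_derive_continuous (dF x x0).
by exists (fun x => x `^ s) => //; exact: smooth_on_powR.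
Qed.

End smooth_comp.

(** * A smooth cutoff of slope close to 1 *)

Section flat.
Context (R : realType) (d : R).
Hypothesis d0 : 0 < d.

(** Smooth functions that vanish to infinite order at 0; as a family indexed
    by s they are closed under differentiation up to linear combinations. *)
Definition flat (s x : R) : R := if 0 < x then x `^ s * expR (- (d / x)) else 0.

(** exp y is the t-th power of exp (y / t), which is at least y / t. *)
Lemma expR_ge_powR (t y : R) : 0 < t -> 0 < y -> (y / t) `^ t <= expR y.
Proof.
move=> t0 y0; have yt : 0 < y / t by rewrite divr_gt0.
have h : y / t <= expR (y / t) by rewrite (le_trans _ (expR_ge1Dx _))// lerDr.
rewrite -[leRHS](_ : expR (y / t) `^ t = _); last by rewrite -expRM divfK ?gt_eqF.
by apply: powR_le_mono; [exact: ltW|exact: ltW|].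
Qed.

Lemma flat_le (s : R) : exists2 C, 0 <= C & forall x, `|x| <= 1 -> `|flat s x| <= C * `|x| ^+ 2.
Proof.
pose t := `|s| + 2; have t0 : 0 < t by rewrite ltr_wpDl.
exists ((t / d) `^ t); first exact: powR_ge0.
move=> x; rewrite /flat; case: ifPn => [x0|_ _]; last first.
  by rewrite normr0 mulr_ge0 ?powR_ge0.
rewrite (gtr0_norm x0) ger0_norm ?mulr_ge0 ?powR_ge0 ?expR_ge0// => x1.
have dx : 0 < d / x by rewrite divr_gt0.
have h := expR_ge_powR t0 dx.
have e0 : expR (- (d / x)) <= (t / d) `^ t * x `^ t.
  rewrite expRN -(@powRM _ (t / d) x t (ltW (divr_gt0 t0 d0)) (ltW x0)).
  have -> : t / d * x = (d / x / t)^-1 by field; rewrite !gt_eqF.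
  have w0 : 0 < d / x / t by rewrite divr_gt0.
  rewrite -(powR_inv1 (ltW w0)) -powRrM mulN1r powRN.
  by rewrite lef_pV2 ?posrE ?expR_gt0 ?powR_gt0.
apply: (@le_trans _ _ (x `^ s * ((t / d) `^ t * x `^ t))).
  by rewrite ler_wpM2l ?powR_ge0.
rewrite mulrCA ler_wpM2l ?powR_ge0// -powRD ?(gt_eqF x0) ?implybT//.
rewrite -(powR_mulrn 2 (ltW x0)); apply: ger_powR; first by rewrite x0.
by have := ler_norm (- s); rewrite normrN /t; move: (`|s|) => w; lra.
Qed.

Lemma is_derive0_flat (f : R -> R) (C : R) : 0 <= C -> f 0 = 0 ->
  (forall x, `|x| <= 1 -> `|f x| <= C * `|x| ^+ 2) -> is_derive (0 : R) (1 : R) f 0.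
Proof.
move=> C0 f0 hf.
have h : h^-1 *: (f (h *: (1 : R) + 0) - f 0) @[h --> (0 : R)^'] --> (0 : R).
  apply/cvgr0Pnorm_le => /= e e0; near=> h.
  rewrite f0 subr0 addr0 /GRing.scale/= mulr1 normrM normfV.
  have hn : h != 0 by near: h; exact: nbhs_dnbhs_neq.
  have h1 : `|h| <= 1 by near: h; apply: dnbhs0_le.
  have h2 : `|h| <= e / (C + 1) by near: h; apply: dnbhs0_le; rewrite divr_gt0// ltr_wpDl.
  rewrite ler_pdivrMl ?normr_gt0//; apply: (le_trans (hf _ h1)).
  rewrite expr2 mulrA mulrC ler_wpM2l//.
  rewrite ler_pdivlMr ?ltr_wpDl// in h2; apply: le_trans h2.
  by rewrite mulrC mulrDr mulr1 lerDl.
have dv : derivable f 0 (1 : R) by apply/cvg_ex; exists 0.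
by apply: DeriveDef => //; exact: cvg_lim h.
Unshelve. all: by end_near.
Qed.

(** At 0 the quadratic bound flat_le forces the derivative to vanish. *)
Lemma is_derive_flat (s x : R) :
  is_derive x (1 : R) (flat s) (s * flat (s - 1) x + d * flat (s - 2) x).
Proof.
have [x0|x0|x0] := ltgtP x 0.
- have -> : s * flat (s - 1) x + d * flat (s - 2) x = 0.
    by rewrite /flat ltNge (ltW x0)/= !mulr0 addr0.
  have h : \forall y \near x, (fun=> 0 : R) y = flat s y.
    near=> y; rewrite /flat ltNge ltW//=.
    by near: y; exact: lt_nbhsl.
  exact: (near_eq_is_derive h).
- pose g (y : R) := y `^ s * expR (- (d / y)).
  have h : \forall y \near x, g y = flat s y.
    near=> y; rewrite /flat (_ : 0 < y)//.
    by near: y; exact: lt_nbhsr.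
  apply: (near_eq_is_derive h).
  have d1 := is_derive1_powR s x0.
  have xn : x != 0 by rewrite gt_eqF.
  have d2 := @is_derive1_comp _ (fun y => expR y) (fun y => - (d * y^-1)) x _ _
    (is_derive_expR _) (is_deriveN (is_deriveZ d (is_deriveV xn (is_derive_id x 1)))).
  apply: is_derive_eq (is_deriveM d1 d2) _.
  rewrite /flat x0 /GRing.scale/=.
  have e1 : x `^ (s - 2) = x `^ s * x ^- 2.
    by rewrite powRD ?xn ?implybT// powRN powR_mulrn ?ltW.
  by rewrite e1 mulr1; ring.
have [C C0 hC] := flat_le s.
rewrite x0.
have -> : s * flat (s - 1) 0 + d * flat (s - 2) 0 = 0.
  by rewrite /flat ltxx !mulr0 addr0.
by apply: (is_derive0_flat C0); first by rewrite /flat ltxx.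
Unshelve. all: by end_near.
Qed.

Lemma smooth_on_flat m (s : R) : smooth_on m setT (flat s).
Proof.
elim: m s => [|m IH] s.
  by move=> x _; exact: is_derive_continuous (is_derive_flat s x).
exists (fun x => s * flat (s - 1) x + d * flat (s - 2) x).
  by move=> x _; exact: is_derive_flat.
by apply: smooth_onD; apply: smooth_onZ.
Qed.

(** x exp (d - d / x) for x > 0: it vanishes for x <= 0, is 1 at x = 1, and
    its slope exp d (1 + d / x) exp (- d / x) is at most exp d. *)
Definition ramp (x : R) : R := expR d * flat 1 x.

Definition ramp' (x : R) : R := expR d * (flat 0 x + d * flat (- 1) x).

Lemma is_derive_ramp x : is_derive x (1 : R) ramp (ramp' x).
Proof.
apply: is_derive_eq (is_deriveZ (expR d) (is_derive_flat 1 x)) _.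
by rewrite /GRing.scale/= /ramp' subrr mul1r; congr (_ * (_ + _ * flat _ _)); ring.
Qed.

Lemma ramp_le0 x : x <= 0 -> ramp x = 0.
Proof. by move=> x0; rewrite /ramp /flat ltNge x0 mulr0. Qed.

Lemma ramp'_le0 x : x <= 0 -> ramp' x = 0.
Proof. by move=> x0; rewrite /ramp' /flat ltNge x0 /= !mulr0 addr0 mulr0. Qed.

Lemma ramp'_ge0 x : 0 <= ramp' x.
Proof.
rewrite /ramp' /flat mulr_ge0 ?expR_ge0//; case: ifP => x0; last by rewrite mulr0 addr0.
by rewrite addr_ge0// !mulr_ge0 ?powR_ge0 ?expR_ge0 ?ltW.
Qed.

Lemma ramp'_le x : ramp' x <= expR d.
Proof.
have [x0|x0] := leP x 0; first by rewrite ramp'_le0 ?expR_ge0.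
rewrite /ramp' ger_pMr ?expR_gt0// /flat x0 powRr0 mul1r.
rewrite (powR_inv1 (ltW x0)) mulrA -[X in X + _]mul1r -mulrDl expRN.
by rewrite ler_pdivrMr ?expR_gt0// mul1r expR_ge1Dx.
Qed.

Lemma ramp_ge1 x : 1 <= x -> 1 <= ramp x.
Proof.
move=> x1; have x0 : 0 < x by exact: lt_le_trans x1.
rewrite /ramp /flat x0 (powRr1 (ltW x0)) mulrCA -expRD.
rewrite (le_trans x1)// ler_pMr// -[leLHS]expR0 ler_expR subr_ge0.
by rewrite ler_pdivrMr// ler_peMr// ltW.
Qed.

Lemma ramp1 : ramp 1 = 1.
Proof. by rewrite /ramp /flat ltr01 powR1 mul1r divr1 expRN mulfV ?gt_eqF ?expR_gt0. Qed.

(** Applying the ramp from both ends gives a smooth function that is 0 for x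
    <= 0 and 1 for x >= 1, with slope at most exp (2d). *)
Definition cutoff (x : R) : R := 1 - ramp (1 - ramp x).

Definition cutoff' (x : R) : R := ramp' (1 - ramp x) * ramp' x.

Lemma is_derive_cutoff x : is_derive x (1 : R) cutoff (cutoff' x).
Proof.
have d1 : is_derive x (1 : R) (fun x => 1 - ramp x) (- ramp' x).
  by apply: is_derive_eq (is_deriveB (is_derive_cst (1 : R) x 1) (is_derive_ramp x)) _; rewrite sub0r.
have d2 := @is_derive1_comp _ ramp (fun x => 1 - ramp x) x _ _ (is_derive_ramp _) d1.
apply: is_derive_eq (is_deriveB (is_derive_cst (1 : R) x 1) d2) _.
by rewrite sub0r mulrN opprK.
Qed.

Lemma cutoff_le0 x : x <= 0 -> cutoff x = 0.
Proof. by move=> x0; rewrite /cutoff (ramp_le0 x0) subr0 ramp1 subrr. Qed.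

Lemma cutoff_ge1 x : 1 <= x -> cutoff x = 1.
Proof. by move=> x1; rewrite /cutoff (@ramp_le0 (1 - _)) ?subr0// subr_le0 ramp_ge1. Qed.

Lemma cutoff'_le x : `|cutoff' x| <= expR d ^+ 2.
Proof.
rewrite normrM !ger0_norm ?ramp'_ge0// expr2.
by rewrite ler_pM ?ramp'_ge0 ?ramp'_le.
Qed.

Lemma cutoff'_eq0 x : x <= 0 \/ 1 <= x -> cutoff' x = 0.
Proof.
rewrite /cutoff'; move=> [x0|x1]; first by rewrite (ramp'_le0 x0) mulr0.
by rewrite (@ramp'_le0 (1 - _)) ?mul0r// subr_le0 ramp_ge1.
Qed.

Lemma smooth_cutoff (n : nat) (u : 'H[R]_n -> R) : smooth u -> smooth (fun z => cutoff (u z)).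
Proof.
have hr (w : 'H[R]_n -> R) : smooth w -> smooth (fun z => 1 - ramp (w z)).
  move=> hw; have h := smooth_comp (fun m => smooth_on_flat m 1) hw (fun=> I).
  have := smoothD (smooth_cst n 1) (smoothM (smooth_cst n (- expR d)) h).
  by congr smooth; apply/funext => z; rewrite /ramp mulNr.
by move=> hu; exact: hr (hr _ hu).
Qed.

End flat.

(** * Regularized gauges *)

Lemma continuous_powR_ge0 (R : realType) (T : topologicalType) (w : T -> R) (s : R) :
  0 < s -> (forall z, 0 <= w z) -> continuous w -> continuous (fun z => w z `^ s).
Proof.
move=> s0 w0 cw z; have [wz|wz] := eqVneq (w z) 0; last first.
  have wp : 0 < w z by rewrite lt0r wz w0.
  apply: (@cvg_comp _ _ _ w (fun x : R => x `^ s) _ (nbhs (w z))); first exact: cw.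
  exact: is_derive_continuous (is_derive1_powR s wp).
rewrite /continuous_at wz powR0 ?gt_eqF//; apply/cvgr0Pnorm_le => /= e e0; near=> y.
rewrite ger0_norm ?powR_ge0//.
have h : w y <= e `^ s^-1.
  near: y; have := cw z; rewrite /continuous_at wz => /cvgr0Pnorm_le /(_ (e `^ s^-1)) h.
  have := h (powR_gt0 _ e0); apply: filterS => y; rewrite ger0_norm//.
have := powR_le_mono (ltW s0) (w0 y) h.
by rewrite -powRrM mulVf ?gt_eqF// powRr1// ltW.
Unshelve. all: by end_near.
Qed.

Lemma cvg_powR (R : realType) (T : topologicalType) (F : set_system T)
  {FF : Filter F} (w : T -> R) (s l : R) :
  0 < l -> w @ F --> l -> (fun z => w z `^ s) @ F --> l `^ s.
Proof.
move=> l0 cw; apply: (@cvg_comp _ _ _ w (fun x : R => x `^ s) _ (nbhs l)) => //.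
exact: is_derive_continuous (is_derive1_powR s l0).
Qed.

Lemma antiderivative_lt (R : realType) (s : R) (F : R -> R) :
  (forall x : R, 0 < x -> is_derive x (1 : R) F (x `^ s)) ->
  forall x y : R, 0 < x -> x < y -> F x < F y.
Proof.
move=> dF x y x0 xy.
have [||w wxy E] := @MVT R F (fun x => x `^ s) x y xy.
- by move=> w; rewrite in_itv/= => /andP[xw _]; apply: dF; exact: lt_trans xw.
- apply: derivable_within_continuous => w; rewrite in_itv/= => /andP[xw _].
  by have := dF w (lt_le_trans x0 xw) => /@ex_derive.
rewrite -subr_gt0 E mulr_gt0 ?subr_gt0// powR_gt0//.
by move: wxy; rewrite in_itv/= => /andP[xw _]; exact: lt_trans xw.
Qed.

Section approximation.
Context (R : realType) (n : nat) (x0 : 'H[R]_n) (c k : R).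
Hypotheses (c0 : c != 0) (k0 : 0 < k).
Local Notation H := ('H[R]_n).
Local Notation psi := (@gauge R n x0 c k).
Local Notation Sg := (@sumsq R n x0.1).
Local Notation tau := (@vtau R n x0).

Lemma smooth_offs l : smooth (fun z : H => offs x0 z l).
Proof.
have h : smooth (fun z : H => z.1 ord0 l).
  apply: (@smooth_affine _ _ _ (fun v => v.1 ord0 l)) => [z|v z].
    apply: (@differentiable_comp _ _ _ _ (fst : H -> 'rV[R]_(n + n)) (fun x : 'rV[R]_(n + n) => x ord0 l)).
      by apply: linear_differentiable => w; exact: cvg_fst.
    exact: differentiable_coord.
  by have [_ ->] := is_derive_coord1 z v l.
exact: smoothD h (smooth_cst n (- x0.1 ord0 l)).
Qed.

Lemma smooth_vtau : smooth (tau : H -> R).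
Proof.
have h : smooth (fun z : H => z.2).
  apply: (@smooth_affine _ _ _ (fun v => v.2)) => [z|v z].
    by apply: linear_differentiable => w; exact: cvg_snd.
  by have [_ ->] := is_derive_coord2 z v.
exact: smoothD h (smooth_cst n (- x0.2)).
Qed.

Lemma smooth_sumsq : smooth (Sg : H -> R).
Proof.
apply: smooth_sum => l; have h := smooth_offs l.
have := smoothM h h; congr smooth; apply/funext => z.
Qed.

(** Replacing S by S + e removes the singularities of the powers of S on the
    axis. *)
Definition reg_gauge4k (e : R) (z : H) : R :=
  c ^+ 2 * (Sg z + e) `^ (2 * k) + tau z ^+ 2.

Definition reg_gauge (e : R) (z : H) : R := reg_gauge4k e z `^ (4 * k)^-1.

Local Notation g := reg_gauge4k.
Local Notation psie := reg_gauge.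

Lemma reg_gauge0 z : psie 0 z = psi z.
Proof. by rewrite /psie /g addr0. Qed.

Let k4 : 0 < (4 * k)^-1. Proof. by rewrite invr_gt0 mulr_gt0. Qed.
Let k2 : 0 < 2 * k. Proof. by rewrite mulr_gt0. Qed.
Let c2 : 0 < c ^+ 2. Proof. by rewrite exprn_even_gt0. Qed.

Lemma reg_gauge4k_ge0 e z : 0 <= g e z.
Proof. by rewrite addr_ge0 ?sqr_ge0// mulr_ge0 ?powR_ge0// ltW. Qed.

Lemma reg_gauge4k_lt e e' z : 0 <= e -> e < e' -> g e z < g e' z.
Proof.
move=> e0 ee; rewrite ltrD2r ltr_pM2l// gt0_ltr_powR// ?nnegrE.
- by rewrite addr_ge0// sumsq_ge0.
- by rewrite addr_ge0// ?sumsq_ge0// (le_trans e0)// ltW.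
- by rewrite ltrD2l.
Qed.

Lemma reg_gauge4k_gt0 e z : 0 < e -> 0 < g e z.
Proof.
by move=> e0; apply: le_lt_trans (reg_gauge4k_lt z (lexx 0) e0); exact: reg_gauge4k_ge0.
Qed.

Lemma reg_gauge_gt0 e z : 0 < e -> 0 < psie e z.
Proof. by move=> e0; rewrite powR_gt0// reg_gauge4k_gt0. Qed.

Lemma reg_gauge_lt e e' z : 0 <= e -> e < e' -> psie e z < psie e' z.
Proof.
move=> e0 ee; rewrite gt0_ltr_powR// ?nnegrE ?reg_gauge4k_ge0//.
exact: reg_gauge4k_lt.
Qed.

Lemma reg_gauge4kE e z : psie e z `^ (4 * k) = g e z.
Proof.
by rewrite /psie -powRrM mulVf ?powRr1 ?reg_gauge4k_ge0// mulf_neq0// gt_eqF.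
Qed.

Lemma smooth_reg_gauge4k e : 0 < e -> smooth (g e).
Proof.
move=> e0; have h1 := smoothD smooth_sumsq (smooth_cst n e).
have h2 : smooth (fun z => (Sg z + e) `^ (2 * k)).
  apply: (smooth_comp (fun m => smooth_on_powR m (2 * k)) h1) => z /=.
  by rewrite ltr_wpDl// sumsq_ge0.
have := smoothD (smoothM (smooth_cst n (c ^+ 2)) h2) (smoothM smooth_vtau smooth_vtau).
by congr smooth; apply/funext => z; rewrite /g [tau z ^+ 2]expr2.
Qed.

Lemma smooth_reg_gauge e : 0 < e -> smooth (psie e).
Proof.
move=> e0.
apply: (smooth_comp (fun m => smooth_on_powR m (4 * k)^-1) (smooth_reg_gauge4k e0)) => z.
exact: reg_gauge4k_gt0.
Qed.

Lemma continuous_gauge : continuous (psi : H -> R).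
Proof.
apply: continuous_powR_ge0 => //; first by move=> z; exact: (gauge4k_ge0 x0 c k).
move=> z; apply: cvgD; last by apply: cvgM; exact: continuous_vtau.
apply: cvgM; first exact: cvg_cst.
apply: continuous_powR_ge0 => //; first by move=> w; exact: sumsq_ge0.
exact: (class_C_continuous (smooth_sumsq 0)).
Qed.

Lemma radial_comp u (F : R -> R) (A B dF : R) z :
  radial_derivative x0 u A B z -> is_derive (u z) (1 : R) F dF ->
  radial_derivative x0 (F \o u) (dF * A) (dF * B) z.
Proof.
move=> h hF v; apply: is_derive_eq (is_derive_comp1 (h v) hF) _.
by rewrite mulrDr !mulrA.
Qed.

Lemma radial_reg_gauge4k e z : 0 < e ->
  radial_derivative x0 (g e) (4 * k * c ^+ 2 * (Sg z + e) `^ (2 * k - 1)) (2 * tau z) z.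
Proof.
move=> e0 v; have h1 := is_derive_sumsq x0 z v; have h2 := is_derive_vtau x0 z v.
have h1' := is_deriveD h1 (is_derive_cst e z v).
have S0 : 0 < Sg z + e by rewrite ltr_wpDl// sumsq_ge0.
have h3 := is_derive_comp1 h1' (is_derive1_powR (2 * k) S0).
have h4 := is_derive_sqr h2; have h5 := is_deriveZ (c ^+ 2) h3.
apply: is_derive_eq (is_deriveD h5 h4) _.
by rewrite /GRing.scale/=; ring.
Qed.

(** The norm of the horizontal gradient of reg_gauge4k. *)
Definition reg_slope (e : R) (z : H) : R :=
  Num.sqrt (Sg z * ((4 * k * c ^+ 2 * (Sg z + e) `^ (2 * k - 1)) ^+ 2 +
    (2 * k * c * Sg z `^ (k - 1) * (2 * tau z)) ^+ 2)).

Lemma hgrad_norm_reg_comp e z (F : R -> R) (dF : R) : 0 < e ->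
  is_derive (psie e z) (1 : R) F dF ->
  hgrad_norm x0.1 c k (fun z => F (psie e z)) z =
  `|dF| * (psie e z `^ (1 - 4 * k) / (4 * k) * reg_slope e z).
Proof.
move=> e0 hF.
have h1 := radial_comp (radial_reg_gauge4k z e0) (is_derive1_powR (4 * k)^-1 (reg_gauge4k_gt0 z e0)).
have h2 := radial_comp h1 hF.
have -> := hgrad_norm_radial c k h2.
have p0 := reg_gauge_gt0 z e0.
have E : g e z `^ ((4 * k)^-1 - 1) = psie e z `^ (1 - 4 * k).
  rewrite -reg_gauge4kE -powRrM mulrBr mulr1 mulfV//.
  by rewrite mulf_neq0// gt_eqF.
rewrite E; set D := dF * _.
have -> : `|dF| * (psie e z `^ (1 - 4 * k) / (4 * k) * reg_slope e z) =
    Num.sqrt ((dF * ((4 * k)^-1 * psie e z `^ (1 - 4 * k))) ^+ 2) * reg_slope e z.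
  have w0 : 0 <= (4 * k)^-1 * psie e z `^ (1 - 4 * k) by rewrite mulr_ge0 ?powR_ge0// ltW.
  rewrite sqrtr_sqr normrM (ger0_norm w0); move: ((4 * k)^-1) => *; ring.
rewrite /reg_slope -sqrtrM ?sqr_ge0//; congr Num.sqrt.
rewrite /D; move: (Sg z `^ _) (_ `^ (2 * k - 1)) (_ `^ (1 - 4 * k)) ((4 * k)^-1) => *; ring.
Qed.

End approximation.

(** * The upper bound for the capacity *)

Section upper_bound.
Context (R : realType) (n : nat) (x0 : 'H[R]_n) (c k p : R).
Hypotheses (n0 : (0 < n)%N) (c0 : c != 0) (k0 : 0 < k) (p1 : 1 < p).
Local Notation muH := (@lebesgue_H R n).
Local Notation T := ('rV[R]_(n + n) * measurableTypeR R)%type.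
Local Notation psi := (@gauge R n x0 c k).
Local Notation Sg := (@sumsq R n x0.1).
Local Notation tau := (@vtau R n x0).
Local Notation ngr := (@ngrad R n x0 c k).
Local Notation Q := ((2 * n)%:R + 2 * k).
Local Notation g := (@reg_gauge4k R n x0 c k).
Local Notation psie := (@reg_gauge R n x0 c k).
Local Notation axisC := (@axisC R n x0).

Let k4 : 0 < 4 * k. Proof. by rewrite mulr_gt0. Qed.
Let k2 : 0 < 2 * k. Proof. by rewrite mulr_gt0. Qed.
Let c2 : 0 < c ^+ 2. Proof. by rewrite exprn_even_gt0. Qed.
Let p0 : 0 < p. Proof. exact: lt_trans p1. Qed.

Let one_powR (s : R) : (1 : R) `^ s = 1. Proof. by rewrite powR1. Qed.

(** If e <= th S, then S + e <= (1 + th) S; otherwise S + e <= (1 + 1 / th)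
    e. In the first case gauge^(4k) grows by the factor (1 + th)^(2k) at
    most, which fixes th; in the second case it grows by a small amount,
    which fixes the bound on e. *)
Lemma reg_gauge_close (r r1 : R) : 0 < r -> r < r1 ->
  exists2 e0, 0 < e0 & forall e z, 0 < e -> e <= e0 -> psi z <= r -> psie e z <= r1.
Proof.
move=> r0 rr1.
have rho : r `^ (4 * k) < r1 `^ (4 * k).
  by rewrite gt0_ltr_powR// nnegrE ltW// (lt_trans r0).
have rho0 : 0 < r `^ (4 * k) by exact: powR_gt0.
have [rh rhE] : exists rh, r `^ (4 * k) = rh by eexists.
have [rh1 rh1E] : exists rh1, r1 `^ (4 * k) = rh1 by eexists.
rewrite rhE rh1E in rho rho0.
pose mid := (rh + rh1) / 2.
have mid1 : rh < mid by rewrite /mid; lra.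
have mid2 : mid < rh1 by rewrite /mid; lra.
have mr : 1 < mid / rh by rewrite ltr_pdivlMr// mul1r.
pose th := (mid / rh) `^ (2 * k)^-1 - 1.
have th1 : 1 < 1 + th.
  rewrite /th addrC subrK -{1}(one_powR ((2 * k)^-1)) gt0_ltr_powR ?invr_gt0// ?nnegrE//.
  by rewrite ltW// (lt_trans _ mr).
have th0 : 0 < th by rewrite ltrDl in th1.
have thE : (1 + th) `^ (2 * k) * rh = mid.
  rewrite /th addrC subrK -powRrM mulVf ?gt_eqF// powRr1 ?divfK ?gt_eqF//.
  by rewrite ltW// (lt_trans _ mr).
have th2 : 1 <= (1 + th) `^ (2 * k).
  by rewrite -{1}(one_powR (2 * k)); apply: powR_le_mono => //; exact: ltW.
pose m0 := (rh1 - mid) / c ^+ 2.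
have m00 : 0 < m0 by rewrite divr_gt0// subr_gt0.
have ti : 0 < 1 + th^-1 by rewrite addr_gt0// invr_gt0.
exists (m0 `^ (2 * k)^-1 / (1 + th^-1)); first by rewrite divr_gt0// powR_gt0.
move=> e z e0 ee0 pr.
have S0 := sumsq_ge0 x0 z.
have gr : gauge4k x0 c k z <= rh.
  rewrite -(gauge4kE _ _ k0) -rhE; apply: powR_le_mono => //; [exact: ltW|exact: gauge_ge0].
apply: (@powR_le_inv _ (4 * k)) => //; [exact: powR_ge0|by rewrite ltW// (lt_trans r0)|].
rewrite rh1E (reg_gauge4kE x0 c0 k0) /reg_gauge4k.
rewrite /gauge4k in gr.
have Se : 0 <= Sg z + e by rewrite addr_ge0// ltW.
have [h|h] := leP e (th * Sg z).
  have h1 : (Sg z + e) `^ (2 * k) <= (1 + th) `^ (2 * k) * Sg z `^ (2 * k).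
    rewrite -powRM ?(ltW (lt_trans _ th1))//; apply: powR_le_mono => //; first exact: ltW.
    by rewrite mulrDl mul1r lerD2l.
  have h2 : c ^+ 2 * (Sg z + e) `^ (2 * k) <= (1 + th) `^ (2 * k) * (c ^+ 2 * Sg z `^ (2 * k)).
    by rewrite mulrCA ler_wpM2l// ltW.
  have h3 : tau z ^+ 2 <= (1 + th) `^ (2 * k) * tau z ^+ 2 by rewrite ler_peMl// sqr_ge0.
  apply: (le_trans (lerD h2 h3)); rewrite -mulrDr.
  apply: (@le_trans _ _ ((1 + th) `^ (2 * k) * rh)); last by rewrite thE ltW.
  by rewrite ler_wpM2l ?powR_ge0.
have h1 : Sg z + e <= m0 `^ (2 * k)^-1.
  apply: (@le_trans _ _ ((1 + th^-1) * e)).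
    rewrite mulrDl mul1r addrC lerD2l mulrC ler_pdivlMr// mulrC; exact: ltW.
  by rewrite mulrC -ler_pdivlMr.
have h2 : (Sg z + e) `^ (2 * k) <= m0.
  have := powR_le_mono (ltW k2) Se h1.
  by rewrite -powRrM mulVf ?gt_eqF// powRr1 ?(ltW m00).
have h3 : c ^+ 2 * (Sg z + e) `^ (2 * k) <= rh1 - mid.
  by rewrite mulrC -ler_pdivlMr.
have h4 : tau z ^+ 2 <= rh.
  by apply: le_trans gr; rewrite lerDr mulr_ge0 ?powR_ge0// ltW.
by move: h3 h4 mid1; move: (c ^+ 2 * _) => X; lra.
Qed.

Variables (r r1 r' al d : R) (Lam : R -> R).
Hypotheses (r0 : 0 < r) (rr1 : r < r1) (r1r' : r1 < r') (d0 : 0 < d).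
Hypothesis alE : al = (Q - p) / (1 - p).
Hypothesis dLam : forall x : R, 0 < x -> is_derive x (1 : R) Lam (x `^ (al - 1)).
Local Notation A := (@annulus R n x0 c k r r').
Local Notation L1 := (Lam r' - Lam r1).
Local Notation L := (Lam r' - Lam r).

Let r10 : 0 < r1. Proof. exact: lt_trans rr1. Qed.
Let r'0 : 0 < r'. Proof. exact: lt_trans r1r'. Qed.
Let L10 : 0 < L1. Proof. by rewrite subr_gt0; exact: (antiderivative_lt dLam). Qed.
Let Lam_le (x y : R) : 0 < x -> x <= y -> Lam x <= Lam y.
Proof.
by move=> x00; rewrite le_eqVlt => /orP[/eqP->//|/(antiderivative_lt dLam x00)/ltW].
Qed.
Let L0 : 0 < L. Proof. by rewrite subr_gt0; apply: (antiderivative_lt dLam) => //; exact: lt_trans r1r'. Qed.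

(** The minimizer for the radii r1 and r', regularized and cut off. Since r
    < r1, it is equal to 1 where psi <= r as soon as e is small. *)
Definition approx (e : R) (z : 'H[R]_n) : R := cutoff d ((Lam r' - Lam (psie e z)) / L1).

Lemma smooth_approx e : 0 < e -> smooth (approx e).
Proof.
move=> e0; apply: smooth_cutoff => //.
have h := smooth_comp (smooth_on_antiderivative dLam) (smooth_reg_gauge x0 c0 k0 e0)
  (fun z => reg_gauge_gt0 x0 c0 k0 z e0).
have := smoothM (smoothD (smooth_cst n (Lam r')) (smoothM (smooth_cst n (-1)) h)) (smooth_cst n L1^-1).
by congr smooth; apply/funext => z; rewrite mulN1r.
Qed.

Lemma approx_eq1 e z : 0 < e -> psie e z <= r1 -> approx e z = 1.
Proof.
move=> e0 h; apply: cutoff_ge1; first exact: d0.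
by rewrite ler_pdivlMr// mul1r lerD2l lerN2 Lam_le// reg_gauge_gt0.
Qed.

Lemma approx_eq0 e z : 0 < e -> r' <= psie e z -> approx e z = 0.
Proof.
move=> e0 h; apply: cutoff_le0; rewrite // pmulr_lle0 ?invr_gt0//.
by rewrite subr_le0 Lam_le.
Qed.

(** The support lies in the set where reg_gauge e <= r', and psi < reg_gauge
    e: this gives both the strict inclusion and the boundedness. *)
Lemma test_function_approx e : 0 < e -> test_function (gauge_ball x0 c k r') (approx e).
Proof.
move=> e0; have se := smooth_approx e0.
have cpsie : continuous (psie e) by exact: (class_C_continuous (smooth_reg_gauge x0 c0 k0 e0 0)).
have psile z : psie e z <= r' -> psi z < r'.
  by apply: lt_le_trans; rewrite -reg_gauge0; exact: reg_gauge_lt.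
have sup : supp (approx e) `<=` [set z | psie e z <= r'].
  rewrite /supp closureE => z; apply; split.
    apply: (@preimage_closed _ _ (psie e) [set x | x <= r']); last exact: closed_le.
    by move=> w _; exact: cpsie.
  move=> w /=; apply: contraNT; rewrite -ltNge => /ltW /(approx_eq0 e0) ->.
  by rewrite eqxx.
split; first exact: se.
  have [M hM] := gauge_le_boxH x0 c0 k0 r'.
  apply: (@subclosed_compact _ _ (boxH M)); [exact: closed_closure|exact: compact_boxH|].
  by move=> z /sup /psile /ltW /hM.
by move=> z /sup /psile.
Qed.

(** The norm of the horizontal gradient of Lam o reg_gauge e. *)
Definition flux (e : R) (z : T) : R :=
  psie e z `^ (al - 1) * (psie e z `^ (1 - 4 * k) / (4 * k) * reg_slope x0 c k e z).

Lemma flux_ge0 e z : 0 <= flux e z.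
Proof. by rewrite mulr_ge0 ?powR_ge0// mulr_ge0 ?sqrtr_ge0// divr_ge0 ?powR_ge0// ltW. Qed.

Lemma hgrad_norm_approx e z : 0 < e ->
  hgrad_norm x0.1 c k (approx e) z =
    `|cutoff' d ((Lam r' - Lam (psie e z)) / L1)| / L1 * flux e z.
Proof.
move=> e0; have pz := reg_gauge_gt0 x0 c0 k0 z e0.
pose F x := cutoff d ((Lam r' - Lam x) / L1).
have h1 : is_derive (psie e z) (1 : R) (fun x => (Lam r' - Lam x) * L1^-1) (- (psie e z `^ (al - 1)) / L1).
  have h := is_deriveZ L1^-1 (is_deriveB (is_derive_cst (Lam r') (psie e z) 1) (dLam pz)).
  have -> : (fun x => (Lam r' - Lam x) * L1^-1) = L1^-1 \*: (cst (Lam r') - Lam).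
    by apply/funext => x; rewrite mulrC.
  by apply: is_derive_eq h _; rewrite /GRing.scale/= sub0r mulrC.
have h2 := @is_derive1_comp _ (cutoff d) _ _ _ _ (is_derive_cutoff d0 _) h1.
rewrite (hgrad_norm_reg_comp c0 k0 e0 h2) /flux.
rewrite !normrM normfV normrN (gtr0_norm L10) (ger0_norm (powR_ge0 _ _)).
by rewrite !mulrA; congr (_ * _ * _ * _); rewrite mulrAC.
Qed.

Lemma flux0 z : 0 < Sg z -> flux 0 z = psi z `^ (al - 1) * ngr z.
Proof.
move=> S0; have pz := gauge_gt0 k c0 S0.
have N0 := ngrad_ge0 x0 c k z.
have sl : reg_slope x0 c k 0 z = 4 * k * psi z `^ (4 * k - 1) * ngr z.
  rewrite /reg_slope addr0 (hvec_gauge4k_sqr c0 k0 S0) sqrtr_sqr ger0_norm//.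
  by rewrite !mulr_ge0 ?powR_ge0// ltW.
rewrite /flux sl reg_gauge0; congr (_ * _).
have -> : psi z `^ (1 - 4 * k) = (psi z `^ (4 * k - 1))^-1 by rewrite -opprB powRN.
have P0 : psi z `^ (4 * k - 1) != 0 by rewrite gt_eqF// powR_gt0.
move: (psi z `^ _) (ngr z) P0 => P N P0; field.
by rewrite P0 gt_eqF.
Qed.

(** This is where the value of alpha enters: (al - 1) p = al - Q. *)
Lemma flux0_powR z : 0 < Sg z ->
  flux 0 z `^ p = psi z `^ (- Q) * ngr z `^ p * psi z `^ al.
Proof.
move=> S0; have pz := gauge_gt0 k c0 S0.
rewrite (flux0 S0) (@powRM _ (psi z `^ (al - 1)) _ p (powR_ge0 _ _) (ngrad_ge0 x0 c k z)) -(powRrM (psi z)).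
rewrite [RHS]mulrAC -(@powRD _ (psi z) (- Q) al) ?(gt_eqF pz) ?implybT//; congr (_ `^ _ * _).
have p1n : 1 - p != 0 by rewrite subr_eq0 lt_eqF.
by rewrite alE; generalize Q => Q0; field.
Qed.

Local Notation D := (A `&` axisC).

Let measurable_D : measurable (D : set T).
Proof.
by apply: measurableI; [exact: measurable_annulus|exact: measurable_axisC].
Qed.

Lemma integral_flux0 :
  (\int[muH]_(z in D) (flux 0 z `^ p)%:E = (Q * L)%:E * sigma x0 c k p)%E.
Proof.
pose W z := ngr z `^ p * \1_axisC z.
have maxisC : measurable (axisC : set T) by exact: measurable_axisC.
have mW : measurable_fun setT W.
  apply: measurable_funM; last exact: measurable_indic.
  exact: (measurableT_comp (measurable_powR p) (measurable_ngrad x0 c k)).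
have W0 z : 0 <= W z by rewrite mulr_ge0 ?powR_ge0// indicE ler0n.
have Wn z : W z != 0 -> 0 < Sg z.
  rewrite /W indicE; case: (boolP (z \in axisC)) => [/set_mem//|_].
  by rewrite mulr0 eqxx.
have Wd l z : 0 < l -> W (dil x0 k l z) = W z.
  move=> l0; rewrite /W (ngrad_dil _ _ k0 _ l0) !indicE; congr (_ * (nat_of_bool _)%:R).
  by apply: eq_mem_set; rewrite /axisC/= sumsq_dil pmulr_rgt0 ?exprn_gt0.
have Wz z : psi z = 0 -> W z = 0.
  move=> pz; apply/eqP/negPn/negP => /Wn S0.
  by have := gauge_gt0 k c0 S0; rewrite pz ltxx.
have mf := measurable_gauge_powR x0 c k al.
have mfA : measurable_fun setT (fun z : T => psi z `^ al * \1_A z).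
  by apply: measurable_funM => //; apply: measurable_indic; exact: measurable_annulus.
have f0 z : 0 <= psi z `^ al * \1_A z by rewrite mulr_ge0 ?powR_ge0// indicE ler0n.
rewrite (sigma_ngrad x0 p n0 c0 k0).
have rr' : r < r' by exact: lt_trans r1r'.
rewrite -(@polar_const _ _ x0 c k k0 W _ L mW mfA W0 f0 Wd Wz (ltW L0)); last first.
  move=> z /Wn S0; have pz := gauge_gt0 k c0 S0.
  by rewrite (@ray_integral _ _ x0 c k k0 r r' (fun z => psi z `^ al) z r0 rr' pz mf) (ray_gauge k0 r0 rr' pz dLam).
rewrite integral_mkcond; apply: eq_integral => z _.
rewrite patchE /W !indicE in_setI.
case: (boolP (z \in A)) => zA/=; last by rewrite !mulr0.
case: (boolP (z \in axisC)) => zp; last by rewrite !(mulr0, mul0r).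
by rewrite !mulr1 flux0_powR//; exact: set_mem zp.
Qed.

Lemma powR_between (a b x s : R) : 0 < a -> a <= x <= b -> x `^ s <= a `^ s + b `^ s.
Proof.
move=> a0 /andP[ax xb]; have x00 : 0 < x by exact: lt_le_trans ax.
have [s0|s0] := leP 0 s.
  by rewrite ler_wpDl ?powR_ge0//; apply: powR_le_mono => //; exact: ltW.
rewrite ler_wpDr ?powR_ge0// -[s]opprK !(powRN _ (- s)) lef_pV2 ?posrE ?powR_gt0//.
by apply: powR_le_mono; rewrite // ?oppr_ge0 ltW.
Qed.

(** When k <= 1/2 the exponent 2k - 1 is nonpositive, so that replacing S by
    S + e decreases the slope, and reg_slope 0 is a multiple of ngrad. When
    k > 1/2 all the powers of S and S + e that occur are bounded on the
    annulus. *)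
Lemma slope_bound : exists2 C, 0 <= C & forall e z, 0 <= e <= 1 -> A z -> 0 < Sg z ->
  reg_slope x0 c k e z <= C * (1 + ngr z).
Proof.
pose Sm := (r' `^ (2 * k) / `|c|) `^ k^-1; pose tm := r' `^ (2 * k).
have Sm0 : 0 <= Sm by exact: powR_ge0.
have tm0 : 0 <= tm by exact: powR_ge0.
pose P1 := 4 * k * c ^+ 2 * (Sm + 1) `^ (2 * k - 1).
pose W1 := Sm `^ (2 * k - 1) * (4 * k * c) ^+ 2 * tm ^+ 2.
have W10 : 0 <= W1.
  by apply: mulr_ge0; [apply: mulr_ge0; [exact: powR_ge0|exact: sqr_ge0]|exact: sqr_ge0].
pose C1 := Num.sqrt (Sm * P1 ^+ 2 + W1).
pose C2 := 4 * k * (r `^ (4 * k - 1) + r' `^ (4 * k - 1)).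
have C20 : 0 <= C2 by rewrite mulr_ge0 ?addr_ge0 ?powR_ge0// ltW.
have kc : 0 <= 4 * k * c ^+ 2 by exact: mulr_ge0 (ltW k4) (ltW c2).
have P0 w e : 0 <= 4 * k * c ^+ 2 * w `^ e by apply: mulr_ge0 => //; exact: powR_ge0.
have C10 : 0 <= C1 by exact: sqrtr_ge0.
exists (C1 + C2); first by rewrite addr_ge0.
move=> e z /andP[e0 e1] /andP[rp pr] S0.
have N0 := ngrad_ge0 x0 c k z.
have SS := sumsq_le_gauge c0 k0 (ltW pr); have tt := vtau_le_gauge k0 (ltW pr).
have pz : 0 < psi z by exact: lt_le_trans rp.
have [kh|kh] := leP k 2^-1.
  apply: (@le_trans _ _ (C2 * ngr z)); last first.
    have -> : (C1 + C2) * (1 + ngr z) = (C1 + C2 + C1 * ngr z) + C2 * ngr z by ring.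
    by rewrite ler_wpDl//; apply: addr_ge0; [exact: addr_ge0|exact: mulr_ge0].
  apply: (@le_trans _ _ (reg_slope x0 c k 0 z)).
    rewrite /reg_slope ler_sqrt; last by rewrite mulr_ge0 ?addr_ge0 ?sqr_ge0 ?ltW.
    rewrite ler_wpM2l ?(ltW S0)// lerD2r ler_pXn2r// ?nnegrE ?P0//.
    rewrite ler_wpM2l//.
    have kn : 2 * k - 1 <= 0 by lra.
    rewrite -[2 * k - 1]opprK !(powRN _ (- (2 * k - 1))) lef_pV2 ?posrE ?powR_gt0 ?addr0//; last by rewrite ltr_wpDr.
    by apply: powR_le_mono; rewrite ?oppr_ge0// ?lerDl// ltW.
  have -> : reg_slope x0 c k 0 z = 4 * k * psi z `^ (4 * k - 1) * ngr z.
    rewrite /reg_slope addr0 (hvec_gauge4k_sqr c0 k0 S0) sqrtr_sqr ger0_norm//.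
    by rewrite !mulr_ge0 ?powR_ge0// ltW.
  apply: ler_wpM2r => //; apply: ler_wpM2l; first exact: ltW.
  by apply: powR_between => //; rewrite rp ltW.
apply: (@le_trans _ _ C1); last first.
  have -> : (C1 + C2) * (1 + ngr z) = C1 + (C2 + (C1 + C2) * ngr z) by ring.
  by rewrite ler_wpDr//; apply: addr_ge0 => //; apply: mulr_ge0 => //; exact: addr_ge0.
rewrite /reg_slope /C1 ler_sqrt; last by rewrite addr_ge0// mulr_ge0// sqr_ge0.
rewrite mulrDr; apply: lerD.
  apply: ler_pM; rewrite ?sqr_ge0 ?(ltW S0)//.
  rewrite ler_pXn2r// ?nnegrE ?P0// ler_wpM2l//.
  apply: powR_le_mono; [lra|by rewrite addr_ge0// ltW|exact: lerD].
have -> : Sg z * (2 * k * c * Sg z `^ (k - 1) * (2 * tau z)) ^+ 2 =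
    Sg z `^ (2 * k - 1) * (4 * k * c) ^+ 2 * (`|tau z|) ^+ 2.
  rewrite real_normK ?num_real//.
  have -> : 2 * k - 1 = 1 + ((k - 1) + (k - 1)) by ring.
  rewrite !(sumsq_powRD _ _ S0) powRr1 ?ltW//.
  by move: (Sg z `^ _) => *; ring.
apply: ler_pM; [|exact: sqr_ge0| |by rewrite ler_pXn2r// ?nnegrE].
  by apply: mulr_ge0; [exact: powR_ge0|exact: sqr_ge0].
rewrite ler_wpM2r ?sqr_ge0//; apply: powR_le_mono => //; [lra|exact: ltW].
Qed.

(** Makes 1 + (flux 0)^p, up to a constant, a dominating function for the
    passage to the limit e = 0. *)
Lemma flux_bound : exists2 C, 0 <= C & forall e z, 0 <= e <= 1 -> A z -> 0 < Sg z ->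
  flux e z <= C * (1 + flux 0 z).
Proof.
have [C C0 hC] := slope_bound.
pose Sm := (r' `^ (2 * k) / `|c|) `^ k^-1; pose tm := r' `^ (2 * k).
have Sm0 : 0 <= Sm by exact: powR_ge0.
pose R2 := (c ^+ 2 * (Sm + 1) `^ (2 * k) + tm ^+ 2) `^ (4 * k)^-1.
pose K (s : R) := r `^ s + R2 `^ s; pose K' := r `^ (1 - al) + r' `^ (1 - al).
have K0 s : 0 <= K s by rewrite addr_ge0 ?powR_ge0.
have K'0 : 0 <= K' by rewrite addr_ge0 ?powR_ge0.
exists (K (al - 1) * (K (1 - 4 * k) / (4 * k)) * C * (1 + K')).
  apply: mulr_ge0; last exact: addr_ge0.
  by apply: mulr_ge0 => //; apply: mulr_ge0 => //; apply: mulr_ge0 => //; rewrite invr_ge0 ltW.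
move=> e z e01 Az S0; have /andP[e0 e1] := e01; have /andP[rp pr] := Az.
have SS := sumsq_le_gauge c0 k0 (ltW pr); have tt := vtau_le_gauge k0 (ltW pr).
have pz : 0 < psi z by exact: lt_le_trans rp.
have hb : r <= psie e z <= R2.
  apply/andP; split.
    apply: (le_trans rp); rewrite -(reg_gauge0 x0 c k z).
    have [->|en] := eqVneq e 0; first exact: lexx.
    by apply: ltW; apply: reg_gauge_lt; rewrite ?lexx// lt0r en.
  apply: powR_le_mono; [by rewrite invr_ge0 ltW|exact: reg_gauge4k_ge0|].
  apply: lerD.
    apply: ler_wpM2l; first exact: ltW.
    by apply: powR_le_mono; [exact: ltW|rewrite addr_ge0// sumsq_ge0|exact: lerD].
  by rewrite -(real_normK (num_real (tau z))) ler_pXn2r// nnegrE powR_ge0.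
have N0 := ngrad_ge0 x0 c k z.
have Nf : ngr z <= K' * flux 0 z.
  have E : psi z `^ (1 - al) * psi z `^ (al - 1) = 1.
    rewrite -powRD ?(gt_eqF pz) ?implybT//.
    have -> : 1 - al + (al - 1) = 0 by ring.
    by rewrite powRr0.
  rewrite (flux0 S0) mulrA; apply: (@le_trans _ _ (psi z `^ (1 - al) * psi z `^ (al - 1) * ngr z)).
    by rewrite E mul1r.
  apply: ler_wpM2r => //; apply: ler_wpM2r; first exact: powR_ge0.
  by apply: powR_between => //; rewrite rp ltW.
have f0 := flux_ge0 0 z.
have Zb : reg_slope x0 c k e z <= C * ((1 + K') * (1 + flux 0 z)).
  apply: (le_trans (hC e z e01 Az S0)); apply: ler_wpM2l => //.
  apply: (@le_trans _ _ (1 + K' * flux 0 z)); first by rewrite lerD2l.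
  have -> : (1 + K') * (1 + flux 0 z) = (1 + K' * flux 0 z) + (K' + flux 0 z) by ring.
  by rewrite lerDl addr_ge0.
have sl0 : 0 <= reg_slope x0 c k e z by exact: sqrtr_ge0.
have k40 : 0 <= (4 * k)^-1 by rewrite invr_ge0 ltW.
apply: (@le_trans _ _ (K (al - 1) * (K (1 - 4 * k) / (4 * k) * (C * ((1 + K') * (1 + flux 0 z)))))).
  apply: ler_pM; [exact: powR_ge0|apply: mulr_ge0 => //; apply: mulr_ge0 => //; exact: powR_ge0| |].
    exact: powR_between hb.
  apply: ler_pM => //; first by apply: mulr_ge0 => //; exact: powR_ge0.
  by apply: ler_wpM2r; [exact: k40|exact: powR_between hb].
by rewrite !mulrA.
Qed.

Lemma measurable_flux e : measurable_fun setT (flux e).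
Proof.
have mS := measurable_sumsq x0; have mt := measurable_vtau x0.
have mSe s : measurable_fun setT (fun z : T => (Sg z + e) `^ s).
  by apply: (measurableT_comp (measurable_powR s)); apply: measurable_funD.
have mg : measurable_fun setT (g e : T -> R).
  by apply: measurable_funD; [apply: measurable_funM|apply: measurable_funX].
have mp s : measurable_fun setT (fun z : T => psie e z `^ s).
  apply: (measurableT_comp (measurable_powR s)).
  exact: (measurableT_comp (measurable_powR _) mg).
apply: measurable_funM => //; apply: measurable_funM; first by apply: measurable_funM.
apply: (@measurableT_comp _ _ _ _ _ _ (@Num.sqrt R)).
  by apply: continuous_measurable_fun; exact: sqrt_continuous.
apply: measurable_funM => //; apply: measurable_funD; apply: measurable_funX.
  by apply: measurable_funM.
apply: measurable_funM; last by apply: measurable_funM.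
apply: measurable_funM => //; exact: (measurableT_comp (measurable_powR _) mS).
Qed.

Lemma cvg_flux (e : nat -> R) z : 0 < Sg z -> e @ \oo --> 0 ->
  (fun j => flux (e j) z) @ \oo --> flux 0 z.
Proof.
move=> S0 ce.
have cS s : (fun j => (Sg z + e j) `^ s) @ \oo --> (Sg z + 0) `^ s.
  apply: cvg_powR; first by rewrite addr0.
  by apply: cvgD => //; exact: cvg_cst.
have cg : (fun j => g (e j) z) @ \oo --> g 0 z.
  by apply: cvgD; [apply: cvgM => //; exact: cvg_cst|exact: cvg_cst].
have g0 : 0 < g 0 z.
  rewrite /reg_gauge4k addr0; apply: ltr_pwDl; last exact: sqr_ge0.
  by rewrite mulr_gt0// powR_gt0.
have cp : (fun j => psie (e j) z) @ \oo --> psie 0 z by exact: cvg_powR.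
have cps s : (fun j => psie (e j) z `^ s) @ \oo --> psie 0 z `^ s.
  by apply: cvg_powR => //; exact: powR_gt0.
apply: cvgM => //; apply: cvgM; first by apply: cvgM => //; exact: cvg_cst.
apply: (@cvg_comp _ _ _ _ (@Num.sqrt R)); last exact: sqrt_continuous.
apply: cvgM; first exact: cvg_cst.
apply: cvgD; last exact: cvg_cst.
by rewrite expr2; apply: cvgM; (apply: cvgM; [exact: cvg_cst|exact: cS]).
Qed.

Hypothesis sigma_fin : (sigma x0 c k p < +oo)%E.

Lemma cvg_integral_flux (e : nat -> R) : (forall j, 0 < e j <= 1) -> e @ \oo --> 0 ->
  (fun j => \int[muH]_(z in D) (flux (e j) z `^ p)%:E)%E @ \oo -->
  ((Q * L)%:E * sigma x0 c k p)%E.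
Proof.
move=> e01 ce; rewrite -integral_flux0.
have [C C0 hC] := flux_bound.
have mfl e' : measurable_fun D (fun z => (flux e' z `^ p)%:E).
  apply/measurable_EFinP; apply: measurable_funTS.
  exact: (measurableT_comp (measurable_powR p) (measurable_flux e')).
pose K := (C * 2) `^ p.
pose gg z := (K * (1 + flux 0 z `^ p))%:E.
have ig : muH.-integrable D gg.
  rewrite /gg; under eq_fun do rewrite EFinM.
  apply: integrableZl => //; under eq_fun do rewrite EFinD.
  apply: integrableD => //.
    apply/integrableP; split; first exact: measurable_cst.
    rewrite integral_cst//= normr1 mul1e.
    apply: le_lt_trans (annulus_lty x0 c0 k0 r r'); apply: le_measure; rewrite ?inE//.
      exact: measurable_annulus.
  apply/integrableP; split; first exact: mfl.
  have -> : (\int[muH]_(z in D) `|(flux 0 z `^ p)%:E| = \int[muH]_(z in D) (flux 0 z `^ p)%:E)%E.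
    by apply: eq_integral => z _; rewrite abse_EFin (ger0_norm (powR_ge0 _ _)).
  rewrite integral_flux0 lte_mul_pinfty// lee_fin.
  by rewrite mulr_ge0 ?(ltW L0)// ltW// Q_gt0.
have [] := @dominated_convergence _ _ _ muH D measurable_D
  (fun j z => (flux (e j) z `^ p)%:E) (fun z => (flux 0 z `^ p)%:E) gg _ _ _ ig _ => //.
- apply: aeW => z [_ zp]; have S0 : 0 < Sg z := zp; apply: cvg_EFin; first by apply: nearW.
  have pz := gauge_gt0 k c0 S0.
  apply: cvg_powR; last exact: cvg_flux.
  by rewrite (flux0 S0); apply: mulr_gt0; [exact: powR_gt0|exact: (ngrad_gt0 k c0 S0)].
- apply: aeW => z j [Az S0]; have /andP[ej0 ej1] := e01 j.
  rewrite abse_EFin lee_fin (ger0_norm (powR_ge0 _ _)).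
  have h : flux (e j) z <= C * (1 + flux 0 z) by apply: hC; rewrite ?(ltW ej0).
  have f0 := flux_ge0 0 z; have fj := flux_ge0 (e j) z.
  apply: (le_trans (powR_le_mono (ltW p0) fj h)).
  have h2 : C * (1 + flux 0 z) <= C * 2 * Num.max 1 (flux 0 z).
    rewrite -mulrA ler_wpM2l// mulr_natl mulr2n lerD// le_max lexx ?orbT//.
  apply: (le_trans (powR_le_mono (ltW p0) _ h2)); first by rewrite mulr_ge0// addr_ge0.
  rewrite powRM ?mulr_ge0// ?le_max ?ler01// ler_wpM2l ?powR_ge0//.
  have [_|_] := leP 1 (flux 0 z); first by rewrite lerDr.
  by rewrite powR1 lerDl powR_ge0.
Qed.

(** The cutoff is constant where psi < r, so only the annulus contributes. *)
Lemma henergy_approx_le e : 0 < e -> (forall z, psi z <= r -> psie e z <= r1) ->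
  (henergy x0.1 c k p (gauge_ball x0 c k r') (approx e) <=
   ((expR d ^+ 2 / L1) `^ p)%:E * \int[muH]_(z in D) (flux e z `^ p)%:E)%E.
Proof.
move=> e0 he; set E := expR d ^+ 2 / L1.
have E0 : 0 <= E by rewrite divr_ge0 ?sqr_ge0// ltW.
have [mA A0] := axis_negligible x0 n0.
have mfl : measurable_fun D (fun z => (flux e z `^ p)%:E).
  apply/measurable_EFinP; apply: measurable_funTS.
  exact: (measurableT_comp (measurable_powR p) (measurable_flux e)).
have Ep : (0 <= (E `^ p)%:E)%E by rewrite lee_fin powR_ge0.
rewrite -(ge0_integralZl muH measurable_D mfl _ Ep); last by move=> z _; rewrite lee_fin powR_ge0.
rewrite /henergy (ge0_integral_setD_null _ mA A0); last by move=> z; rewrite lee_fin powR_ge0.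
rewrite integral_mkcond [leRHS]integral_mkcond; apply: ge0_integral_mono => z.
  by apply: erestrict_ge0 => w _; rewrite lee_fin powR_ge0.
rewrite gauge_ball_axisC !patchE.
case: ifPn => [/set_mem[zB zp]|_]; last first.
  by case: ifP => // _; rewrite -EFinM lee_fin mulr_ge0 ?powR_ge0.
have f0 := flux_ge0 e z.
have [pr|pr] := leP r (psi z).
  rewrite mem_set; last by split=> //; rewrite /annulus/= pr.
  rewrite -EFinM lee_fin -powRM//; apply: powR_le_mono; [exact: ltW|exact: sqrtr_ge0|].
  rewrite (hgrad_norm_approx z e0) ler_wpM2r// ler_wpM2r ?invr_ge0 ?(ltW L10)//.
  by apply: cutoff'_le.
rewrite memNset; last by move=> [/andP[h _] _]; move: pr; rewrite ltNge h.
rewrite (hgrad_norm_approx z e0) cutoff'_eq0//; last first.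
  right; rewrite ler_pdivlMr// mul1r lerD2l lerN2 Lam_le ?reg_gauge_gt0//.
  by apply: he; exact: ltW.
by rewrite normr0 !mul0r powR0// gt_eqF.
Qed.

Lemma capacity_le_approx (K : set 'H[R]_n) : K `<=` [set z | psi z <= r] ->
  (capacity x0.1 c k p K (gauge_ball x0 c k r') <=
   ((expR d ^+ 2 / L1) `^ p)%:E * ((Q * L)%:E * sigma x0 c k p))%E.
Proof.
move=> Kr; have [e0 e00 he] := reg_gauge_close r0 rr1.
pose e1 := Num.min e0 1.
have e10 : 0 < e1 by rewrite lt_min e00 ltr01.
pose e (j : nat) : R := e1 * j.+1%:R^-1.
have ej j : 0 < e j <= e1.
  by rewrite mulr_gt0 ?invr_gt0 ?ltr0n//= ger_pMr// invf_le1 ?ltr0n// ler1n.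
have e01 j : 0 < e j <= 1.
  by have /andP[-> h] := ej j; rewrite (le_trans h)// ge_min lexx orbT.
have ce : e @ \oo --> 0.
  rewrite -(mulr0 e1); apply: cvgM; first exact: cvg_cst.
  exact: cvg_harmonic.
have h := cvg_integral_flux e01 ce.
have Efin : ((expR d ^+ 2 / L1) `^ p)%:E \is a fin_num by [].
have h2 := cvgeZl Efin h.
rewrite -(cvg_lim _ h2)//; apply: lime_ge; first by apply/cvg_ex; eexists; exact: h2.
apply: nearW => j; have /andP[ej0 eje] := ej j.
have eje0 : e j <= e0 by rewrite (le_trans eje)// ge_min lexx.
have hz z : psi z <= r -> psie (e j) z <= r1 by exact: he.
apply: le_trans (henergy_approx_le ej0 hz).
apply: ereal_inf_lbound; exists (approx (e j)) => //; split.
  exact: test_function_approx.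
by move=> z /Kr zr; apply: approx_eq1 => //; exact: hz.
Qed.

End upper_bound.

(** * Positivity and finiteness of sigma *)

Section sigma_bounds.
Context (R : realType) (n : nat) (x0 : 'H[R]_n) (c k p : R).
Hypotheses (n0 : (0 < n)%N) (c0 : c != 0) (k0 : 0 < k) (p1 : 1 < p).
Local Notation muH := (@lebesgue_H R n).
Local Notation T := ('rV[R]_(n + n) * measurableTypeR R)%type.
Local Notation psi := (@gauge R n x0 c k).
Local Notation Sg := (@sumsq R n x0.1).
Local Notation tau := (@vtau R n x0).
Local Notation ngr := (@ngrad R n x0 c k).
Local Notation axisC := (@axisC R n x0).
Local Notation B := (@gauge_ball R n x0 c k).

Let p0 : 0 < p. Proof. exact: lt_trans p1. Qed.

Lemma gauge_ball_dil0 l : 0 < l -> muH (B 1) = 0%E -> muH (B l) = 0%E.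
Proof.
move=> l0 B10.
have mB rho : measurable (B rho : set T) by exact: measurable_gauge_ball.
have iB rho : (\int[muH]_z (\1_(B rho) z : R)%:E = muH (B rho))%E.
  by rewrite (integral_indic muH measurableT (mB rho)) setIT.
rewrite -(iB l).
have mi rho : measurable_fun setT (fun z : T => (\1_(B rho) z)%:E : \bar R).
  by apply/measurable_EFinP; exact: measurable_indic.
have i0 z : (0 <= (\1_(B l) z : R)%:E)%E by rewrite lee_fin indicE ler0n.
rewrite (integral_dil x0 k l0 (mi l) i0).
have -> : (\int[muH]_z (\1_(B l) (dil x0 k l z))%:E = \int[muH]_z (\1_(B 1) z : R)%:E)%E.
  apply: eq_integral => z _; rewrite !indicE; congr (nat_of_bool _)%:R%:E.
  by apply: eq_mem_set; rewrite /gauge_ball/= (gauge_dil _ _ k0 _ l0) gtr_pMr.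
by rewrite (iB 1) B10 mule0.
Qed.

(** Otherwise all the dilates of the unit ball would be null, and they cover
    the space. *)
Lemma gauge_ball_gt0 : (0 < muH (B 1))%E.
Proof.
rewrite lt0e measure_ge0 andbT; apply/eqP => B10.
have mB rho : measurable (B rho : set T) by exact: measurable_gauge_ball.
have : muH.-negligible (\bigcup_m (B m.+1%:R : set T)).
  apply: negligible_bigcup => m; apply/negligibleP; first exact: mB.
  by apply: gauge_ball_dil0 => //; rewrite ltr0n.
have -> : \bigcup_m (B m.+1%:R : set T) = setT.
  apply/seteqP; split=> // z _; exists (Num.truncn (psi z)) => //.
  by rewrite /gauge_ball/=; exact: truncnS_gt.
move=> /negligibleP -/(_ measurableT) h.
by have := lebesgue_H_setT_gt0 R n; rewrite h ltxx.
Qed.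

(** ngrad is positive off the axis, so a vanishing integral would make the
    unit ball null. *)
Lemma sigma_gt0 : (0 < sigma x0 c k p)%E.
Proof.
have [mA A0] := axis_negligible x0 n0.
have mB : measurable (B 1 : set T) by exact: measurable_gauge_ball.
have s0 : (0 <= sigma x0 c k p)%E.
  by apply: integral_ge0 => z _; rewrite lee_fin powR_ge0.
rewrite lt0e s0 andbT; apply/eqP => sz.
pose W z := (ngr z `^ p * \1_axisC z)%:E.
have mW : measurable_fun (B 1) W.
  apply/measurable_EFinP; apply: measurable_funTS; apply: measurable_funM.
    exact: (measurableT_comp (measurable_powR p) (measurable_ngrad x0 c k)).
  by apply: measurable_indic; exact: measurable_axisC.
have := (ae_eq_integral_abs muH mB mW).1.
have -> : (\int[muH]_(z in B 1) `|W z| = 0)%E.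
  rewrite -sz (sigma_ngrad x0 p n0 c0 k0); apply: eq_integral => z _.
  by rewrite /W abse_EFin ger0_norm// mulr_ge0 ?powR_ge0// indicE ler0n.
move=> /(_ erefl) [N [mN N0 hN]].
have : (muH (B 1) <= muH (N `|` [set z : T | Sg z = 0%R]))%E.
  apply: le_measure; rewrite ?inE//; first exact: measurableU.
  move=> z zB; have [S0|S0] := ltP 0 (Sg z); last first.
    by right; apply/eqP; rewrite eq_le S0 sumsq_ge0.
  left; apply: hN => hW; have hz : (ngr z `^ p * \1_axisC z)%:E = 0%:E :> \bar R := hW zB.
  move: hz => [] /eqP; apply/negP.
  have zp : axisC z := S0.
  rewrite indicE (mem_set zp) mulr1 gt_eqF//; apply: powR_gt0.
  exact: (ngrad_gt0 k c0 S0).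
rewrite leNgt; apply/negP/negPn.
apply: le_lt_trans gauge_ball_gt0.
by rewrite measureU0// N0.
Qed.

Definition slab (e M : R) : set T := [set z | e < Sg z <= M /\ `|tau z| <= 1].

Lemma measurable_slab e M : measurable (slab e M).
Proof.
rewrite (_ : slab e M = (Sg @^-1` `]e, M]%classic) `&` (tau @^-1` `[(-1), 1]%classic)).
  apply: measurableI; rewrite -[X in measurable X]setTI.
    by apply: (measurable_sumsq x0 measurableT); exact: measurable_itv.
  by apply: (measurable_vtau x0 measurableT); exact: measurable_itv.
by rewrite /slab; apply/seteqP; split=> z /=; rewrite !in_itv/= ler_norml => -[].
Qed.

Let slab_lty e M : (muH (slab e M) < +oo)%E.
Proof.
have [M' hM] := gauge_le_boxH x0 c0 k0 ((c ^+ 2 * `|M| `^ (2 * k) + 1) `^ (4 * k)^-1).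
apply: le_lt_trans (boxH_lty n M'); apply: le_measure; rewrite ?inE.
- exact: measurable_slab.
- exact: measurable_boxH.
move=> z [/andP[_ zM] zt]; apply: hM; apply: powR_le_mono.
- by rewrite invr_ge0 mulr_ge0// ltW.
- exact: (gauge4k_ge0 x0 c k).
apply: lerD.
  rewrite ler_wpM2l ?sqr_ge0//; apply: powR_le_mono; rewrite ?sumsq_ge0//.
    by rewrite mulr_ge0// ltW.
  by rewrite (le_trans zM)// ler_norm.
by rewrite -(real_normK (num_real _)) -[leRHS](expr1n _ 2) ler_pXn2r// nnegrE.
Qed.

Variable b : R.
Hypotheses (b0 : 0 <= b) (bn : b < (2 * n)%:R).

Let f (z : T) : R := Sg z `^ (- (b / 2)).
Let I (e M : R) : \bar R := (\int[muH]_z (f z * \1_(slab e M) z)%:E)%E.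

Let mf : measurable_fun setT f.
Proof. exact: (measurableT_comp (measurable_powR _) (measurable_sumsq x0)). Qed.

Let mfi e M : measurable_fun setT (fun z => (f z * \1_(slab e M) z)%:E).
Proof.
apply/measurable_EFinP; apply: measurable_funM; first exact: mf.
by apply: measurable_indic; exact: measurable_slab.
Qed.

Let fi0 e M z : (0 <= (f z * \1_(slab e M) z)%:E)%E.
Proof. by rewrite lee_fin mulr_ge0 ?powR_ge0// indicE ler0n. Qed.

Let I_lty e M : 0 < e -> (I e M < +oo)%E.
Proof.
move=> e0; have ms := measurable_slab e M.
have K0 : (0 <= (e `^ (- (b / 2)))%:E)%E by rewrite lee_fin powR_ge0.
have mi : measurable_fun setT (fun z : T => (\1_(slab e M) z)%:E : \bar R).
  by apply/measurable_EFinP; exact: measurable_indic.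
apply: (@le_lt_trans _ _ (\int[muH]_z ((e `^ (- (b / 2)))%:E * (\1_(slab e M) z)%:E))%E).
  apply: ge0_integral_mono => z; first exact: fi0.
  rewrite -EFinM lee_fin indicE; case: (boolP (z \in slab e M)) => [/set_mem[/andP[h _] _]|_]; last by rewrite !mulr0.
  rewrite !mulr1 /f !powRN lef_pV2 ?posrE ?powR_gt0//; last exact: lt_trans h.
  by apply: powR_le_mono; [rewrite divr_ge0|exact: ltW|exact: ltW].
rewrite (ge0_integralZl muH measurableT mi _ K0); last by move=> z _; rewrite lee_fin indicE ler0n.
rewrite (integral_indic muH measurableT ms) setIT.
by rewrite lte_mul_pinfty// slab_lty.
Qed.

(** Halving the horizontal coordinates multiplies S^(- b / 2) by 2^b and the
    volume by 2^(- 2n). *)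
Let I_half e M : 0 < e -> (I e (M / 4) <= (2 `^ (b - (2 * n)%:R))%:E * I e M)%E.
Proof.
move=> e0; have h0 : 0 < 2^-1 :> R by rewrite invr_gt0.
rewrite {1}/I (@ge0_integral_affine_H R n 2^-1 1 (x0.1 - 2^-1 *: x0.1) 0 _ h0 ltr01 (mfi _ _) (fi0 _ _)).
rewrite mulr1; set h := affine_H _ _ _ _.
have hS z : Sg (h z) = Sg z / 4.
  rewrite /sumsq mulr_suml; apply: eq_bigr => l _; rewrite /h /affine_H/= !mxE.
  by field.
have ht z : tau (h z) = tau z by rewrite /h /affine_H /vtau/= mul1r addr0.
have -> : 2 `^ (b - (2 * n)%:R) = 2^-1 ^+ (n + n) * 2 `^ b :> R.
  by rewrite powRD ?pnatr_eq0 ?implybT// powRN powR_mulrn// mulrC exprVn mul2n addnn.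
rewrite EFinM -muleA; apply: lee_wpmul2l; first by rewrite lee_fin exprn_ge0// ltW.
have B0 : (0 <= (2 `^ b : R)%:E)%E by rewrite lee_fin powR_ge0.
rewrite /I -(ge0_integralZl muH measurableT (mfi e M) _ B0); last by move=> z _; exact: fi0.
apply: ge0_integral_mono => z; first exact: fi0.
rewrite -EFinM lee_fin !indicE.
case: (boolP (h z \in slab e (M / 4))) => [/set_mem[]|_]; last first.
  by rewrite mulr0 !mulr_ge0 ?powR_ge0// ler0n.
rewrite hS ht => /andP[h1 h2] h3.
have S0 : 0 < Sg z by have := lt_trans e0 h1; rewrite pmulr_lgt0.
rewrite mem_set; last first.
  split=> //; apply/andP; split; last by rewrite ler_pM2r in h2.
  apply: (lt_trans h1); rewrite ltr_pdivrMr// ltr_pMr//.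
  by rewrite (ltr_nat _ 1 4).
rewrite !mulr1 /f hS powRM ?invr_ge0// ?(ltW S0)// mulrC ler_wpM2r ?powR_ge0//.
rewrite -powR_inv1// -powRrM.
have -> : (4 : R) = 2 `^ 2 by rewrite powR_mulrn// -natrX.
rewrite -powRrM; have -> : 2 * (-1 * - (b / 2)) = b by field.
exact: lexx.
Qed.

Let kappa : R := 2 `^ (b - (2 * n)%:R).
Let kappa1 : kappa < 1.
Proof.
rewrite /kappa -opprB powRN invf_lt1 ?powR_gt0//.
have := @gt0_ltr_powR R ((2 * n)%:R - b) _ 1 2.
by rewrite subr_gt0 => /(_ bn); rewrite !nnegrE powR1; apply; rewrite ?ltr1n.
Qed.

(** Splitting at S = M / 4 gives I e M <= I (M / 4) M + kappa I e M with
    kappa < 1, and I e M is finite, so it can be solved for. *)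
Let I_bound e M : 0 < e -> e <= M / 4 -> 0 < M ->
  (I e M <= (fine (I (M / 4) M) / (1 - kappa))%:E)%E.
Proof.
move=> e0 eM M0.
have M4 : 0 < M / 4 by rewrite divr_gt0.
have M4M : M / 4 <= M by rewrite ler_pdivrMr// ler_pMr// (ler_nat _ 1 4).
have split_I : (I e M <= I (M / 4) M + I e (M / 4))%E.
  rewrite /I -(ge0_integralD muH measurableT _ (mfi _ _) _ (mfi _ _)); last 2 first.
  - by move=> z _; exact: fi0.
  - by move=> z _; exact: fi0.
  apply: ge0_integral_mono => z; first exact: fi0.
  rewrite -EFinD lee_fin -mulrDr ler_wpM2l ?powR_ge0// !indicE.
  case: (boolP (z \in slab e M)) => [/set_mem[/andP[h1 h2] h3]|_]; last by rewrite addr_ge0// ler0n.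
  have [h|h] := leP (Sg z) (M / 4).
    by rewrite (@mem_set _ (slab e (M / 4)))// ?lerDr ?ler0n//; split=> //; rewrite h1.
  by rewrite (@mem_set _ (slab (M / 4) M))// ?lerDl ?ler0n//; split=> //; rewrite h.
have fin1 := I_lty M e0; have fin2 := I_lty M M4.
have pos e' : (0 <= I e' M)%E by apply: integral_ge0 => z _; exact: fi0.
have := le_trans split_I (leeD2l _ (I_half M e0)).
rewrite -/kappa.
rewrite -(@fineK _ (I e M)) ?ge0_fin_numE// -{1}(@fineK _ (I (M / 4) M)) ?ge0_fin_numE//.
rewrite -EFinM -EFinD !lee_fin => h.
rewrite ler_pdivlMr ?subr_gt0// mulrBr mulr1 lerBlDr.
by rewrite (mulrC _ kappa).
Qed.

Lemma slab_integral_lty M : 0 < M -> (\int[muH]_z (Sg z `^ (- (b / 2)) * \1_(slab 0 M) z)%:E < +oo)%E.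
Proof.
rewrite -/f.
move=> M0; have M4 : 0 < M / 4 by rewrite divr_gt0.
pose e (j : nat) : R := (M / 4) * j.+1%:R^-1.
have e0 j : 0 < e j by rewrite mulr_gt0 ?invr_gt0 ?ltr0n.
have eM j : e j <= M / 4 by rewrite ger_pMr// invf_le1 ?ltr0n// ler1n.
have nd z : setT z -> nondecreasing_seq (fun j => (f z * \1_(slab (e j) M) z)%:E).
  move=> _ j j' jj; rewrite lee_fin ler_wpM2l ?powR_ge0// !indicE ler_nat.
  case: (boolP (z \in slab (e j) M)) => // /set_mem[/andP[h1 h2] h3].
  rewrite mem_set//; split=> //; rewrite h2 andbT; apply: le_lt_trans h1.
  by rewrite ler_pM2l// lef_pV2 ?posrE ?ltr0n// ler_nat.
have := @cvg_monotone_convergence _ _ _ muH _ measurableT _ (fun j => mfi (e j) M)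
  (fun j z _ => fi0 (e j) M z) nd.
have -> : (\int[muH]_z limn (fun j => (f z * \1_(slab (e j) M) z)%:E) =
           \int[muH]_z (f z * \1_(slab 0 M) z)%:E)%E.
  apply: eq_integral => z _; apply: lim_near_cst => //.
  have [zs|zs] := boolP (z \in slab 0 M); last first.
    apply: nearW => j; rewrite !indicE (negbTE zs) memNset//.
    move=> [/andP[h1 h2] h3]; move/negP: zs; apply; rewrite inE; split=> //.
    by rewrite h2 andbT (lt_trans _ h1).
  have [/andP[S0 SM] St] := set_mem zs.
  have ce : e @ \oo --> 0.
    by rewrite -(mulr0 (M / 4)); apply: cvgM; [exact: cvg_cst|exact: cvg_harmonic].
  near=> j; rewrite !indicE zs mem_set//; split=> //; rewrite SM andbT.
  by near: j; exact: (cvgr_lt _ ce).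
move=> h; rewrite -(cvg_lim _ h)//.
apply: (@le_lt_trans _ _ (fine (I (M / 4) M) / (1 - kappa))%:E); last exact: ltry.
apply: lime_le; first by apply/cvg_ex; eexists; exact: h.
by apply: nearW => j; exact: I_bound.
Unshelve. all: by end_near.
Qed.

End sigma_bounds.

Section sigma_finite.
Context (R : realType) (n : nat) (x0 : 'H[R]_n) (c k p : R).
Hypotheses (n0 : (0 < n)%N) (c0 : c != 0) (k0 : 0 < k) (p1 : 1 < p).
Local Notation muH := (@lebesgue_H R n).
Local Notation T := ('rV[R]_(n + n) * measurableTypeR R)%type.
Local Notation psi := (@gauge R n x0 c k).
Local Notation Sg := (@sumsq R n x0.1).
Local Notation ngr := (@ngrad R n x0 c k).
Local Notation axisC := (@axisC R n x0).
Local Notation B := (@gauge_ball R n x0 c k).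

Let p0 : 0 < p. Proof. exact: lt_trans p1. Qed.

(** |c| S^k <= psi^(2k), so the factor S^(k - 1/2) is at most a constant
    times psi^(2k - 1). *)
Lemma ngrad_bounded : 2^-1 <= k -> exists C, forall z, 0 < Sg z -> ngr z <= C.
Proof.
move=> kh; have cp : 0 < `|c| by rewrite normr_gt0.
exists (`|c| * (`|c|^-1) `^ ((k - 2^-1) / k)) => z S0.
have pz := gauge_gt0 k c0 S0.
rewrite /ngrad -mulrA ler_wpM2l//.
have e0 : 0 <= (k - 2^-1) / k by rewrite divr_ge0 ?subr_ge0// ltW.
have h : Sg z `^ k <= psi z `^ (2 * k) / `|c|.
  by rewrite ler_pdivlMr// mulrC; exact: gauge_sumsq_le.
have := powR_le_mono e0 (powR_ge0 _ _) h.
rewrite -powRrM (mulrC k) divfK ?gt_eqF// powRM ?powR_ge0 ?invr_ge0// -powRrM.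
have -> : 2 * k * ((k - 2^-1) / k) = 2 * k - 1 by field; rewrite gt_eqF.
move=> h'; apply: (@le_trans _ _ (psi z `^ (2 * k - 1) * `|c|^-1 `^ ((k - 2^-1) / k) * psi z `^ (1 - 2 * k))).
  by rewrite ler_wpM2r ?powR_ge0.
rewrite mulrAC -powRD ?(gt_eqF pz) ?implybT//.
have -> : 2 * k - 1 + (1 - 2 * k) = 0 by ring.
by rewrite powRr0 mul1r.
Qed.

(** For k < 1/2, ngrad <= |c| S^(k - 1/2) on the unit ball, which is
    contained in a slab around the axis. *)
Lemma sigma_lty : (1 - 2 * k) * p < (2 * n)%:R -> (sigma x0 c k p < +oo)%E.
Proof.
move=> bn; rewrite (sigma_ngrad x0 p n0 c0 k0).
have mB : measurable (B 1 : set T) by exact: measurable_gauge_ball.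
have muB : (muH (B 1) < +oo)%E.
  apply: le_lt_trans (gauge_le_lty x0 c0 k0 1); apply: le_measure; rewrite ?inE//.
    exact: measurable_gauge_le.
  by move=> z /ltW.
have [kh|kh] := leP 2^-1 k.
  have [C hC] := ngrad_bounded kh.
  apply: (@le_lt_trans _ _ (\int[muH]_(z in B 1) (`|C| `^ p)%:E)%E).
    rewrite integral_mkcond [leRHS]integral_mkcond; apply: ge0_integral_mono => z.
      by apply: erestrict_ge0 => w _; rewrite lee_fin mulr_ge0 ?powR_ge0// indicE ler0n.
    rewrite !patchE; case: ifPn => // _; rewrite lee_fin indicE.
    case: (boolP (z \in axisC)) => [/set_mem S0|_]; last by rewrite mulr0 powR_ge0.
    rewrite mulr1; apply: powR_le_mono; [exact: ltW|exact: ngrad_ge0|].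
    by rewrite (le_trans (hC z S0))// ler_norm.
  by rewrite integral_cst// lte_mul_pinfty ?lee_fin ?powR_ge0.
pose b := (1 - 2 * k) * p.
have b0 : 0 <= b.
  by rewrite mulr_ge0 ?(ltW p0)// subr_ge0 -ler_pdivlMl// mulr1 ltW.
pose M := (1 `^ (2 * k) / `|c|) `^ k^-1.
have M0 : 0 < M by rewrite powR_gt0// divr_gt0 ?powR_gt0// normr_gt0.
have := slab_integral_lty x0 c0 k0 b0 bn M0.
set F := (X in (\int[_]_z X z < _)%E) => hF.
have cp : (0 <= (`|c| `^ p)%:E)%E by rewrite lee_fin powR_ge0.
apply: (@le_lt_trans _ _ (\int[muH]_z ((`|c| `^ p)%:E * F z))%E).
  rewrite integral_mkcond; apply: ge0_integral_mono => z.
    by apply: erestrict_ge0 => w _; rewrite lee_fin mulr_ge0 ?powR_ge0// indicE ler0n.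
  rewrite patchE; case: ifPn => [/set_mem zB|_]; last first.
    by rewrite /F -EFinM lee_fin !mulr_ge0 ?powR_ge0// indicE ler0n.
  rewrite /F -EFinM lee_fin indicE.
  case: (boolP (z \in axisC)) => [/set_mem S0|_]; last first.
    by rewrite mulr0 !mulr_ge0 ?powR_ge0// indicE ler0n.
  have z1 : psi z <= 1 by exact: ltW.
  have le1 e : 0 <= e -> psi z `^ e <= 1.
    by move=> e0; have := powR_le_mono e0 (gauge_ge0 x0 c k z) z1; rewrite powR1.
  rewrite indicE mem_set; last first.
    split; first by apply/andP; split; [exact: S0|exact: (sumsq_le_gauge c0 k0 z1)].
    apply: le_trans (gauge_vtau_le x0 c k0 z) _.
    by apply: le1; rewrite mulr_ge0// ltW.
  rewrite !mulr1; have -> : - (b / 2) = (k - 2^-1) * p by rewrite /b; field.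
  rewrite powRrM -(@powRM _ `|c| _ p (normr_ge0 c) (powR_ge0 _ _)); apply: powR_le_mono; [exact: ltW|exact: ngrad_ge0|].
  rewrite /ngrad ler_piMr ?mulr_ge0 ?powR_ge0//.
  by apply: le1; rewrite subr_ge0 -ler_pdivlMl// mulr1 ltW.
rewrite ge0_integralZl//.
- by rewrite lte_mul_pinfty.
- apply/measurable_EFinP; apply: measurable_funM; last by apply: measurable_indic; exact: measurable_slab.
  exact: (measurableT_comp (measurable_powR _) (measurable_sumsq x0)).
- by move=> z _; rewrite lee_fin mulr_ge0 ?powR_ge0// indicE ler0n.
Qed.

End sigma_finite.

(** * The capacity *)

Section capacity_formula.
Context (R : realType) (n : nat) (x0 : 'H[R]_n) (c k p : R).
Hypotheses (n0 : (0 < n)%N) (c0 : c != 0) (k0 : 0 < k) (p1 : 1 < p).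
Local Notation psi := (@gauge R n x0 c k).
Local Notation Q := ((2 * n)%:R + 2 * k).
Local Notation B := (@gauge_ball R n x0 c k).

(** A point with psi = r is the limit of its images under the dilations of
    ratio l < 1. *)
Lemma closure_gauge_ball r : 0 < r -> closure (B r) = [set z | psi z <= r].
Proof.
move=> r0; apply/seteqP; split=> z.
  rewrite closureE; apply; split; last by move=> w /ltW.
  apply: (@preimage_closed _ _ psi [set x | x <= r]); last exact: closed_le.
  by move=> w _; apply: continuous_gauge.
move=> /= zr U nU.
have cd := @continuous_dil R n x0 k z 1 ltr01.
have dil1 : dil x0 k 1 z = z.
  by rewrite /dil scale1r powR1 mul1r !subrK; case: (z).
have hU : \forall l \near (1 : R)^'-, U (dil x0 k l z).
  apply: cvg_at_left_filter (cd) _ _.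
  by rewrite dil1.
near (1 : R)^'- => l.
have l1 : l < 1 by near: l; exact: nbhs_left_lt.
have l0 : 0 < l by near: l; exact: nbhs_left_gt.
exists (dil x0 k l z); split; last by near: l.
rewrite /gauge_ball/= (gauge_dil _ _ k0 _ l0).
have [->|zn] := eqVneq (psi z) 0; first by rewrite mulr0.
apply: lt_le_trans zr; rewrite gtr_pMl// lt0r zn; exact: gauge_ge0.
Unshelve. all: by end_near.
Qed.

Variables (r r' al : R) (Lam : R -> R).
Hypotheses (r0 : 0 < r) (rr : r < r') (alE : al = (Q - p) / (1 - p)).
Hypothesis dLam : forall x : R, 0 < x -> is_derive x (1 : R) Lam (x `^ (al - 1)).
Local Notation L := (Lam r' - Lam r).
Local Notation cap := (capacity x0.1 c k p (closure (B r)) (B r')).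

Let L0 : 0 < L. Proof. by rewrite subr_gt0; exact: (antiderivative_lt dLam). Qed.

Lemma capacity_ge : ((Q * L `^ (1 - p))%:E * sigma x0 c k p <= cap)%E.
Proof.
apply: le_ereal_inf_tmp => _ [u [[su _ suB] u1] <-].
apply: (energy_ge_sigma n0 c0 k0 p1 r0 rr alE dLam L0).
- exact: (su 1%N).1.
- exact: (su 1%N).2.
- by move=> z zr; apply: u1; rewrite closure_gauge_ball.
- move=> z zr; apply/eqP/negPn/negP => un.
  have : supp u z by apply: subset_closure.
  by move=> /suB; rewrite /gauge_ball/= ltNge zr.
Qed.

(** If sigma is infinite the right-hand side is infinite; otherwise let d
    tend to 0 and r1 tend to r in capacity_le_approx. *)
Lemma capacity_le : (cap <= (Q * L `^ (1 - p))%:E * sigma x0 c k p)%E.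
Proof.
have Q0 : 0 < Q by exact: Q_gt0.
have C0 : 0 < Q * L `^ (1 - p) by rewrite mulr_gt0// powR_gt0.
have s0 : (0 < sigma x0 c k p)%E by exact: sigma_gt0.
have [sy|sy] := eqVneq (sigma x0 c k p) +oo%E.
  by rewrite sy gt0_muley ?lte_fin// leey.
have sfin : (sigma x0 c k p < +oo)%E by rewrite ltey.
pose t (j : nat) : R := j.+1%:R^-1 / 2.
have t0 j : 0 < t j by rewrite divr_gt0// invr_gt0 ltr0n.
have t1 j : t j < 1.
  by rewrite ltr_pdivrMr// mul1r (@le_lt_trans _ _ 1) ?ltr1n// invf_le1 ?ltr0n// ler1n.
pose r1 j := r + t j * (r' - r).
have rr1 j : r < r1 j by rewrite ltrDl mulr_gt0// subr_gt0.
have r1r j : r1 j < r' by rewrite -ltrBrDl gtr_pMl// subr_gt0.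
have Kr : closure (B r) `<=` [set z | psi z <= r] by rewrite closure_gauge_ball.
have hj j := capacity_le_approx n0 c0 k0 p1 r0 (rr1 j) (r1r j) (t0 j) alE dLam sfin Kr.
pose s := fine (sigma x0 c k p).
have sE : sigma x0 c k p = s%:E by rewrite fineK// ge0_fin_numE// ltW.
pose G j := (expR (t j) ^+ 2 / (Lam r' - Lam (r1 j))) `^ p * (Q * L * s).
have ct : t @ \oo --> 0.
  rewrite -(mul0r (2^-1)); apply: cvgM; last exact: cvg_cst.
  exact: cvg_harmonic.
have cr1 : r1 @ \oo --> r.
  rewrite -[X in _ --> X]addr0 -(mul0r (r' - r)); apply: cvgD; first exact: cvg_cst.
  by apply: cvgM => //; exact: cvg_cst.
have cG : G @ \oo --> Q * L `^ (1 - p) * s.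
  have -> : Q * L `^ (1 - p) * s = (1 ^+ 2 / L) `^ p * (Q * L * s).
    have -> : L `^ (1 - p) = L * L `^ (- p).
      by rewrite -{2}(powRr1 (ltW L0)) -powRD// (gt_eqF L0) implybT.
    have -> : (1 ^+ 2 / L) `^ p = L `^ (- p).
      by rewrite expr1n mul1r -(powR_inv1 (ltW L0)) -powRrM mulN1r.
    by move: (L `^ _) Q => *; ring.
  apply: cvgM; last exact: cvg_cst.
  apply: cvg_powR; first by rewrite expr1n divr_gt0.
  apply: cvgM.
    have ce : (fun j => expR (t j)) @ \oo --> (1 : R).
      by rewrite -expR0; apply: (@cvg_comp _ _ _ _ (@expR R) _ _ _ ct); exact: continuous_expR.
    by apply: cvgM.
  apply: cvgV; first by rewrite gt_eqF.
  apply: cvgB; first exact: cvg_cst.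
  apply: (@cvg_comp _ _ _ _ Lam _ _ _ cr1).
  exact: is_derive_continuous (dLam r0).
have cGE : (fun j => (G j)%:E) @ \oo --> ((Q * L `^ (1 - p))%:E * sigma x0 c k p)%E.
  rewrite sE -EFinM; apply: cvg_EFin => //; exact: nearW.
rewrite -(cvg_lim _ cGE)//; apply: lime_ge; first by apply/cvg_ex; eexists; exact: cGE.
by apply: nearW => j; have := hj j; rewrite sE -!EFinM.
Qed.

Lemma capacity_gauge : (cap = (Q * L `^ (1 - p))%:E * sigma x0 c k p)%E.
Proof. by apply/eqP; rewrite eq_le capacity_le capacity_ge. Qed.

End capacity_formula.

Lemma is_derive_powR_div (R : realType) (al x : R) : al != 0 -> 0 < x ->
  is_derive x (1 : R) (fun x => x `^ al / al) (x `^ (al - 1)).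
Proof.
move=> al0 x0; have h := is_deriveZ al^-1 (is_derive1_powR al x0).
have -> : (fun x => x `^ al / al) = al^-1 \*: (fun x => x `^ al).
  by apply/funext => y; rewrite mulrC.
by apply: is_derive_eq h _; rewrite /GRing.scale/= mulrA mulVf// mul1r.
Qed.

Theorem theorem5p1 (R : realType) (n : nat) (x0 : 'H[R]_n) (c k p r r' : R) :
  (1 <= n)%N -> c != 0 -> 0 < k -> 1 < p -> 0 < r -> r < r' ->
  let Q := (2 * n)%:R + 2 * k in
  let alpha := (Q - p) / (1 - p) in
  let sigma_ := sigma x0 c k in
  let B := gauge_ball x0 c k in
  let cap := capacity x0.1 c k p (closure (B r)) (B r') in
  [/\ (0 < sigma_ p)%E,
      (1 - 2 * k) * p < (2 * n)%:R -> (sigma_ p < +oo)%E,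
      p < Q -> cap =
        ((`|alpha| `^ (p - 1) * Q)%:E * sigma_ p
         * ((r `^ alpha - r' `^ alpha) `^ (1 - p))%:E)%E,
      p = Q -> cap =
        (Q%:E * sigma_ Q * ((ln r' - ln r) `^ (1 - Q))%:E)%E
    & Q < p -> cap =
        ((alpha `^ (p - 1) * Q)%:E * sigma_ p
         * ((r' `^ alpha - r `^ alpha) `^ (1 - p))%:E)%E].
Proof.
move=> n0 c0 k0 p1 r0 rr Q alpha sigma_ B cap.
have p1n : 1 - p < 0 by rewrite subr_lt0.
have capE (Lam : R -> R) := @capacity_gauge R n x0 c k p n0 c0 k0 p1 r r' alpha Lam r0 rr erefl.
have power (D a : R) : 0 < a -> 0 < D -> alpha != 0 ->
    (r' `^ alpha / alpha - r `^ alpha / alpha = D / a) ->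
    cap = ((a `^ (p - 1) * Q)%:E * sigma_ p * (D `^ (1 - p))%:E)%E.
  move=> a0 D0 al0 E; rewrite /cap (capE _ (fun x => is_derive_powR_div al0)) E.
  rewrite powRM ?invr_ge0 ?ltW// -powR_inv1 ?(ltW a0)// -powRrM mulN1r opprB.
  rewrite [RHS]muleAC -EFinM; congr (_%:E * _)%E.
  by rewrite mulrA mulrC mulrA.
split; first exact: sigma_gt0.
- exact: sigma_lty.
- move=> pQ; have al0 : alpha < 0 by rewrite /alpha pmulr_rlt0 ?subr_gt0// invr_lt0.
  apply: power; rewrite ?normr_gt0 ?lt_eqF//.
    rewrite subr_gt0 -[alpha]opprK !(powRN _ (- alpha)) ltf_pV2 ?posrE ?powR_gt0//; last exact: lt_trans rr.
    by rewrite gt0_ltr_powR ?nnegrE ?oppr_gt0// ltW// (lt_trans r0).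
  by rewrite ltr0_norm// invrN; field; rewrite lt_eqF.
- move=> pQ; have al0 : alpha = 0 by rewrite /alpha -pQ subrr mul0r.
  have dln (x : R) : 0 < x -> is_derive x (1 : R) (@ln R) (x `^ (alpha - 1)).
    by move=> x00; rewrite al0 sub0r powR_inv1 ?ltW//; exact: is_derive1_ln.
  by rewrite /cap (capE _ dln) -pQ EFinM [RHS]muleAC pQ.
- move=> pQ; have al0 : 0 < alpha by rewrite /alpha nmulr_rgt0 ?subr_lt0// invr_lt0.
  apply: power; rewrite ?gt_eqF//.
    by rewrite subr_gt0 gt0_ltr_powR ?nnegrE// ltW// (lt_trans r0).
  by rewrite mulrBl.
Qed.
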